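(* Let $k$ be a field and let $\alpha\ge 1$ and $d$ be integers with $2\alpha<d$. Then for every $n\ge 3$ the Poincaré series of the hypercycle algebra is $$P_{C_n^{d,\alpha}}(t)=\frac{(1+t)^{n(d-\alpha)}}{1+\sum_{1\le r\le i<n}(-1)^r\frac{n}{r}\binom{i-1}{r-1}\binom{n-i-1}{r-1}t^{i+r}-t^{n+1}},$$ and for every $n\ge 1$ the Poincaré series of the hyperline algebra is $$P_{L_n^{d,\alpha}}(t)=\frac{(1+t)^{n(d-\alpha)+\alpha}}{1+\sum_{1\le r\le i\le n}(-1)^r\binom{i-1}{r-1}\binom{n-i+1}{r}t^{i+r}}.$$
   Context: For a graded $k$-algebra $R=k[x_1,\ldots,x_N]/I$ ($I$ a homogeneous ideal, standard grading), the Poincaré series is the formal power series $P_R(t)=\sum_{i\ge 0}\dim_k \mathrm{Tor}_i^R(k,k)\,t^i$. A hypergraph $H=(V,E)$ with $V=\{x_1,\ldots,x_N\}$ and $E\subseteq 2^V$ defines the hypergraph algebra $k[x_1,\ldots,x_N]/(\prod_{x\in e}x : e\in E)$. The same symbol is used for a hypergraph and its algebra. Hyperline $L_n^{d,\alpha}$: a hypergraph with $nd-(n-1)\alpha$ vertices and $n$ edges $e_1,\ldots,e_n$, all of size $d$, such that for $i\ne j$ one has $|e_i\cap e_j|=\alpha$ if $|i-j|=1$ and $e_i\cap e_j=\emptyset$ otherwise. Hypercycle $C_n^{d,\alpha}$ ($n\ge 3$): a hypergraph with $n(d-\alpha)$ vertices, each lying in some edge, and $n$ edges $e_1,\ldots,e_n$,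 all of size $d$, such that for $i\ne j$ one has $|e_i\cap e_j|=\alpha$ if $i-j\equiv\pm1\pmod n$ and $e_i\cap e_j=\emptyset$ otherwise. Convention: $\binom{a}{b}=0$ if $b>a$. *)

(* Defs.v *)
From HB Require Import structures.
From mathcomp Require Import all_boot all_order all_algebra.
From mathcomp Require Import generic_quotient ring_quotient.
From mathcomp Require Import mpoly.
From mathcomp Require Import boolp.

Set Implicit Arguments.
Unset Strict Implicit.
Unset Printing Implicit Defensive.

Import GRing.Theory.
Local Open Scope ring_scope.
Local Open Scope quotient_scope.

(* The vertex x_(i+1) is represented by i : 'I_N.  An empty edge would make the
   algebra below the zero ring, which has no residue field k. *)
Record hypergraph (N : nat) := Hypergraph {
  edges : {set {set 'I_N}};
  edges_neq0 : set0 \notin edges }.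

Section HypergraphAlgebra.
Variables (k : fieldType) (N : nat) (H : hypergraph N).

Definition edge_monomial (e : {set 'I_N}) : {mpoly k[N]} :=
  \prod_(i in e) 'X_i.

Definition hypergraph_ideal (p : {mpoly k[N]}) : bool :=
  `[< exists c : {set 'I_N} -> {mpoly k[N]},
        p = \sum_(e in edges H) c e * edge_monomial e >].

Lemma hypergraph_idealP0 p : hypergraph_ideal p -> p@_0%MM = 0.
Proof.
case/asboolP=> c ->; rewrite raddf_sum /= big1 // => e eH.
rewrite -[RHS](mulr0 (c e)@_0%MM) rmorphM /=; congr (_ * _).
have [i ie] : exists i, i \in e.
  by apply/set0Pn; apply: contraNneq (edges_neq0 H) => <-.
by rewrite /edge_monomial rmorph_prod /= (bigD1 i) //= mcoeffX mnm1_eq0 mul0r.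
Qed.

Lemma hypergraph_idealr_closed : idealr_closed hypergraph_ideal.
Proof.
split=> [||p q q' /asboolP[c ->] /asboolP[c' ->]].
- by apply/asboolP; exists (fun=> 0); rewrite big1 // => e _; rewrite mul0r.
- by apply/negP=> /hypergraph_idealP0 /eqP; rewrite mcoeff1 eqxx oner_eq0.
apply/asboolP; exists (fun e => p * c e + c' e).
rewrite mulr_sumr -big_split; apply: eq_bigr => e _ /=.
by rewrite mulrDl mulrA.
Qed.

HB.instance Definition _ :=
  isIdealr.Build {mpoly k[N]} hypergraph_ideal hypergraph_idealr_closed.

Definition hypergraph_idealr : idealr {mpoly k[N]} := hypergraph_ideal.

Definition hypergraph_algebra : comNzRingType :=
  {ideal_quot hypergraph_idealr}.

(* The projection of R onto R / (x_1, ..., x_N) = k. *)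
Definition residue (x : hypergraph_algebra) : k :=
  (repr (x : {ideal_quot hypergraph_idealr}))@_0%MM.

Lemma residue_pi (p : {mpoly k[N]}) :
  residue (\pi_({ideal_quot hypergraph_idealr}) p) = p@_0%MM.
Proof.
apply/eqP; rewrite -subr_eq0 /residue -raddfB /=; apply/eqP.
apply: hypergraph_idealP0.
have := Quotient.idealrBE hypergraph_idealr
  (repr (\pi_({ideal_quot hypergraph_idealr}) p)) p.
by rewrite reprK eqxx.
Qed.

Lemma residue_is_zmod_morphism : zmod_morphism residue.
Proof.
move=> x y; rewrite -[x in LHS]reprK -[y in LHS]reprK.
by rewrite -(rmorphB \pi_({ideal_quot hypergraph_idealr})) residue_pi raddfB.
Qed.

Lemma residue_is_monoid_morphism : monoid_morphism residue.
Proof.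
split=> [|x y].
  rewrite -(rmorph1 \pi_({ideal_quot hypergraph_idealr})) residue_pi.
  by rewrite mcoeff1 eqxx.
rewrite -[x in LHS]reprK -[y in LHS]reprK.
by rewrite -(rmorphM \pi_({ideal_quot hypergraph_idealr})) residue_pi rmorphM.
Qed.

HB.instance Definition _ :=
  GRing.isZmodMorphism.Build hypergraph_algebra k residue
    residue_is_zmod_morphism.
HB.instance Definition _ :=
  GRing.isMonoidMorphism.Build hypergraph_algebra k residue
    residue_is_monoid_morphism.

End HypergraphAlgebra.

Section Tor.
Variables (R : comNzRingType) (k : fieldType) (eps : {rmorphism R -> k}).

(* Resolutions ... -> R^(b_1) -> R^(b_0) -> k -> 0 of k, an R-module through
   eps, by free modules of finite rank.  Elements of R^b are row vectors, on
   which matrices act from the right; an R-linear map R^b -> k has the form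
   v |-> \sum_j eps (v_j) c_j. *)
Record free_resolution := FreeResolution {
  res_rank : nat -> nat;
  res_diff : forall i, 'M[R]_(res_rank i.+1, res_rank i);
  res_aug : 'cV[k]_(res_rank 0);
  res_aug_surj : forall a : k,
    exists v : 'rV[R]_(res_rank 0), map_mx eps v *m res_aug = a%:M;
  res_exact0 : forall v : 'rV[R]_(res_rank 0),
    map_mx eps v *m res_aug = 0 <->
    exists w : 'rV[R]_(res_rank 1), v = w *m res_diff 0;
  res_exactS : forall i (v : 'rV[R]_(res_rank i.+1)),
    v *m res_diff i = 0 <->
    exists w : 'rV[R]_(res_rank i.+2), v = w *m res_diff i.+1 }.

(* The differential of F (x)_R k, whose i-th term is k^(b_i). *)
Definition tensor_diff (F : free_resolution) i :
    'M[k]_(res_rank F i.+1, res_rank F i) :=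
  map_mx eps (res_diff F i).

(* dim_k H_i(F (x)_R k) = dim_k Tor_i^R(k, k); the subtractions are not
   truncated since images are contained in kernels. *)
Definition tor_dim (F : free_resolution) (i : nat) : nat :=
  match i with
  | 0 => (res_rank F 0 - \rank (tensor_diff F 0))%N
  | j.+1 => (\rank (kermx (tensor_diff F j)) - \rank (tensor_diff F j.+1))%N
  end.

(* The formal power series \sum_i P i t^i is the Poincare series of R. *)
Definition is_poincare_series (P : nat -> nat) : Prop :=
  (exists F : free_resolution, True) /\
  (forall (F : free_resolution) i, tor_dim F i = P i).

End Tor.

(* \sum_i P i t^i = num / den in Q[[t]]. *)
Definition series_eq_frac (P : nat -> nat) (num den : {poly rat}) : Prop :=
  den`_0 != 0 /\
  forall m, \sum_(j < m.+1) (P j)%:R * den`_(m - j) = num`_m.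

Definition has_poincare_series (k : fieldType) (N : nat) (H : hypergraph N)
    (num den : {poly rat}) : Prop :=
  exists2 P : nat -> nat,
    is_poincare_series (@residue k N H) P & series_eq_frac P num den.

Definition hyperline (n d a N : nat) (H : hypergraph N) : Prop :=
  N = (n * d - (n - 1) * a)%N /\
  exists e : 'I_n -> {set 'I_N},
    [/\ injective e, edges H = [set e i | i : 'I_n],
        forall i, #|e i| = d &
        forall i j : 'I_n, i != j ->
          if (i == j.+1 :> nat) || (j == i.+1 :> nat)
          then #|e i :&: e j| = a else e i :&: e j = set0].

Definition hypercycle (n d a N : nat) (H : hypergraph N) : Prop :=
  [/\ N = (n * (d - a))%N, cover (edges H) = [set: 'I_N] &
  exists e : 'I_n -> {set 'I_N},
    [/\ injective e, edges H = [set e i | i : 'I_n],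
        forall i, #|e i| = d &
        forall i j : 'I_n, i != j ->
          if (i == j.+1 %[mod n])%N || (j == i.+1 %[mod n])%N
          then #|e i :&: e j| = a else e i :&: e j = set0]].

(* Main.v *)
Require Import Defs.
From HB Require Import structures.
From mathcomp Require Import all_boot all_order all_algebra.
From mathcomp Require Import generic_quotient ring_quotient.
From mathcomp Require Import freeg mpoly.
From mathcomp Require Import boolp.
From mathcomp Require Import zify ring.

Set Implicit Arguments.
Unset Strict Implicit.
Unset Printing Implicit Defensive.

Import GRing.Theory.
Local Open Scope ring_scope.

(** In a hyperline or hypercycle every edge has a private vertex, one that lies in no
    other edge: its neighbours cover at most 2 * a < d of its vertices.  For an edge
    ideal with this property Tor can be computed combinatorially.  Let P be a set of
    private vertices, one for each edge, and [ed p] the edge of p; a subset S of P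
    stands for a set of edges, with least common multiple m_S.

    Resolution.  Let K be the Koszul complex over the polynomial ring Q, with exterior
    basis e_A.  The elements u_S = (m_S / prod_(p in S) x_p) e_S span a differential
    graded subalgebra T of K, which is the Taylor resolution of the hypergraph
    algebra R.  The bar construction B(T, T, K) contracts onto K, and B(R, T, K) is a
    free resolution of k over R with basis the words [S_1 | ... | S_n] e_A.  All of this
    is multigraded, and in a fixed multidegree a homogeneous element is given
    by its scalars: the complexes are therefore handled as vector spaces over k,
    and monomials enter only at the end ([strand_row], [bar_resolution]).
    Exactness in a multidegree ([strand_exact]) combines the contraction of the bar
    construction ([bar_homotopy]), the acyclicity of the kernel of
    B(T, T, K) -> B(R, T, K), which is filtered by chain complexes of simplices
    ([dividing_acyclic]), and that of K ([wedge_homotopy]).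

    Tor.  The dimensions can be computed from this resolution ([tor_dim_indep]).
    Modulo the maximal ideal, all that is left of the differential is the product of
    two consecutive letters with disjoint edges ([coeff_dword_merges]): the
    other terms lose a variable, thanks to the private vertices.  A letter S is thought
    of as the commuting product of its connected components for the graph of the
    edges that meet; then all the products leave the trace of a word unchanged, that is
    its class in the monoid generated by the connected sets, where two of
    them commute if none of their edges meet.  Splitting off or
    attaching the least possible first letter of the trace is an acyclic matching of the
    words ([matching_rank], [key_triang]), whose critical words consist of a normal form
    of a trace, and of A.  So Tor_i has as dimension the number of pairs of a trace
    and a set A of total degree i ([tor_dim_res]), where a connected set C has degree
    #|C| + 1.  By the inversion formula of Cartier and Foata ([crit_count_series])
    the Poincare series is (1 + t)^N divided by the sum over S of (-1)^c t^(#|S| + c),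
    where c is the number of components of S ([private_vertices_poincare]).

    Counting.  The edges of a hyperline form a path and those of a hypercycle a cycle.
    Components of a set of edges are runs, so that the denominators count bit
    strings by their ones and runs ([path_runs_sum], [cycle_runs_sum]).  The
    exception is the set of all n edges of a cycle, a single component without ends,
    which yields the term -t^(n+1). *)

(** * Finitely supported formal sums *)

Section FormalSums.
Variables (k : fieldType) (B : choiceType).
Implicit Types (x y : {freeg B / k}) (Q : B -> Prop) (b : B).

Lemma fglift_is_linear (M : lmodType k) (f : B -> M) : linear (fglift f).
Proof.
have lD : additive (fglift f) by exact: lift_is_additive.
have l0 : fglift f 0 = 0 by have := lD 0 0; rewrite !subrr.
have lN z : fglift f (- z) = - fglift f z by rewrite -sub0r lD l0 sub0r.
have lA z z' : fglift f (z + z') = fglift f z + fglift f z'.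
  by rewrite -[z' in LHS]opprK lD lN opprK.
have lS (r : seq B) (F : B -> {freeg B / k}) :
    fglift f (\sum_(b <- r) F b) = \sum_(b <- r) fglift f (F b).
  by elim: r => [|b r IH]; rewrite ?big_nil // !big_cons lA IH.
move=> c x y; rewrite lA; congr (_ + _).
rewrite -[X in c *: fglift f X]freeg_sumE lS scaler_sumr.
have -> : c *: x = \sum_(b <- dom x) << c * coeff b x *g b >> by [].
rewrite lS; apply: eq_bigr => b _; rewrite !liftU scalerA.
by [].
Qed.

HB.instance Definition _ (M : lmodType k) (f : B -> M) :=
  GRing.isLinear.Build k {freeg B / k} M _ (fglift f) (fglift_is_linear f).

Definition delta b : {freeg B / k} := << b >>.

Lemma coeff_delta b c : coeff c (delta b) = (b == c)%:R.
Proof. by rewrite coeffU mul1r. Qed.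

Lemma fglift_delta (M : lmodType k) (f : B -> M) b : fglift f (delta b) = f b.
Proof. by rewrite liftU scale1r. Qed.

Lemma freegE x : x = \sum_(b <- dom x) coeff b x *: delta b.
Proof.
rewrite -[LHS]freeg_sumE; apply: eq_bigr => b _.
by apply/eqP/freeg_eqP => b'; rewrite coeffZ coeff_delta coeffU.
Qed.

Lemma coeff_sum (I : Type) (r : seq I) (P : pred I) (F : I -> {freeg B / k}) b :
  coeff b (\sum_(i <- r | P i) F i) = \sum_(i <- r | P i) coeff b (F i).
Proof. by rewrite raddf_sum. Qed.

Definition supported Q x : Prop := forall b, coeff b x != 0 -> Q b.

Lemma supported_ind Q (P : {freeg B / k} -> Prop) :
  P 0 ->
  (forall c b x, Q b -> supported Q x -> P x -> P (c *: delta b + x)) ->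
  forall x, supported Q x -> P x.
Proof.
move=> P0 PS x Qx; rewrite [x]freegE.
have: {in dom x, forall b, Q b} by move=> b; rewrite mem_dom; apply: Qx.
elim: (dom x) => [|b s IH] Qs; first by rewrite big_nil.
have Qs' : {in s, forall b, Q b} by move=> c cs; apply: Qs; rewrite inE cs orbT.
rewrite big_cons; apply: PS; [by apply: Qs; rewrite inE eqxx| |exact: IH].
move=> c; rewrite coeff_sum => nz.
have [cs|cs] := boolP (c \in s); first exact: Qs'.
case/eqP: nz; rewrite big_seq big1 // => d ds.
rewrite coeffZ coeff_delta; case: eqP => [dc|]; last by rewrite !mulr0.
by rewrite -dc ds in cs.
Qed.

Lemma supported0 Q : supported Q 0.
Proof. by move=> b; rewrite coeff0 eqxx. Qed.

Lemma supportedD Q x y : supported Q x -> supported Q y -> supported Q (x + y).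
Proof.
move=> Qx Qy b; rewrite coeffD; have [->|/Qx //] := eqVneq (coeff b x) 0.
by rewrite add0r; apply: Qy.
Qed.

Lemma supportedZ Q c x : supported Q x -> supported Q (c *: x).
Proof. by move=> Qx b; rewrite coeffZ mulf_eq0 negb_or => /andP[_]; apply: Qx. Qed.

Lemma supportedN Q x : supported Q x -> supported Q (- x).
Proof. by move=> Qx b; rewrite coeffN oppr_eq0; apply: Qx. Qed.

Lemma supportedB Q x y : supported Q x -> supported Q y -> supported Q (x - y).
Proof. by move=> Qx Qy; apply: supportedD => //; apply: supportedN. Qed.

Lemma supported_delta Q b : Q b -> supported Q (delta b).
Proof.
by move=> Qb c; rewrite coeff_delta; case: (b =P c) => [<- //|_]; rewrite eqxx.
Qed.

Lemma supported_sum Q (I : eqType) (r : seq I) (P : pred I)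
    (F : I -> {freeg B / k}) :
  (forall i, i \in r -> P i -> supported Q (F i)) ->
  supported Q (\sum_(i <- r | P i) F i).
Proof.
move=> QF; rewrite big_seq_cond.
apply: (big_ind (supported Q)); [exact: supported0|exact: supportedD|].
by move=> i /andP[]; apply: QF.
Qed.

Lemma supportedW Q Q' x :
  (forall b, Q b -> Q' b) -> supported Q x -> supported Q' x.
Proof. by move=> QQ' Qx b /Qx/QQ'. Qed.

Lemma freeg0P x : (forall b, coeff b x = 0) -> x = 0.
Proof. by move=> x0; apply/eqP/freeg_eqP => b; rewrite x0 coeff0. Qed.

End FormalSums.
Arguments delta {k B} b.

Lemma supported_lift (k : fieldType) (B B' : choiceType) (Q : B -> Prop)
    (Q' : B' -> Prop) (f : B -> {freeg B' / k}) (x : {freeg B / k}) :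
  (forall b, Q b -> supported Q' (f b)) -> supported Q x ->
  supported Q' (fglift f x).
Proof.
move=> Qf; elim/supported_ind => [|c b y Qb _ Qy]; first by rewrite linear0; exact: supported0.
by rewrite linearP /= fglift_delta; apply: supportedD => //; apply: supportedZ; apply: Qf.
Qed.

Lemma eq_on_supported (k : fieldType) (B : choiceType) (M : lmodType k)
    (Q : B -> Prop) (f g : {freeg B / k} -> M) :
  linear f -> linear g -> (forall b, Q b -> f (delta b) = g (delta b)) ->
  forall x, supported Q x -> f x = g x.
Proof.
move=> lf lg fg x.
have f0 : f 0 = 0 by have := lf (-1) 0 0; rewrite scaler0 addr0 scaleN1r addNr.
have g0 : g 0 = 0 by have := lg (-1) 0 0; rewrite scaler0 addr0 scaleN1r addNr.
elim/supported_ind => [|c b y Qb _ IH]; first by rewrite f0 g0.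
by rewrite lf lg fg // IH.
Qed.

(** * Signs of the exterior algebra *)

Lemma big_disjointU (R : Type) (idx : R) (op : Monoid.com_law idx)
    (I : finType) (A B : {set I}) (F : I -> R) : [disjoint A & B] ->
  \big[op/idx]_(i in A :|: B) F i =
  op (\big[op/idx]_(i in A) F i) (\big[op/idx]_(i in B) F i).
Proof. by move=> dAB; rewrite -bigU //; apply: eq_bigl => i; rewrite !inE. Qed.

Section ExteriorSigns.
Variables (k : fieldType) (N : nat).
Implicit Types (S T U : {set 'I_N}) (a b : 'I_N).

Definition below a S : nat := (\sum_(b in S) (b < a))%N.
Definition above a S : nat := (\sum_(b in S) (a < b))%N.
Definition inversions T S : nat := (\sum_(t in T) below t S)%N.

Lemma sign_parity m n : odd m = odd n -> (-1) ^+ m = (-1) ^+ n :> k.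
Proof. by move=> mn; rewrite -(signr_odd k m) mn signr_odd. Qed.

(** In the exterior algebra, e_T e_S = ext T S *: e_(T :|: S), and the Koszul
    differential of e_S is the sum over a in S of sg a S *: x_a e_(S :\ a). *)
Definition sg a S : k := (-1) ^+ below a S.
Definition ext T S : k :=
  if [disjoint T & S] then (-1) ^+ inversions T S else 0.

Lemma belowU a S T : [disjoint S & T] -> below a (S :|: T) = (below a S + below a T)%N.
Proof. exact: big_disjointU. Qed.

Lemma belowD1 a b S : b \in S -> below a S = ((b < a) + below a (S :\ b))%N.
Proof. exact: big_setD1. Qed.

Lemma inversionsUl T T' S : [disjoint T & T'] ->
  inversions (T :|: T') S = (inversions T S + inversions T' S)%N.
Proof. exact: big_disjointU. Qed.

Lemma inversionsUr T S S' : [disjoint S & S'] ->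
  inversions T (S :|: S') = (inversions T S + inversions T S')%N.
Proof.
move=> dSS'; rewrite /inversions -big_split; apply: eq_bigr => t _.
exact: belowU.
Qed.

Lemma inversions1l a T S : a \in T ->
  inversions T S = (below a S + inversions (T :\ a) S)%N.
Proof. exact: big_setD1. Qed.

Lemma inversions1r a T S : a \in S ->
  inversions T S = (above a T + inversions T (S :\ a))%N.
Proof.
move=> aS; rewrite /inversions /above -big_split; apply: eq_bigr => t _.
exact: belowD1.
Qed.

Lemma below_above a S : a \notin S -> (below a S + above a S)%N = #|S|.
Proof.
move=> aS; rewrite -sum1_card -big_split; apply: eq_bigr => b bS /=.
by case: ltngtP => //= /val_inj ba; rewrite -ba bS in aS.
Qed.

Lemma ext0l S : ext set0 S = 1.
Proof. by rewrite /ext -setI_eq0 set0I eqxx /inversions big_set0. Qed.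

Lemma ext0r T : ext T set0 = 1.
Proof.
rewrite /ext -setI_eq0 setI0 eqxx /inversions big1 // => t _.
by rewrite /below big_set0.
Qed.

Lemma ext_neq0 T S : (ext T S != 0) = [disjoint T & S].
Proof. by rewrite /ext; case: ifP; rewrite ?eqxx ?signr_eq0. Qed.

Lemma ext_eq0 T S : ~~ [disjoint T & S] -> ext T S = 0.
Proof. by rewrite /ext => /negPf->. Qed.

Lemma disjointUl T T' S :
  [disjoint T :|: T' & S] = [disjoint T & S] && [disjoint T' & S].
Proof. by rewrite -!setI_eq0 setIUl setU_eq0. Qed.

Lemma disjointUr T S S' :
  [disjoint T & S :|: S'] = [disjoint T & S] && [disjoint T & S'].
Proof. by rewrite -!setI_eq0 setIUr setU_eq0. Qed.

Lemma extA T T' S :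
  ext T T' * ext (T :|: T') S = ext T' S * ext T (T' :|: S).
Proof.
rewrite /ext disjointUl disjointUr.
case dTT': [disjoint T & T']; case dTS: [disjoint T & S];
  case dT'S: [disjoint T' & S]; rewrite ?mul0r ?mulr0 //=.
rewrite -!exprD inversionsUl // inversionsUr //; congr (_ ^+ _).
by rewrite addnA addnC.
Qed.

Section Leibniz.
Variables (M : lmodType k) (f : {set 'I_N} -> M).

Let leibniz_disjoint T S : [disjoint T & S] ->
  ext T S *: (\sum_(a in T :|: S) sg a (T :|: S) *: f ((T :|: S) :\ a)) =
  \sum_(a in T) sg a T *: (ext (T :\ a) S *: f (T :\ a :|: S)) +
  (-1) ^+ #|T| *: \sum_(a in S) sg a S *: (ext T (S :\ a) *: f (T :|: (S :\ a))).
Proof.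
move=> dTS; rewrite big_disjointU //= scalerDr !scaler_sumr; congr (_ + _).
  apply: eq_bigr => a aT; have aS : a \notin S by rewrite (disjointFr dTS).
  rewrite !scalerA setDUl (setDidPl (_ : [disjoint S & [set a]])); last first.
    by rewrite disjoint_sym disjoints1.
  congr (_ *: _); rewrite /ext dTS (disjointWl (subsetDl _ _) dTS) /sg.
  rewrite belowU // (inversions1l S aT) -!exprD.
  apply: sign_parity; rewrite !oddD.
  move: (odd (below a T)) (odd (below a S)) (odd (inversions (T :\ a) S)).
  by move=> [] [] [].
apply: eq_bigr => a aS; have aT : a \notin T by rewrite (disjointFl dTS).
rewrite !scalerA setDUl (setDidPl (_ : [disjoint T & [set a]])); last first.
  by rewrite disjoint_sym disjoints1.
congr (_ *: _); rewrite /ext dTS (disjointWr (subsetDl _ _) dTS) /sg.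
rewrite belowU // (inversions1r T aS) -!exprD.
apply: sign_parity; rewrite -(below_above aT) !oddD.
move: (odd (below a T)) (odd (above a T)) (odd (inversions T (S :\ a))).
by move: (odd (below a S)) => [] [] [] [].
Qed.

(** The Koszul differential is a graded derivation of the exterior algebra.
    When T and S meet, the left-hand side vanishes, and the right-hand side can
    be non-zero only if they meet in one point c, in which case removing c from T
    and removing it from S contribute opposite signs. *)
Lemma leibniz T S :
  ext T S *: (\sum_(a in T :|: S) sg a (T :|: S) *: f ((T :|: S) :\ a)) =
  \sum_(a in T) sg a T *: (ext (T :\ a) S *: f (T :\ a :|: S)) +
  (-1) ^+ #|T| *: \sum_(a in S) sg a S *: (ext T (S :\ a) *: f (T :|: (S :\ a))).
Proof.
have [dTS|ndTS] := boolP [disjoint T & S]; first exact: leibniz_disjoint.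
rewrite (ext_eq0 ndTS) scale0r.
have [c /setIP[cT cS]] : exists c, c \in T :&: S.
  by apply/set0Pn; rewrite setI_eq0.
have l0 a : a != c -> ext (T :\ a) S = 0.
  move=> ac; apply: ext_eq0; rewrite -setI_eq0; apply/set0Pn; exists c.
  by rewrite !inE eq_sym ac cT cS.
have r0 a : a != c -> ext T (S :\ a) = 0.
  move=> ac; apply: ext_eq0; rewrite -setI_eq0; apply/set0Pn; exists c.
  by rewrite !inE eq_sym ac cT cS.
rewrite (bigD1 c) //= big1 => [|a /andP[_ /l0->]]; last by rewrite scale0r scaler0.
rewrite (bigD1 c) //= big1 => [|a /andP[_ /r0->]]; last by rewrite scale0r scaler0.
have -> : T :\ c :|: S = T :|: S.
  by apply/setP => x; rewrite !inE; case: (x =P c) => [->|//]; rewrite cS !orbT.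
have -> : T :|: (S :\ c) = T :|: S.
  by apply/setP => x; rewrite !inE; case: (x =P c) => [->|//]; rewrite cT.
rewrite !addr0 !scalerA -scalerDl /ext.
have -> : [disjoint T :\ c & S] = [disjoint T & S :\ c].
  rewrite -!setI_eq0; congr (_ == _); apply/setP => x; rewrite !inE.
  by case: (x == c); rewrite ?andbF.
case: ifP => _; last by rewrite !mulr0 addr0 scale0r.
rewrite /sg -!exprD.
have cT' : c \notin T :\ c by rewrite !inE eqxx.
have := below_above cT'; rewrite (inversions1r (T :\ c) cS) (inversions1l (S :\ c) cT).
rewrite (belowD1 c cS) (belowD1 c cT) (cardsD1 c T) cT ltnn !add0n => <-.
set u := (_ + _)%N; set v := (_ + _)%N.
have odd_uv : odd v = ~~ odd u.
  rewrite /u /v !oddD.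
  move: (odd (below c (T :\ c))) (odd (above c (T :\ c))) (odd (below c (S :\ c))).
  by move: (odd (inversions (T :\ c) (S :\ c))) => [] [] [] [].
have -> : (-1) ^+ v = - (-1) ^+ u :> k.
  by rewrite -(signr_odd k v) odd_uv signrN signr_odd.
by rewrite subrr scale0r.
Qed.

Lemma koszul_dd S :
  \sum_(a in S) sg a S *: \sum_(b in S :\ a) sg b (S :\ a) *: f (S :\ a :\ b) = 0.
Proof.
pose F a b := (sg a S * sg b (S :\ a)) *: f (S :\ a :\ b).
have skew a b : a \in S -> b \in S -> (a < b)%N -> F b a = - F a b.
  move=> aS bS ab; rewrite /F -scaleNr setDDl setUC -setDDl; congr (_ *: _).
  rewrite /sg (belowD1 b aS) (belowD1 a bS) ab ltnNge (ltnW ab) add0n add1n.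
  by rewrite exprS mulN1r mulNr mulrC.
have -> : \sum_(a in S) sg a S *: \sum_(b in S :\ a) sg b (S :\ a) *: f (S :\ a :\ b) =
   \sum_(a in S) \sum_(b in S | (a < b)%N) F a b + \sum_(a in S) \sum_(b in S | (b < a)%N) F a b.
  rewrite -big_split; apply: eq_bigr => a aS /=; rewrite scaler_sumr.
  rewrite (bigID (fun b => (a < b)%N)) /=; congr (_ + _).
    apply: eq_big => [b|b _]; last by rewrite scalerA.
    by rewrite !inE -val_eqE /=; case: ltngtP; rewrite ?andbF.
  apply: eq_big => [b|b _]; last by rewrite scalerA.
  by rewrite !inE -val_eqE /=; case: ltngtP; rewrite ?andbF ?andbT.
rewrite [X in _ + X](exchange_big_dep (fun b => b \in S)) /=; last by move=> a b _ /andP[].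
rewrite -big_split /= big1 // => a aS; rewrite -[RHS](subrr (\sum_(b in S | (a < b)%N) F a b)).
congr (_ + _); rewrite -sumrN; apply: eq_big => [b|b /andP[bS ab]]; first by rewrite aS.
by case/andP: ab => _; apply: skew.
Qed.

End Leibniz.
End ExteriorSigns.

(** * The bar construction *)

Ltac freeg_ring :=
  apply/eqP/freeg_eqP => ?; rewrite ?(coeffD, coeffN, coeffZ); ring.
Ltac solve_linear := move=> ? ? ?; rewrite ?linearP /=; freeg_ring.

Section BarConstruction.
Variables (k : fieldType) (N : nat).
Implicit Types (S T A : {set 'I_N}).

Notation word := (seq {set 'I_N} * {set 'I_N})%type.
Notation ybase := ({set 'I_N} * word)%type.
Notation CW := {freeg word / k}.
Notation CY := {freeg ybase / k}.
Notation ext := (ext k).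
Notation sg := (sg k).
Implicit Types (w : seq {set 'I_N}) (v : word) (x : CW) (y : CY).

(** Over the polynomial ring, let m_S be the least common multiple of the edges of S
    and u_S = (m_S / prod_(p in S) x_p) e_S.  These elements of the Koszul complex K
    span a differential graded subalgebra T, the Taylor resolution of the
    hypergraph algebra.  A word ([:: S_1; ...; S_n], A) stands for the element
    [u_(S_1) | ... | u_(S_n)] e_A of the bar construction of T with coefficients in K,
    and a pair (S, v) for the element u_S v of the bar construction B(T, T, K).
    In a given multidegree the monomial coefficients are determined, so that only
    scalars are recorded.  Here x is sent to u_S x. *)
Definition inF S : CW -> CY := fglift (fun v : word => (delta (S, v))).
HB.instance Definition _ S := GRing.isLinear.Build k CW CY _ (inF S) (fglift_is_linear _).

(** Multiplication by u_T. *)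
Definition lm T : CY -> CY :=
  fglift (fun b : ybase => ext T b.1 *: (delta (T :|: b.1, b.2))).
HB.instance Definition _ T := GRing.isLinear.Build k CY CY _ (lm T) (fglift_is_linear _).

(** The part of the differential of B(T, T, K) that acts on the factor u_S. *)
Definition d0 : CY -> CY := fglift (fun b : ybase =>
  \sum_(a in b.1) sg a b.1 *: (delta (b.1 :\ a, b.2))).
HB.instance Definition _ := GRing.isLinear.Build k CY CY _ d0 (fglift_is_linear _).

(** The face of the word v that moves its first letter out of the brackets. *)
Definition front v : CY :=
  if v.1 is T :: w then (delta (T, (w, v.2))) else 0.

(** The extra degeneracy of B(T, T, K), which moves the factor u_S into the brackets.
    The bar construction is normalized: u_set0 is the unit. *)
Definition bar : CY -> CW := fglift (fun b : ybase =>
  if b.1 == set0 then 0 else (delta (b.1 :: b.2.1, b.2.2))).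
HB.instance Definition _ := GRing.isLinear.Build k CY CW _ bar (fglift_is_linear _).

(** The augmentation of B(T, T, K) to K, given by the product T * K -> K. *)
Definition act : CY -> CW := fglift (fun b : ybase =>
  if b.2.1 is [::] then ext b.1 b.2.2 *: (delta ([::], b.1 :|: b.2.2))
  else 0).
HB.instance Definition _ := GRing.isLinear.Build k CY CW _ act (fglift_is_linear _).

(** The differential of a word, without the faces that carry a letter out on the left.
    Rather than given by a formula for the faces, it is read off from the requirement
    that [bar] be a contraction, see [bar_homotopy]. *)
Fixpoint dword w A : CW :=
  if w is T :: w' then
    - act (delta (T, (w', A)))
    - bar (d0 (delta (T, (w', A)))
           + (-1) ^+ #|T| *: lm T (front (w', A) + inF set0 (dword w' A)))
  else \sum_(a in A) sg a A *: (delta ([::], A :\ a)).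

(** The differential of u_set0 v in B(T, T, K). *)
Definition d1 v : CY := front v + inF set0 (dword v.1 v.2).

Definition dY : CY -> CY := fglift (fun b : ybase =>
  d0 (delta b) + (-1) ^+ #|b.1| *: lm b.1 (d1 b.2)).
HB.instance Definition _ := GRing.isLinear.Build k CY CY _ dY (fglift_is_linear _).

(** On words alone, the differential squares to zero only up to multiples of edges
    ([dX_dX]): it becomes a differential over the hypergraph algebra, to which T maps
    by sending u_S to 0 unless S is empty. *)
Definition dX : CW -> CW := fglift (fun v : word => dword v.1 v.2).
HB.instance Definition _ := GRing.isLinear.Build k CW CW _ dX (fglift_is_linear _).

(** Multiplication by the differential of u_T. *)
Definition dl T y : CY := \sum_(a in T) sg a T *: lm (T :\ a) y.
Fact dl_is_linear T : linear (dl T).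
Proof.
move=> c x y; rewrite /dl scaler_sumr -big_split; apply: eq_bigr => a _ /=.
by rewrite linearP; freeg_ring.
Qed.
HB.instance Definition _ T := GRing.isLinear.Build k CY CY _ (dl T) (dl_is_linear T).

Definition nonempty_letters w := all (fun S => S != set0) w.
Definition nonempty_ybase (b : ybase) : Prop := nonempty_letters b.2.1.

Lemma linear_ext (B : choiceType) (M : lmodType k) (f g : {freeg B / k} -> M) :
  linear f -> linear g -> (forall b, f (delta b) = g (delta b)) -> f =1 g.
Proof.
by move=> lf lg fg x; apply: (@eq_on_supported _ _ _ (fun=> True)) => // b _; apply: fg.
Qed.

Lemma inFE S v : inF S (delta v) = (delta (S, v)).
Proof. exact: fglift_delta. Qed.

Lemma lmE T S v : lm T (delta (S, v)) = ext T S *: (delta (T :|: S, v)).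
Proof. exact: fglift_delta. Qed.

Lemma d0E S v : d0 (delta (S, v)) =
  \sum_(a in S) sg a S *: (delta (S :\ a, v)).
Proof. exact: fglift_delta. Qed.

Lemma barE S w A : bar (delta (S, (w, A))) =
  if S == set0 then 0 else (delta (S :: w, A)).
Proof. exact: fglift_delta. Qed.

Lemma actE S w A : act (delta (S, (w, A))) =
  if w is [::] then ext S A *: (delta ([::], S :|: A)) else 0.
Proof. exact: fglift_delta. Qed.

Lemma dYE S v : dY (delta (S, v)) =
  d0 (delta (S, v)) + (-1) ^+ #|S| *: lm S (d1 v).
Proof. exact: fglift_delta. Qed.

Lemma dword_cons S w A : dword (S :: w) A =
  - act (delta (S, (w, A))) - bar (dY (delta (S, (w, A)))).
Proof. by rewrite dYE. Qed.

Lemma dXE w A : dX (delta (w, A)) = dword w A.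
Proof. exact: fglift_delta. Qed.

Lemma lm0 y : lm set0 y = y.
Proof.
apply: (linear_ext (g := idfun)); [exact: linearP|by []|].
by case=> S v; rewrite lmE ext0l set0U scale1r.
Qed.

Lemma lmM T T' y : lm T (lm T' y) = ext T T' *: lm (T :|: T') y.
Proof.
apply: (linear_ext (f := fun y => lm T (lm T' y))
  (g := fun y => ext T T' *: lm (T :|: T') y)); [solve_linear|solve_linear|].
case=> S v; rewrite !lmE linearZ /=; rewrite lmE !scalerA extA setUA mulrC //.
Qed.

Lemma lm_inF S x : lm S (inF set0 x) = inF S x.
Proof.
apply: (linear_ext (f := fun x => lm S (inF set0 x))); [solve_linear|exact: linearP|].
by move=> v; rewrite !inFE lmE ext0r setU0 scale1r.
Qed.

Lemma d0_lm T y : d0 (lm T y) = dl T y + (-1) ^+ #|T| *: lm T (d0 y).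
Proof.
apply: (linear_ext (f := fun y => d0 (lm T y))
  (g := fun y => dl T y + (-1) ^+ #|T| *: lm T (d0 y))); [solve_linear|solve_linear|].
case=> S v; rewrite lmE linearZ /= !d0E.
rewrite (leibniz (fun U => (delta (U, v)))); congr (_ + _ *: _).
  by apply: eq_bigr => a _; rewrite lmE.
rewrite linear_sum; apply: eq_bigr => a _; by rewrite [in RHS]linearZ /= lmE.
Qed.

Lemma dl_dl S y : \sum_(a in S) sg a S *: dl (S :\ a) y = 0.
Proof. exact: (koszul_dd (fun U => lm U y)). Qed.

Lemma dY_lm T y : dY (lm T y) = dl T y + (-1) ^+ #|T| *: lm T (dY y).
Proof.
apply: (linear_ext (f := fun y => dY (lm T y))
  (g := fun y => dl T y + (-1) ^+ #|T| *: lm T (dY y))); [solve_linear|solve_linear|].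
case=> S v; rewrite dYE linearD linearZ /= scalerDr addrA -d0_lm lmM !lmE.
rewrite !linearZ /= dYE scalerDr; congr (_ + _); rewrite !scalerA.
have [dTS|ndTS] := boolP [disjoint T & S]; last by rewrite (ext_eq0 _ ndTS) !(mul0r, mulr0).
have /eqP-> : #|T :|: S| == (#|T| + #|S|)%N.
  by have /leqifP := leq_card_setU T S; rewrite dTS.
by rewrite exprD; congr (_ *: _); ring.
Qed.

Lemma dY_inF v : dY (inF set0 (delta v)) = d1 v.
Proof.
by rewrite inFE dYE d0E big_set0 cards0 expr0 scale1r lm0 add0r.
Qed.

Lemma bar_inF x : bar (inF set0 x) = 0.
Proof.
apply: (linear_ext (f := fun x => bar (inF set0 x)) (g := fun=> 0)).
- solve_linear.
- by move=> c u u'; rewrite [RHS]addr0 scaler0.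
by case=> w A; rewrite inFE barE eqxx.
Qed.

Lemma act_inF v : act (inF set0 (delta v)) = if v.1 is [::] then (delta v) else 0.
Proof.
by case: v => [[|S w] A]; rewrite inFE actE //= ext0l set0U scale1r.
Qed.

(** [bar] contracts the bar resolution onto the Koszul complex: this is how the
    differential of a word was chosen. *)
Lemma bar_homotopy y : supported nonempty_ybase y ->
  dY (inF set0 (bar y)) + inF set0 (bar (dY y)) = y - inF set0 (act y).
Proof.
apply: (eq_on_supported (f := fun y => dY (inF set0 (bar y)) + inF set0 (bar (dY y)))
  (g := fun y => y - inF set0 (act y))); [solve_linear|solve_linear|].
case=> S [w A]; rewrite /nonempty_ybase /= => nw; rewrite barE.
have [->|S0] := eqVneq S set0.
  rewrite !linear0 add0r -[X in dY X]inFE -[in RHS]inFE dY_inF /d1 linearD /=.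
  rewrite bar_inF addr0 act_inF /front; case: w nw => [|T w] nw /=.
    by rewrite !linear0 subrr.
  rewrite linear0 subr0 barE; case/andP: nw => /negPf-> _.
  by rewrite !inFE.
rewrite dY_inF /d1 /front /= -/(dYE _ _) linearB linearN /=.
rewrite -[d0 _ + _](dYE S (w, A)); freeg_ring.
Qed.

End BarConstruction.

(** * Degrees and multidegrees *)

Section Multidegree.
Variables (k : fieldType) (N : nat) (P : {set 'I_N}) (ed : 'I_N -> {set 'I_N}).
Hypothesis ed_self : forall p, p \in P -> p \in ed p.
Implicit Types (S T A : {set 'I_N}) (x : 'I_N) (m : 'I_N -> nat) (i : nat).

Notation word := (seq {set 'I_N} * {set 'I_N})%type.
Notation ybase := ({set 'I_N} * word)%type.
Notation CW := {freeg word / k}.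
Notation CY := {freeg ybase / k}.
Implicit Types (w : seq {set 'I_N}) (v : word) (b : ybase).

(** The support of the square-free monomial m_S. *)
Definition span S : {set 'I_N} := \bigcup_(p in S) ed p.

Lemma spanU S T : span (S :|: T) = span S :|: span T.
Proof. exact: bigcup_setU. Qed.

Lemma span_sub S T : S \subset T -> span S \subset span T.
Proof. by move=> /setUidPr <-; rewrite spanU subsetUl. Qed.

Lemma sub_span S : S \subset P -> S \subset span S.
Proof.
move=> SP; apply/subsetP => p pS; apply/bigcupP; exists p => //.
exact/ed_self/(subsetP SP).
Qed.

Lemma span0 : span set0 = set0.
Proof. exact: big_set0. Qed.

(** The exponent of x in the multidegree of a word or of a pair, and their degrees. *)
Definition wt v x : nat := (\sum_(S <- v.1) (x \in span S) + (x \in v.2))%N.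
Definition wty b x : nat := ((x \in span b.1) + wt b.2 x)%N.
Definition dg v : nat := (\sum_(S <- v.1) #|S|.+1 + #|v.2|)%N.
Definition dgy b : nat := (#|b.1| + dg b.2)%N.

Definition letter S : bool := (S != set0) && (S \subset P).
Definition letters w := all letter w.

(** The basis elements of degree i whose multidegree divides x^m: multiplied by the
    quotient of the monomials, they form the basis of the part of multidegree m of
    the complexes over the polynomial ring. *)
Definition inW m i v : Prop :=
  [/\ letters v.1, dg v = i & forall x, (wt v x <= m x)%N].
Definition inY m i b : Prop :=
  [/\ letters b.2.1 && (b.1 \subset P), dgy b = i & forall x, (wty b x <= m x)%N].

Lemma wt_nil A x : wt ([::], A) x = (x \in A).
Proof. by rewrite /wt big_nil. Qed.

Lemma wt_cons S w A x : wt (S :: w, A) x = ((x \in span S) + wt (w, A) x)%N.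
Proof. by rewrite /wt big_cons addnA. Qed.

Lemma dg_cons S w A : dg (S :: w, A) = (#|S|.+1 + dg (w, A))%N.
Proof. by rewrite /dg big_cons addnA. Qed.

Lemma letter_gt0 S : letter S -> (0 < #|S|)%N.
Proof. by case/andP=> S0 _; rewrite card_gt0. Qed.

Lemma dg_eq0 w A : letters w -> dg (w, A) = 0%N -> w = [::] /\ A = set0.
Proof.
case: w => [|S w] _; last by rewrite dg_cons.
by rewrite /dg big_nil add0n => /eqP; rewrite cards_eq0 => /eqP.
Qed.

Lemma cardsU_disjoint (I : finType) (S T : {set I}) : [disjoint S & T] -> #|S :|: T| = (#|S| +
  #|T|)%N.
Proof. by move=> dST; apply/eqP; have /leqifP := leq_card_setU S T; rewrite dST. Qed.

Lemma in_setUn S T x : ((x \in S :|: T) <= (x \in S) + (x \in T))%N.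
Proof. by rewrite inE; case: (x \in S); case: (x \in T). Qed.

Lemma in_subn S T x : S \subset T -> ((x \in S) <= (x \in T))%N.
Proof. by move=> /subsetP ST; case: (boolP (x \in S)) => // /ST ->. Qed.

Lemma inW_W m m' i v : (forall x, m x <= m' x)%N -> inW m i v -> inW m' i v.
Proof. by move=> mm' [? ? wm]; split=> // x; apply: leq_trans (mm' x). Qed.

(** Over the polynomial ring all the maps preserve multidegrees; after erasing the
    monomials, this says that multidegrees can only go down. *)
Lemma supported_lm m i S (y : CY) j m' : S \subset P -> (#|S| + j = i)%N ->
  (forall x, (x \in span S) + m' x <= m x)%N ->
  supported (inY m' j) y -> supported (inY m i) (lm S y).
Proof.
move=> SP Sji Sm; apply: supported_lift => -[T v] [/andP[/= lv TP] dTv wTv].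
have [dST|ndST] := boolP [disjoint S & T]; last first.
  by rewrite (ext_eq0 _ ndST) scale0r; apply: supported0.
apply: supportedZ; apply: supported_delta; split=> /=.
- by rewrite lv subUset SP TP.
- by rewrite /dgy /= cardsU_disjoint // -addnA -Sji -dTv.
move=> x; apply: leq_trans (Sm x); apply: leq_trans (leq_add (leqnn _) (wTv x)).
by rewrite /wty /= addnA leq_add2r spanU in_setUn.
Qed.

Lemma supported_inF m i (z : CW) :
  supported (inW m i) z -> supported (inY m i) (inF set0 z).
Proof.
apply: (supported_lift (f := fun v => delta (set0, v))) => -[w A] [lw dw ww];
  apply: supported_delta; split=> //.
- by rewrite /= lw sub0set.
- by rewrite /dgy /= cards0.
by move=> x; rewrite /wty /= span0 inE; apply: ww.
Qed.

Lemma supported_bar m i (y : CY) :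
  supported (inY m i) y -> supported (inW m i.+1) (bar y).
Proof.
apply: supported_lift => -[S [w A]] [/andP[/= lw SP] dw ww].
case: eqVneq => [|S0]; first by move=> _; apply: supported0.
apply: supported_delta; split=> /=; first by rewrite lw /letter S0 SP.
  by rewrite dg_cons -dw.
by move=> x; rewrite wt_cons; apply: ww.
Qed.

Lemma supported_act m i (y : CY) :
  supported (inY m i) y -> supported (inW m i) (act y).
Proof.
apply: supported_lift => -[S [w A]] [/andP[/= lw SP] dw ww].
case: w lw dw ww => [|T w] lw dw ww; last exact: supported0.
have [dST|ndST] := boolP [disjoint S & A]; last first.
  by rewrite (ext_eq0 _ ndST) scale0r; apply: supported0.
apply: supportedZ; apply: supported_delta; split=> //=.
  rewrite -dw /dgy /dg /= !big_nil !add0n; exact: cardsU_disjoint.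
move=> x; apply: leq_trans (ww x); rewrite /wty /wt /= !big_nil !add0n.
apply: leq_trans (in_setUn _ _ _) _.
by rewrite leq_add2r; apply/in_subn/sub_span.
Qed.

Lemma supported_d0 m i S v : inY m i.+1 (S, v) ->
  supported (inY m i) (d0 (delta (S, v) : CY)).
Proof.
case=> /andP[/= lv SP] dv wv; rewrite d0E; apply: supported_sum => a _ aS.
apply: supportedZ; apply: supported_delta; split=> /=.
- by rewrite lv (subset_trans _ SP) // subsetDl.
- by apply/eq_add_S; rewrite -dv /dgy /= (cardsD1 a S) aS.
move=> x; apply: leq_trans (wv x); rewrite /wty /= leq_add2r.
by apply/in_subn/span_sub/subsetDl.
Qed.

Let supported_dY_of S v m i :
  (forall m i, inW m i.+1 v -> supported (inW m i) (dword k v.1 v.2)) ->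
  inY m i.+1 (S, v) -> supported (inY m i) (dY (delta (S, v) : CY)).
Proof.
move=> IH Hv; rewrite dYE; apply: supportedD; first exact: supported_d0.
case: Hv => /andP[/= lv SP] dv wv; apply: supportedZ.
rewrite /d1 linearD /=; apply: supportedD.
  case: v lv dv wv {IH} => -[|T w] A lv dv wv; rewrite /front /=.
    by rewrite linear0; apply: supported0.
  move: lv => /= /andP[/andP[_ TP] lw].
  apply: (supported_lm (j := (#|T| + dg (w, A))%N) (m' := wty (T, (w, A)))) => //.
  - by apply/eq_add_S; rewrite -dv /dgy /= dg_cons addSn addnS.
  - by move=> x; have := wv x; rewrite /wty /= wt_cons.
  by apply: supported_delta; split=> //=; rewrite lw.
case E: (dg v) => [|j].
  case: v lv E {dv wv IH} => w A /= lw /(dg_eq0 lw)[-> ->] /=.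
  by rewrite big_set0 !linear0; apply: supported0.
apply: (supported_lm (j := j) (m' := wt v)) => //.
  by apply/eq_add_S; rewrite -dv /dgy /= E addnS.
by apply: supported_inF; apply: IH; split.
Qed.

Lemma supported_dword m i w A : inW m i.+1 (w, A) ->
  supported (inW m i) (dword k w A).
Proof.
elim: w m i A => [|S w IH] m i A.
  case=> _ dA wA; apply: supported_sum => a _ aA; apply: supportedZ; apply: supported_delta.
  split=> //.
    by apply/eq_add_S; rewrite -dA /dg /= !big_nil (cardsD1 a A) aA.
  move=> x; apply: leq_trans (wA x); rewrite /wt /= !big_nil !add0n.
  exact/in_subn/subsetDl.
case=> lSw dw ww; rewrite dword_cons; have /andP[lS lw] := lSw.
have Y : inY m i (S, (w, A)).
  split; first by apply/andP; split=> //; case/andP: lS.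
    by apply/eq_add_S; rewrite -dw dg_cons.
  by move=> x; have := ww x; rewrite wt_cons.
apply: supportedB; first by apply: supportedN; apply: supported_act; apply: supported_delta.
case: i Y dw => [|i] Y dw; first by have := letter_gt0 lS; case: Y => _; rewrite /dgy /=; lia.
by apply: supported_bar; apply: supported_dY_of => // m' i'; apply: IH.
Qed.

Lemma supported_dY m i (y : CY) : supported (inY m i.+1) y ->
  supported (inY m i) (dY y).
Proof.
apply: supported_lift => -[S v] Hb.
have := @supported_dY_of S v m i _ Hb; rewrite /dY fglift_delta /=; apply=> m' i'.
by case: v Hb => w A _; apply: supported_dword.
Qed.

Lemma dY_deg0 m (y : CY) : supported (inY m 0) y -> dY y = 0.
Proof.
elim/supported_ind => [|c [S [w A]] z]; first by rewrite linear0.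
case=> /andP[/= lw SP] /eqP; rewrite addn_eq0 /= cards_eq0 => /andP[/eqP-> /eqP].
case/(dg_eq0 lw)=> -> -> _ _ IH; rewrite linearP /= IH addr0 -inFE dY_inF /d1 /=.
by rewrite big_set0 linear0 addr0 scaler0.
Qed.

Lemma inY_nonempty m i b : inY m i b -> nonempty_ybase b.
Proof. by case=> /andP[lb _] _ _; apply: sub_all lb => S /andP[]. Qed.

(** * The bar differential squares to zero *)

Lemma dY_dl S (y : CY) : dY (dl S y) = - ((-1) ^+ #|S| *: dl S (dY y)).
Proof.
rewrite {1}/dl linear_sum /=; under eq_bigr do rewrite linearZ /= dY_lm scalerDr.
rewrite big_split /= dl_dl add0r /dl scaler_sumr -sumrN; apply: eq_bigr => a aS.
by rewrite (cardsD1 a S) aS exprS !scalerA mulN1r -scaleNr !mulNr opprK mulrC.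
Qed.

(** The square of the differential commutes with T, so that it needs to be computed
    on words only. *)
Lemma dYdY_lm S (y : CY) : dY (dY (lm S y)) = lm S (dY (dY y)).
Proof.
rewrite dY_lm linearD linearZ /= dY_dl dY_lm scalerDr addrA addNr add0r.
by rewrite scalerA -exprD addnn -signr_odd odd_double scale1r.
Qed.

Lemma act_inF_bar S (y : CY) : act (inF S (bar y)) = 0.
Proof.
apply: (linear_ext (f := fun y => act (inF S (bar y))) (g := fun=> 0)).
- solve_linear.
- by move=> c u u'; rewrite [RHS]addr0 scaler0.
case=> T [w A]; rewrite barE; case: ifP => _; first by rewrite !linear0.
by rewrite inFE actE.
Qed.

Lemma act_dY (y : CY) : act (dY y) = dX (act y).
Proof.
apply: (linear_ext (f := fun y => act (dY y)) (g := fun y => dX (act y)));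
  [solve_linear|solve_linear|].
case=> S [[|T w] A]; rewrite dYE linearD linearZ /= actE /d1 /front /=.
  rewrite add0r linearZ /= dXE /= d0E.
  rewrite (leibniz (fun U => delta ([::], U))); congr (_ + _ *: _).
    by rewrite linear_sum; apply: eq_bigr => a _; rewrite linearZ /= actE.
  rewrite !linear_sum; apply: eq_bigr => a _.
  by rewrite ![in LHS]linearZ /= lm_inF inFE actE.
rewrite linear0 d0E linear_sum big1 ?add0r => [|a _]; last first.
  by rewrite linearZ /= actE scaler0.
apply/eqP; rewrite scaler_eq0 signr_eq0 /=; apply/eqP.
rewrite linearD /= -[- _ - _]/(dword k (T :: w) A) dword_cons lm_inF;
  rewrite !(linearD, linearN) /=.
rewrite act_inF_bar oppr0 addr0 lmE linearZ /= !actE.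
case: w => [|T' w]; last by rewrite !linear0 addr0.
by rewrite [inF S _]linearZ /= inFE [act _]linearZ /= actE !scalerA extA setUA mulrC subrr.
Qed.

(** By the definition of the differential, d (S :: w) = y - act y - bar (d y) with
    y = u_S w, and applying [bar_homotopy] to d y shows that d d (S :: w) = 0 as soon
    as d d y = 0, a statement on the shorter word w. *)
Lemma dY_d1 m i w A : inW m i (w, A) -> dY (d1 k (w, A)) = 0.
Proof.
elim: w m i A => [|S w IH] m i A Hw.
  rewrite /d1 /= add0r linear_sum linear_sum /= -[RHS](linear0 (inF set0)).
  rewrite -[in RHS](koszul_dd (fun U => delta ([::], U)) A) !linear_sum.
  apply: eq_bigr => a _; rewrite !linearZ /= dY_inF /d1 /= add0r.
  by [].
set y : CY := delta (S, (w, A)).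
case: Hw => /= /andP[lS lw] dw ww.
have Y : inY m i.-1 (S, (w, A)).
  split; first by apply/andP; split=> //; case/andP: lS.
    by rewrite -dw dg_cons.
  by move=> x; have := ww x; rewrite wt_cons.
have ddy : dY (dY y) = 0.
  rewrite /y -[(S, (w, A))]/(S, (w, A)) -[delta _]scale1r -(ext0r k S).
  rewrite -[X in delta (X, _)]setU0 -lmE dYdY_lm -[delta _]inFE dY_inF.
  rewrite (IH (wt (w, A)) (dg (w, A))) ?linear0 //.
have Hh : dY (inF set0 (bar (dY y))) = dY y - inF set0 (act (dY y)).
  have := bar_homotopy (_ : supported (@nonempty_ybase N) (dY y)).
  rewrite ddy !linear0 addr0; apply.
  case E: i.-1 Y => [|j] Y.
    by rewrite (@dY_deg0 m y) ?E; [apply: supported0|apply: supported_delta].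
  apply: (supportedW (Q := inY m j)); first exact: inY_nonempty.
  by apply: supported_dY; apply: supported_delta.
have -> : d1 k (S :: w, A) = y - inF set0 (act y) - inF set0 (bar (dY y)).
  by rewrite /d1 /front dword_cons -/y linearB linearN addrA.
have cancel (a b c : CY) : a - b - (a - c) = c - b by freeg_ring.
rewrite !linearB /= Hh cancel act_dY /y actE.
case: {IH lw dw ww ddy Hh Y y} w => [|T w]; last by rewrite !linear0 addr0.
rewrite ![in dY _]linearZ [dX _]linearZ ![inF _ _]linearZ /=.
by rewrite dY_inF dXE /d1 /= add0r subrr.
Qed.

Lemma dYdY m i (y : CY) : supported (inY m i) y -> dY (dY y) = 0.
Proof.
apply: (eq_on_supported (f := fun y => dY (dY y)) (g := fun=> 0)).
- solve_linear.
- by move=> c u u'; rewrite [RHS]addr0 scaler0.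
case=> S [w A] [/andP[/= lw SP] dv wv].
rewrite -[delta _]scale1r -(ext0r k S).
rewrite -[X in delta (X, _)]setU0 -lmE dYdY_lm -[delta _]inFE dY_inF.
by rewrite (@dY_d1 (wt (w, A)) (dg (w, A))) ?linear0.
Qed.

End Multidegree.

(** * Exactness in each multidegree *)

Section Strand.
Variables (k : fieldType) (N : nat) (P : {set 'I_N}) (ed : 'I_N -> {set 'I_N}).
Hypothesis ed_self : forall p, p \in P -> p \in ed p.
Implicit Types (S T A : {set 'I_N}) (x p : 'I_N) (i : nat).

Notation word := (seq {set 'I_N} * {set 'I_N})%type.
Notation ybase := ({set 'I_N} * word)%type.
Notation CW := {freeg word / k}.
Notation CY := {freeg ybase / k}.
Notation inW := (inW P ed).
Notation inY := (inY P ed).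
Notation wt := (wt ed).
Notation letters := (letters P).
Implicit Types (w : seq {set 'I_N}) (v : word) (b : ybase).

Lemma supportedI (B : choiceType) (Q Q' : B -> Prop) (z : {freeg B / k}) :
  supported Q z -> supported Q' z -> supported (fun c => Q c /\ Q' c) z.
Proof. by move=> Qz Q'z b nz; split; [apply: Qz|apply: Q'z]. Qed.

Lemma supported_eq0 (B : choiceType) (z : {freeg B / k}) :
  supported (fun=> False) z -> z = 0.
Proof.
by move=> z0; apply: freeg0P => b; have [//|/z0] := eqVneq (coeff b z) 0.
Qed.

Lemma supported_d1 w A : letters w ->
  supported (fun b => inY (wt (w, A)) (dg (w, A)).-1 b /\ (dg b.2 < dg (w, A))%N)
    (d1 k (w, A)).
Proof.
move=> lw; have Y : inY (wt (w, A)) (dg (w, A)) (set0, (w, A)).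
  split=> /=; [by rewrite lw sub0set|by rewrite /dgy cards0|].
  by move=> x; rewrite /wty /= span0 inE.
have sY : supported (inY (wt (w, A)) (dg (w, A))) (delta (set0, (w, A)) : CY).
  exact: supported_delta.
rewrite -dY_inF inFE.
case E: (dg (w, A)) => [|j]; rewrite E in sY.
  by rewrite (dY_deg0 sY); apply: supported0.
apply: supportedW (supported_dY ed_self sY) => b Yb; split=> //.
by case: Yb => _ <- _; rewrite ltnS leq_addl.
Qed.

(** The monomial [x^alpha / m_v] lies in the edge ideal iff one of the edges,
    indexed by their private vertices, divides it. *)
Variable alpha : 'I_N -> nat.
Definition dividing v : {set 'I_N} :=
  [set p in P | [forall x, (x \in ed p) + wt v x <= alpha x]%N].

Lemma dividingP v p : reflect
  (p \in P /\ forall x, ((x \in ed p) + wt v x <= alpha x)%N) (p \in dividing v).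
Proof.
by rewrite inE; apply: (iffP andP) => -[pP] => [/forallP|?]; split=> //; apply/forallP.
Qed.

Lemma dividing_sub v v' : (forall x, wt v' x <= wt v x)%N ->
  dividing v \subset dividing v'.
Proof.
move=> vv'; apply/subsetP => p /dividingP[pP Hp]; apply/dividingP; split=> // x.
by apply: leq_trans (Hp x); rewrite leq_add2l.
Qed.

Lemma dividing_front i S v p : inY alpha i (S, v) -> p \in S -> p \in dividing v.
Proof.
case=> /andP[/= lv SP] _ wv pS; apply/dividingP; split; first exact: (subsetP SP).
move=> x; apply: leq_trans (wv x); rewrite leq_add2r.
by apply: in_subn; apply: bigcup_sup.
Qed.

(** In multidegree alpha, these elements span the kernel of the map from B(T, T, K) to
    its quotient over the hypergraph algebra.  The elements u_S v with S non-empty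
    are among them, by [dividing_front]. *)
Definition inZ b : Prop := dividing b.2 != set0.

Lemma supported_lm_snd (Q : word -> Prop) S (y : CY) :
  supported (fun b => Q b.2) y -> supported (fun b => Q b.2) (lm S y).
Proof.
apply: supported_lift => -[T v] /= Qv; apply: supportedZ; exact: supported_delta.
Qed.

Lemma supported_dY_inZ i (y : CY) :
  supported (fun b => inY alpha i b /\ inZ b) y -> supported inZ (dY y).
Proof.
apply: supported_lift => -[S [w A]] [[/andP[/= lw SP] _ _] Zv].
rewrite /inZ in Zv *; apply: supportedD.
  rewrite d0E; apply: supported_sum => a _ _; apply: supportedZ.
  exact: supported_delta.
apply: supportedZ; apply: (supported_lm_snd (Q := fun v => dividing v != set0)).
apply: supportedW (supported_d1 (A := A) lw) => b [[_ _ wb] _].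
apply: contraNneq Zv => Zb; rewrite -subset0 -Zb; apply: dividing_sub => x.
by apply: leq_trans (wb x); rewrite leq_addl.
Qed.

(** For a fixed word v, the sets S such that u_S v has multidegree at most alpha are
    the faces of the full simplex on [dividing v]; a vertex p of it is chosen, and S is
    sent to the face spanned by p and S. *)
Definition cone : CY -> CY := fglift (fun b =>
  if [pick p in dividing b.2] is Some p then lm [set p] (delta b) else 0).
HB.instance Definition _ := GRing.isLinear.Build k CY CY _ cone (fglift_is_linear _).

Lemma coneE S v : cone (delta (S, v)) =
  if [pick p in dividing v] is Some p then lm [set p] (delta (S, v)) else 0.
Proof. exact: fglift_delta. Qed.

Lemma supported_cone_snd (Q : word -> Prop) (y : CY) :
  supported (fun b => Q b.2) y -> supported (fun b => Q b.2) (cone y).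
Proof.
apply: supported_lift => -[S v] /= Qv; case: pickP => [p _|_]; last exact: supported0.
by apply: supported_lm_snd; apply: supported_delta.
Qed.

Lemma supported_cone i (y : CY) : supported (inY alpha i) y ->
  supported (inY alpha i.+1) (cone y).
Proof.
apply: supported_lift => -[S v] [/andP[/= lv SP] dv wv].
case: pickP => [p|]; last by move=> _; apply: supported0.
move=> /dividingP[pP Hp]; rewrite lmE.
have [pS|pS] := boolP [disjoint [set p] & S]; last first.
  by rewrite (ext_eq0 _ pS) scale0r; apply: supported0.
apply: supportedZ; apply: supported_delta; split=> /=.
- by rewrite lv subUset sub1set pP.
- by rewrite -dv /dgy /= cardsU_disjoint // cards1.
move=> x; rewrite /wty /= spanU inE /span big_set1.
by case: (boolP (x \in ed p)) => [xp|_]; [have := Hp x; rewrite xp|apply: wv].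
Qed.

Lemma dl1 p (y : CY) : dl [set p] y = y.
Proof.
rewrite /dl big_set1 setDv lm0 /sg /below big_set1 ltnn expr0 scale1r //.
Qed.

(** The error terms come from the differential of the word, whose terms have a word of
    smaller degree as last component. *)
Lemma cone_homotopy i S w A : inY alpha i (S, (w, A)) -> inZ (S, (w, A)) ->
  supported (fun b => dg b.2 < dg (w, A))%N
    (delta (S, (w, A)) - dY (cone (delta (S, (w, A)))) - cone (dY (delta (S, (w, A))))).
Proof.
move=> [/andP[/= lw SP] dv wv] Zv; rewrite dYE linearD linearZ /=.
have Ep : exists p, [pick p in dividing (w, A)] = Some p.
  case: pickP => [p _|none]; first by exists p.
  by case/set0Pn: Zv => p; rewrite /= none.
case: Ep => p Ep.
have -> : cone (d0 (delta (S, (w, A)))) = lm [set p] (d0 (delta (S, (w, A)))).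
  rewrite d0E !linear_sum; apply: eq_bigr => a _.
  by rewrite [in LHS]linearZ [in RHS]linearZ /= coneE Ep.
rewrite coneE Ep dY_lm dl1 cards1 expr1 scaleN1r dYE [lm [set p] (_ + _)]linearD /= [lm [set p] (_
  *: _)]linearZ /=.
set y := lm S _; set c := _ ^+ _.
have -> (a b e f : CY) : a - (a - (b + c *: e)) - (b + c *: f) = c *: e - c *: f.
  by freeg_ring.
have sy : supported (fun b => dg b.2 < dg (w, A))%N y.
  apply: (supported_lm_snd (Q := fun v => (dg v < dg (w, A))%N)).
  by apply: supportedW (supported_d1 (A := A) lw) => b [].
apply: supportedB; apply: supportedZ.
  exact: (supported_lm_snd (Q := fun v => (dg v < dg (w, A))%N)).
exact: (supported_cone_snd (Q := fun v => (dg v < dg (w, A))%N)).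
Qed.

(** Filter by the degree of v the subcomplex spanned by the u_S v with x^alpha / m_v in
    the ideal: the associated graded pieces are the chain complexes of full simplices, and coning off one vertex of each is
    a contraction up to lower terms. *)
Lemma dividing_acyclic i (z : CY) :
  supported (fun b => inY alpha i b /\ inZ b) z -> dY z = 0 ->
  exists2 y : CY, supported (fun b => inY alpha i.+1 b /\ inZ b) y & dY y = z.
Proof.
suff acyc q (u : CY) : supported (fun b => (inY alpha i b /\ inZ b) /\ (dg b.2 < q)%N) u ->
    dY u = 0 ->
    exists2 y : CY, supported (fun b => inY alpha i.+1 b /\ inZ b) y & dY y = u.
  move=> sz; apply: (acyc i.+1); apply: supportedI => //.
  apply: supportedW sz => b [[_ db _] _]; rewrite ltnS -db; exact: leq_addl.
elim: q u => [|q IH] u su du.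
  exists 0; first exact: supported0.
  by rewrite linear0 [u]supported_eq0 //; apply: supportedW su => b [_].
have sc : supported (fun b => inY alpha i.+1 b /\ inZ b) (cone u).
  apply: supportedI.
    by apply: supported_cone; apply: supportedW su => b [[]].
  by apply: (supported_cone_snd (Q := fun v => dividing v != set0)); apply: supportedW su => b [[]].
have [||y sy dy] := IH (u - dY (cone u)).
- apply: supportedI.
    apply: supportedI.
      apply: supportedB; first by apply: supportedW su => b [[]].
      by apply: supported_dY => //; apply: supportedW sc => b [].
    apply: supportedB; first by apply: supportedW su => b [[]].
    exact: supported_dY_inZ sc.
  have -> : u - dY (cone u) = u - dY (cone u) - cone (dY u) by rewrite du linear0 subr0.
  elim/supported_ind: u / su {du sc} => [|c [S [w A]] u [[Yb Zb] qb] _ IHu].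
    by rewrite !linear0 !addr0; apply: supported0.
  have -> : c *: delta (S, (w, A)) + u - dY (cone (c *: delta (S, (w, A)) + u)) -
      cone (dY (c *: delta (S, (w, A)) + u)) =
      c *: (delta (S, (w, A)) - dY (cone (delta (S, (w, A)))) -
            cone (dY (delta (S, (w, A))))) + (u - dY (cone u) - cone (dY u)).
    by rewrite !linearP /=; freeg_ring.
  apply: supportedD => //; apply: supportedZ.
  apply: supportedW (cone_homotopy Yb Zb) => b bq; exact: leq_trans bq _.
- rewrite linearB /= du sub0r (@dYdY _ _ P ed _ alpha i.+1) ?oppr0 //.
  by apply: supportedW sc => b [].
exists (y + cone u); first exact: supportedD.
by rewrite linearD /= dy addrNK.
Qed.

Definition koszul_word v : Prop := v.1 = [::].

Lemma dY_inF_koszul (z : CW) : supported koszul_word z ->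
  dY (inF set0 z) = inF set0 (dX z).
Proof.
apply: (eq_on_supported (f := fun z => dY (inF set0 z))
   (g := fun z => inF set0 (dX z))); [solve_linear|solve_linear|].
by case=> w A; rewrite /koszul_word /= => ->; rewrite dY_inF dXE /d1 add0r.
Qed.

(** Multiplication by e_x contracts the Koszul complex in every multidegree that
    involves x. *)
Definition wedge x : CW -> CW := fglift (fun v : word =>
  ext k [set x] v.2 *: delta (v.1, x |: v.2)).
HB.instance Definition _ x := GRing.isLinear.Build k CW CW _ (wedge x) (fglift_is_linear _).

Lemma wedge_homotopy x (z : CW) : supported koszul_word z ->
  dX (wedge x z) = z - wedge x (dX z).
Proof.
apply: (eq_on_supported (f := fun z => dX (wedge x z))
   (g := fun z => z - wedge x (dX z))); [solve_linear|solve_linear|].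
case=> w A; rewrite /koszul_word /= => ->;
  rewrite /wedge !fglift_delta /= -!/(wedge x _) linearZ /= !dXE /=.
rewrite (leibniz (fun U => delta ([::], U))) big_set1 setDv set0U ext0l scale1r.
rewrite /sg /below big_set1 ltnn expr0 scale1r cards1 expr1 scaleN1r; congr (_ - _).
by rewrite linear_sum; apply: eq_bigr => a _; rewrite [in RHS]linearZ /= /wedge fglift_delta.
Qed.

Lemma supported_wedge x i (z : CW) : (0 < alpha x)%N ->
  supported (fun v => inW alpha i v /\ koszul_word v) z ->
  supported (fun v => inW alpha i.+1 v /\ koszul_word v) (wedge x z).
Proof.
move=> ax; apply: supported_lift => -[w A] [[lw dw ww]]; rewrite /koszul_word /= => Ew;
  rewrite {w}Ew in lw dw ww *.
have [xA|xA] := boolP [disjoint [set x] & A]; last first.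
  by rewrite (ext_eq0 _ xA) scale0r; apply: supported0.
apply: supportedZ; apply: supported_delta; split=> //; split=> //=.
  by rewrite -dw /dg /= !big_nil !add0n cardsU_disjoint // cards1.
move=> x'; have := ww x'; rewrite !wt_nil !inE.
by case: eqP => [->|] //=.
Qed.

Lemma coeff_inF (z : CW) v S :
  coeff (S, v) (inF set0 z) = if S == set0 then coeff v z else 0.
Proof.
have: supported (fun=> True) z by [].
elim/supported_ind => [|c v' {}z _ _ IH].
  by rewrite linear0 !coeff0; case: ifP.
rewrite linearP /= !coeffD !coeffZ IH inFE !coeff_delta xpair_eqE eq_sym.
by case: ifP => _; rewrite //= mulr0 addr0.
Qed.

(** The differential of words is the one of B(T, T, K) modulo the u_S with S non-empty. *)
Lemma coeff_dY_inF i m (z : CW) v : supported (inW m i) z ->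
  coeff (set0, v) (dY (inF set0 z)) = coeff v (dX z).
Proof.
elim/supported_ind => [|c [w A] {}z [lw _ _] _ IH]; first by rewrite !linear0 !coeff0.
rewrite !linearP /= !coeffD !coeffZ IH dY_inF dXE; congr (_ * _ + _).
rewrite /d1 coeffD coeff_inF eqxx /front /=.
case: w lw => [_|S w /= /andP[/andP[S0 _] _]]; first by rewrite coeff0 add0r.
by rewrite coeff_delta xpair_eqE (negPf S0) add0r.
Qed.

(** Exactness over the hypergraph algebra, one multidegree at a time.  A cycle z has in
    B(T, T, K) a boundary in the kernel of the passage to the quotient; that kernel is
    acyclic, so that z can be corrected by an element n of the kernel.  The resulting
    cycle is a boundary, first up to a Koszul cycle by [bar_homotopy], then
    altogether by [wedge_homotopy]. *)
Lemma strand_exact i (z : CW) : (exists x, 0 < alpha x)%N ->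
  supported (inW alpha i) z ->
  (forall v, dividing v = set0 -> coeff v (dX z) = 0) ->
  exists2 u : CW, supported (inW alpha i.+1) u &
    forall v, dividing v = set0 -> coeff v z = coeff v (dX u).
Proof.
move=> [x ax] sz dz.
have sY : supported (inY alpha i) (inF set0 z) by exact: supported_inF.
have [n sn dn] : exists2 n : CY, supported (fun b => inY alpha i b /\ inZ b) n &
    dY n = dY (inF set0 z).
  case: i sz sY => [|i] sz sY.
    by exists 0; [apply: supported0|rewrite linear0 (dY_deg0 sY)].
  apply: dividing_acyclic; last exact: dYdY sY.
  move=> [S v] nz; have Yb := supported_dY ed_self sY nz; split=> //.
  have [S0|/set0Pn[p pS]] := eqVneq S set0; last first.
    by apply/set0Pn; exists p; apply: dividing_front Yb pS.
  apply: contraNneq nz => Zv; rewrite S0 (coeff_dY_inF _ sz) dz //.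
pose y := inF set0 z - n.
have sy : supported (inY alpha i) y.
  by apply: supportedB => //; apply: supportedW sn => b [].
have dy : dY y = 0 by rewrite linearB /= dn subrr.
have hy := bar_homotopy (supportedW (@inY_nonempty _ P ed _ _) sy).
rewrite dy !linear0 addr0 in hy.
have sk : supported (fun v => inW alpha i v /\ koszul_word v) (act y).
  apply: supportedI; first exact: supported_act.
  apply: (supported_lift (Q := fun=> True)) (_ : supported _ y) => [[S [w A]] _|b _ //].
  case: w => [|T w]; last exact: supported0.
  by apply: supportedZ; apply: supported_delta.
have sk' : supported koszul_word (act y) by apply: supportedW sk => v [].
have sw := supported_wedge ax sk.
exists (bar y + wedge x (act y)).
  by apply: supportedD; [apply: supported_bar|apply: supportedW sw => v []].
have su : supported (inW alpha i.+1) (bar y + wedge x (act y)).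
  by apply: supportedD; [apply: supported_bar|apply: supportedW sw => v []].
move=> v Zv; rewrite -(coeff_dY_inF _ su) [inF _ _]linearD [dY _]linearD /= hy.
rewrite dY_inF_koszul; last by apply: supportedW sw => u [].
rewrite wedge_homotopy // -act_dY dy !linear0 addr0 addrNK /y coeffB.
rewrite coeff_inF eqxx; suff -> : coeff (set0, v) n = 0 by rewrite subr0.
by apply/eqP; apply: contraTT isT => /sn[_]; rewrite /inZ /= Zv eqxx.
Qed.

(** The residual terms are those that carry a letter out of the brackets and then
    differentiate it to the unit; the edge of that letter divides the monomial that
    was erased. *)
Lemma dX_dX w A v : letters w -> coeff v (dX (dX (delta (w, A) : CW))) != 0 ->
  exists2 p, p \in P & forall x, ((x \in ed p) + wt v x <= wt (w, A) x)%N.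
Proof.
move=> lw; have W : inW (wt (w, A)) (dg (w, A)) (w, A) by [].
have sW : supported (inW (wt (w, A)) (dg (w, A))) (delta (w, A) : CW) by exact: supported_delta.
case E: (dg (w, A)) sW => [|j] sW.
  by case: (dg_eq0 lw E) => -> ->; rewrite dXE /= big_set0 linear0 coeff0 eqxx.
have sX : supported (inW (wt (w, A)) j) (dX (delta (w, A) : CW)).
  by rewrite dXE; apply: supported_dword => //; split.
rewrite -(coeff_dY_inF _ sX).
have := dYdY ed_self (supported_inF sW); rewrite dY_inF /d1 -dXE linearD /=.
move/eqP; rewrite addrC addr_eq0 => /eqP->; rewrite coeffN oppr_eq0.
case: w lw {W E sW sX} => [|S w] lw; first by rewrite /front linear0 coeff0 eqxx.
rewrite /front /= dYE coeffD coeffZ.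
case/andP: lw => /andP[S0 SP] lw.
have -> : coeff (set0, v) (lm S (d1 k (w, A))) = 0.
  apply/eqP; apply: contraTT isT.
  have : supported (fun b : ybase => S \subset b.1) (lm S (d1 k (w, A))).
    apply: (supported_lift (Q := fun=> True)) (_ : supported _ _) => [[T u] _|b _ //].
    by apply: supportedZ; apply: supported_delta; apply: subsetUl.
  by move=> sS /sS /=; rewrite subset0 (negPf S0).
rewrite mulr0 addr0 d0E coeff_sum => nz.
have [a aS nza] : exists2 a, a \in S & coeff (set0, v) (sg k a S *: delta (S :\ a, (w, A))) != 0.
  apply/exists_inP; apply: contraNT nz; rewrite negb_exists_in => /forall_inP H.
  by rewrite big1 // => a /H; rewrite negbK => /eqP.
move: nza; rewrite coeffZ coeff_delta mulf_eq0 negb_or => /andP[_].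
have [[_ <-] _|_] := (S :\ a, (w, A)) =P (set0, v); last by rewrite eqxx.
exists a; first exact: (subsetP SP).
move=> x; rewrite wt_cons leq_add2r; apply: in_subn; exact: bigcup_sup.
Qed.

End Strand.

(** * The free resolution *)

Section Words.
Variables (N : nat) (P : {set 'I_N}).
Notation word := (seq {set 'I_N} * {set 'I_N})%type.

Definition cons_word (S : {set 'I_N}) (v : word) : word := (S :: v.1, v.2).

(** The words of degree i; a letter has degree at least 2, so that i is enough fuel. *)
Fixpoint words_fuel (n i : nat) : seq word :=
  [seq ([::], A) | A : {set 'I_N} <- enum {set 'I_N} & #|A| == i] ++
  if n is n'.+1 then
    flatten [seq [seq cons_word T v | v <- words_fuel n' (i - #|T|.+1)]
            | T : {set 'I_N} <- enum {set 'I_N} & letter P T && (#|T| < i)%N]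
  else [::].
Definition words i := words_fuel i i.

Lemma words_fuelE n m i : (i <= n)%N -> (i <= m)%N -> words_fuel n i = words_fuel m i.
Proof.
elim: n m i => [|n IH] [|m] i //=.
- rewrite leqn0 => /eqP-> _; congr (_ ++ _).
  by rewrite (@eq_filter _ _ pred0) ?filter_pred0 // => S; rewrite andbF.
- rewrite leqn0 => _ /eqP->; congr (_ ++ _).
  by rewrite (@eq_filter _ _ pred0) ?filter_pred0 // => S; rewrite andbF.
move=> Hn Hm; congr (_ ++ flatten _); apply/eq_in_map => T.
by rewrite mem_filter => /andP[/andP[_ Ti] _]; rewrite (IH m) //; lia.
Qed.

Lemma mem_words_fuel n i (v : word) : (i <= n)%N ->
  (v \in words_fuel n i) = letters P v.1 && (dg v == i).
Proof.
case: v => w A; elim: n i w A => [|n IH] i w A Hi; rewrite mem_cat; case: w => [|S w] /=.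
- rewrite orbF /dg big_nil add0n /=; apply/mapP/idP => [[B]|/eqP dA].
    by rewrite mem_filter => /andP[/eqP <- _] [->].
  by exists A; rewrite // mem_filter dA eqxx mem_enum.
- rewrite orbF (_ : i = 0%N); last by move: Hi; lia.
  rewrite dg_cons addSn /= andbF; apply/negP => /mapP[B _]; discriminate.
- rewrite (_ : (_ \in flatten _) = false) ?orbF; last first.
    apply/negP => /flatten_mapP[S _ /mapP[v _]]; discriminate.
  rewrite /dg big_nil add0n /=; apply/mapP/idP => [[B]|/eqP dA].
    by rewrite mem_filter => /andP[/eqP <- _] [->].
  by exists A; rewrite // mem_filter dA eqxx mem_enum.
rewrite (_ : (_ \in map _ _) = false) /=; last by apply/negP => /mapP[B _]; discriminate.
apply/flatten_mapP/andP => [[T]|[/andP[lS lw] /eqP dS]].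
  rewrite mem_filter => /andP[/andP[lT Ti] _] /mapP[[w' A']].
  rewrite IH => [/andP[/= lw' /eqP dw'] [-> -> ->]|]; last by lia.
  by rewrite lT lw'; split=> //; rewrite dg_cons dw' subnKC.
have S0 := letter_gt0 lS; move: dS; rewrite dg_cons => dS.
exists S; first by rewrite mem_filter lS mem_enum andbT -dS leq_addr.
apply/mapP; exists (w, A) => //; rewrite -dS addKn IH ?eqxx ?andbT //.
by rewrite -ltnS (leq_trans _ Hi) // -dS addSn ltnS leq_addl.
Qed.

Lemma mem_words i v : (v \in words i) = letters P v.1 && (dg v == i).
Proof. exact: mem_words_fuel. Qed.

Lemma words_fuel_uniq n i : uniq (words_fuel n i).
Proof.
elim: n i => [|n IH] i /=.
  by rewrite cats0 map_inj_uniq ?filter_uniq -?enumT ?enum_uniq // => A B [].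
rewrite cat_uniq map_inj_uniq ?filter_uniq -?enumT ?enum_uniq //=; last by move=> A B [].
apply/andP; split.
  apply/hasPn => v /flatten_mapP[S _ /mapP[u _ ->]]; apply/negP => /mapP[A _]; discriminate.
have: uniq [seq T : {set 'I_N} <- enum {set 'I_N} | letter P T && (#|T| < i)%N].
  by rewrite filter_uniq ?enum_uniq.
elim: [seq _ <- _ | _] => //= S s IHs /andP[Ss us]; rewrite cat_uniq IHs // andbT.
rewrite map_inj_uniq ?IH /=; last by move=> [w A] [w' A'] [-> ->].
apply/hasPn => v /flatten_mapP[T Ts /mapP[u _ ->]]; apply/negP => /mapP[u' _ [ST _ _]].
by move: Ss; rewrite -ST Ts.
Qed.

Lemma words_uniq i : uniq (words i).
Proof. exact: words_fuel_uniq. Qed.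

Lemma words0 : words 0 = [:: ([::], set0)].
Proof.
apply: perm_small_eq => //; apply: uniq_perm => //; first exact: words_uniq.
case=> w A; rewrite mem_words inE /=; apply/andP/eqP => [[lw /eqP dw]|[-> ->]].
  by case: (dg_eq0 lw dw) => -> ->.
by rewrite /dg big_nil cards0.
Qed.

End Words.

Section Resolution.
Local Open Scope quotient_scope.
Variables (k : fieldType) (N : nat) (H : hypergraph N).
Variables (P : {set 'I_N}) (ed : 'I_N -> {set 'I_N}).
Hypothesis edgesE : edges H = ed @: P.
Implicit Types (S T A : {set 'I_N}) (p : 'I_N) (i : nat).

Notation R := (hypergraph_algebra k H).
Notation quo := {ideal_quot (hypergraph_idealr k H)}.
Implicit Types (q : {mpoly k[N]}) (m : 'X_{1..N}).

Definition proj q : R := \pi_quo q.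
Fact proj_is_zmod_morphism : zmod_morphism proj.
Proof. by move=> x y; rewrite /proj rmorphB. Qed.
Fact proj_is_monoid_morphism : monoid_morphism proj.
Proof. by split=> [|x y]; rewrite /proj ?rmorph1 ?rmorphM. Qed.
HB.instance Definition _ :=
  GRing.isZmodMorphism.Build {mpoly k[N]} R proj proj_is_zmod_morphism.
HB.instance Definition _ :=
  GRing.isMonoidMorphism.Build {mpoly k[N]} R proj proj_is_monoid_morphism.

Lemma edge_monomialE (e : {set 'I_N}) :
  edge_monomial k e = 'X_[[multinom (x \in e : nat) | x < N]].
Proof.
rewrite /edge_monomial.
rewrite mprodXE; congr 'X_[_]; apply/mnmP => x; rewrite mnmE mnm_sumE.
transitivity (\sum_(i in e) (i == x))%N; first by apply: eq_bigr => i _; rewrite mnm1E.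
have [xe|xe] := boolP (x \in e); last first.
  by rewrite big1 // => i ie; case: eqP => // ix; rewrite -ix ie in xe.
rewrite (bigD1 x) //= eqxx big1 // => i /andP[_ /negPf->] //.
Qed.

Definition divides p m : Prop := forall x, ((x \in ed p) <= m x)%N.

Lemma mcoeff_mulX q m n :
  (q * 'X_[m])@_n = if (m <= n)%MM then q@_(n - m) else 0.
Proof.
case: ifPn => [mn|nmn]; first by rewrite -[in LHS](submK mn) addmC mcoeffMX.
rewrite [q]mpolyE mulr_suml raddf_sum /= big1 // => n' _.
rewrite -scalerAl -mpolyXD mcoeffZ mcoeffX.
case: eqP => [E|_]; last by rewrite mulr0.
by case/negP: nmn; rewrite -E lem_addl.
Qed.

Definition mset (A : {set 'I_N}) : 'X_{1..N} := [multinom (x \in A : nat) | x < N].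

Lemma proj_eq0 q : proj q = 0 <-> (forall m, q@_m != 0 -> exists2 p, p \in P & divides p m).
Proof.
have -> : (proj q = 0) <-> (q \in hypergraph_idealr k H).
  have := Quotient.idealrBE (hypergraph_idealr k H) q 0.
  rewrite subr0 /proj -(rmorph0 \pi_quo) => ->; split=> [->|/eqP //]; exact: eqxx.
split=> [/asboolP[c ->] m|qP].
  rewrite raddf_sum /= => nz.
  have [e eH nze] : exists2 e, e \in edges H & (c e * edge_monomial k e)@_m != 0.
    apply/exists_inP; apply: contraNT nz; rewrite negb_exists_in => /forall_inP H0.
    by rewrite big1 // => e /H0; rewrite negbK => /eqP.
  move: eH; rewrite edgesE => /imsetP[p pP Ee]; exists p => // x.
  move: nze; rewrite edge_monomialE mcoeff_mulX.
  by case: ifPn => [/mnm_lepP/(_ x)|_]; rewrite ?eqxx // mnmE Ee.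
rewrite [q]mpolyE big_seq; apply: rpred_sum => m; rewrite mcoeff_msupp => /qP[p pP pm].
apply/asboolP; exists (fun e => if e == ed p then q@_m *: 'X_[(m - mset (ed p))%MM] else 0).
rewrite (bigD1 (ed p)) /=; last by rewrite edgesE imset_f.
rewrite eqxx big1 ?addr0 => [|e /andP[_ /negPf->]]; last by rewrite mul0r.
rewrite edge_monomialE -scalerAl -mpolyXD submK //.
by apply/mnm_lepP => x; rewrite mnmE.
Qed.

End Resolution.
Section ResolutionMatrices.
Variables (k : fieldType) (N : nat) (H : hypergraph N).
Variables (P : {set 'I_N}) (ed : 'I_N -> {set 'I_N}).
Hypothesis ed_self : forall p, p \in P -> p \in ed p.
Hypothesis edgesE : edges H = ed @: P.
Implicit Types (S T A : {set 'I_N}) (p : 'I_N) (i : nat).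

Notation word := (seq {set 'I_N} * {set 'I_N})%type.
Notation CW := {freeg word / k}.
Notation R := (hypergraph_algebra k H).
Notation inW := (inW P ed).
Notation wt := (wt ed).
Notation words := (words P).
Notation proj := (@proj k N H).
Implicit Types (w : seq {set 'I_N}) (v y : word) (q : {mpoly k[N]}).
Implicit Types (m al : 'X_{1..N}) (z : CW).

Definition wtm v : 'X_{1..N} := [multinom wt v x | x < N].
Definition wd i (j : 'I_(size (words i))) : word := tnth (in_tuple (words i)) j.

Lemma wdE v i (j : 'I_(size (words i))) : wd j = nth v (words i) j.
Proof. exact: tnth_nth. Qed.

Lemma wd_in i (j : 'I_(size (words i))) : wd j \in words i.
Proof. exact: mem_tnth. Qed.

Lemma inW_words (al : 'I_N -> nat) i v : inW al i v -> v \in words i.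
Proof. by case=> lv dv _; rewrite mem_words lv dv eqxx. Qed.

Lemma words_inW i v : v \in words i -> inW (wt v) i v.
Proof. by rewrite mem_words => /andP[lv /eqP dv]. Qed.

Lemma supported_sumE al i z : supported (inW al i) z ->
  z = \sum_(v <- words i) coeff v z *: delta v.
Proof.
move=> sz; apply/eqP/freeg_eqP => v; rewrite coeff_sum.
under eq_bigr do rewrite coeffZ coeff_delta.
have [vW|vW] := boolP (v \in words i).
  rewrite (bigD1_seq v) ?words_uniq //= eqxx mulr1 big1 ?addr0 // => u /negPf->.
  by rewrite mulr0.
rewrite big_seq big1 => [|u uW].
  by apply/eqP; apply: contraNT vW => /sz/inW_words.
by case: eqP => [uv|_]; [rewrite -uv uW in vW|rewrite mulr0].
Qed.

Lemma wtm_le v al : reflect (forall x, (wt v x <= al x)%N) (wtm v <= al)%MM.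
Proof. by apply: (iffP mnm_lepP) => Hv x; have := Hv x; rewrite mnmE. Qed.

(** The homogeneous element of multidegree al of the resolution whose coordinates
    on the basis are, up to the forced monomials, the scalars of z. *)
Definition strand_row al i z : 'rV[R]_(size (words i)) :=
  \row_j proj (if (wtm (wd j) <= al)%MM
               then coeff (wd j) z *: 'X_[(al - wtm (wd j))%MM] else 0).

Definition res_mx i : 'M[R]_(size (words i.+1), size (words i)) :=
  \matrix_(a, b) strand_row (wtm (wd a)) i (dX (delta (wd a))) 0 b.

Lemma dX_wt (al : 'I_N -> nat) i v y : inW al i.+1 v -> coeff y (dX (delta v : CW)) != 0 ->
  inW (wt v) i y.
Proof.
move=> [lv dv _]; have sv : supported (inW (wt v) i.+1) (delta v : CW).
  by apply: supported_delta.
by case: v lv dv sv => w A lv dv sv; rewrite dXE; apply: supported_dword => //; split.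
Qed.

(** The erased monomials match: (al - wt v) + (wt v - wt y) = al - wt y. *)
Lemma strand_row_mul al i z : supported (inW al i.+1) z ->
  strand_row al i.+1 z *m res_mx i = strand_row al i (dX z).
Proof.
move=> sz; apply/rowP => b; rewrite !mxE; set y := wd b.
under eq_bigr do rewrite !mxE.
pose F v := proj (if (wtm v <= al)%MM then coeff v z *: 'X_[al - wtm v] else 0) *
  proj (if (wtm y <= wtm v)%MM
        then coeff y (dX (delta v)) *: 'X_[wtm v - wtm y] else 0).
transitivity (\sum_(v <- words i.+1) F v); first by rewrite [in RHS]big_tnth.
rewrite [in RHS](supported_sumE sz) linear_sum coeff_sum.
transitivity (proj (\sum_(v <- words i.+1) if (wtm y <= al)%MM then
   coeff y (dX (coeff v z *: delta v)) *: 'X_[al - wtm y] else 0)); last first.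
  by case: ifP => _; [rewrite scaler_suml|rewrite big1].
rewrite rmorph_sum /=; apply: eq_bigr => v _; rewrite /F -rmorphM; congr proj.
rewrite linearZ /= coeffZ.
have [->|nz] := eqVneq (coeff v z) 0; first by rewrite !(scale0r, if_same, mul0r).
have Wv := sz v nz; have va : (wtm v <= al)%MM by apply/wtm_le; case: Wv.
rewrite va.
have [->|ny] := eqVneq (coeff y (dX (delta v : CW))) 0.
  by rewrite mulr0 !(scale0r, if_same, mulr0).
have [_ _ wy] := dX_wt Wv ny.
have yv : (wtm y <= wtm v)%MM by apply/wtm_le => x; rewrite mnmE.
rewrite yv (lepm_trans yv va) -scalerAl -scalerAr scalerA -mpolyXD; congr (_ *: 'X_[_]).
apply/mnmP => x; rewrite mnmDE !mnmBE.
by move/mnm_lepP/(_ x): yv; move/mnm_lepP/(_ x): va; lia.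
Qed.

Lemma strand_row_eq0 al i z :
  (forall v, dividing P ed al v = set0 -> coeff v z = 0) -> strand_row al i z = 0.
Proof.
move=> z0; apply/rowP => b; rewrite !mxE; case: ifP => wal; last by rewrite rmorph0.
have [/z0->|/set0Pn[p /dividingP[pP Hp]]] := eqVneq (dividing P ed al (wd b)) set0.
  by rewrite scale0r rmorph0.
apply/(proj_eq0 edgesE) => m; rewrite mcoeffZ mcoeffX.
case: (_ =P m) => [<- _|_]; last by rewrite mulr0 eqxx.
by exists p => // x; rewrite mnmBE mnmE; have := leq_sub2r (wt (wd b) x) (Hp x); rewrite addnK.
Qed.

Lemma dX_row i (a : 'I_(size (words i.+1))) :
  row a (res_mx i) = strand_row (wtm (wd a)) i (dX (delta (wd a))).
Proof. by apply/rowP => b; rewrite !mxE. Qed.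

Lemma res_mx_mul i : res_mx i.+1 *m res_mx i = 0.
Proof.
apply/row_matrixP => a; rewrite row_mul dX_row row0.
have Wa := words_inW (wd_in a); set v := wd a in Wa *.
have sX : supported (inW (wtm v) i.+1) (dX (delta v : CW)).
  move=> y /(dX_wt Wa); apply: inW_W => x; by rewrite mnmE.
rewrite strand_row_mul //; apply: strand_row_eq0 => y.
case: v Wa {sX} => w A [lw _ _] Zy; apply/eqP; apply: contraTT isT => nz.
have [p pP Hp] := dX_dX ed_self lw nz.
have: p \in dividing P ed (wtm (w, A)) y.
  by apply/dividingP; split=> // x; rewrite mnmE; apply: Hp.
by rewrite Zy inE.
Qed.

Definition lift i (v : 'rV[R]_(size (words i))) (j : 'I_(size (words i))) : {mpoly k[N]} :=
  repr (v 0 j : {ideal_quot (hypergraph_idealr k H)}).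

Lemma proj_lift i (v : 'rV[R]_(size (words i))) j : proj (lift v j) = v 0 j.
Proof. exact: reprK. Qed.

Definition strand i (v : 'rV[R]_(size (words i))) al : CW :=
  \sum_(j < size (words i) | (wtm (wd j) <= al)%MM)
     (lift v j)@_(al - wtm (wd j)) *: delta (wd j).

Lemma supported_strand i (v : 'rV[R]_(size (words i))) al :
  supported (inW al i) (strand v al).
Proof.
apply: supported_sum => j _ /wtm_le jal; apply: supportedZ; apply: supported_delta.
have [lj dj _] := words_inW (wd_in j). by split.
Qed.

Lemma wd_inj i : injective (@wd i).
Proof.
move=> a b; rewrite /wd !(tnth_nth ([::], set0)) /= => ab; apply/val_inj.
by apply/eqP; rewrite -(nth_uniq ([::], set0) (ltn_ord a) (ltn_ord b) (words_uniq P i)) ab.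
Qed.

Lemma coeff_strand i (v : 'rV[R]_(size (words i))) al j :
  coeff (wd j) (strand v al) =
  if (wtm (wd j) <= al)%MM then (lift v j)@_(al - wtm (wd j)) else 0.
Proof.
rewrite /strand coeff_sum.
under eq_bigr do rewrite coeffZ coeff_delta (inj_eq (@wd_inj i)).
case: ifP => jal; last first.
  rewrite big1 // => a aal; case: eqP => [aj|_]; last by rewrite mulr0.
  by rewrite -aj aal in jal.
rewrite (bigD1 j) //= eqxx mulr1 big1 ?addr0 // => a /andP[_ /negPf->].
by rewrite mulr0.
Qed.

(** Every row is the sum of its homogeneous components; they vanish in large
    degree, whence the bound D. *)
Lemma row_strands i (v : 'rV[R]_(size (words i))) : exists D,
  v = \sum_(al : 'X_{1..N < D}) strand_row al i (strand v al).
Proof.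
pose D := (\sum_j (msize (lift v j) + mdeg (wtm (wd j))))%N.
exists D; apply/rowP => j; rewrite summxE.
under eq_bigr do rewrite mxE coeff_strand.
rewrite -rmorph_sum /= -[LHS]proj_lift; congr proj.
apply/mpolyP => m; rewrite raddf_sum /=.
have [mD|mD] := boolP (mdeg (m + wtm (wd j)) < D)%N; last first.
  rewrite big1 => [|al _].
    apply/memN_msupp_eq0; apply: contraNN mD => /msize_mdeg_lt mj.
    rewrite mdegD (leq_trans _ (_ : msize (lift v j) + mdeg (wtm (wd j)) <= D)%N) //.
      by rewrite -addSn leq_add2r.
    by rewrite /D (bigD1 j) //= leq_addr.
  case: ifP => jal; last by rewrite mcoeff0.
  rewrite mcoeffZ mcoeffX; case: eqP => [E|_]; last by rewrite mulr0.
  by case/negP: mD; rewrite -E submK // bmdeg.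
rewrite (bigD1 (BMultinom mD)) //= lem_addl addmK mcoeffZ mcoeffX eqxx mulr1.
rewrite big1 ?addr0 // => al /eqP alm; case: ifP => jal; last by rewrite mcoeff0.
rewrite mcoeffZ mcoeffX; case: eqP => [E|_]; last by rewrite mulr0.
by case: alm; apply/val_inj; rewrite /= -E submK.
Qed.

(** The homogeneous components of a cycle are cycles modulo multiples of edges. *)
Lemma strand_cycle i (v : 'rV[R]_(size (words i.+1))) : v *m res_mx i = 0 ->
  exists D, v = \sum_(al : 'X_{1..N < D}) strand_row al i.+1 (strand v al) /\
  forall (al : 'X_{1..N < D}) y, dividing P ed al y = set0 ->
    coeff y (dX (strand v al)) = 0.
Proof.
move=> v0; have [D Ev] := row_strands v; exists D; split=> // al y Zy.
have sX (be : 'X_{1..N < D}) : supported (inW be i) (dX (strand v be)).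
  apply: supported_lift (@supported_strand _ v be) => u Wu y' ny.
  have := dX_wt Wu; rewrite /dX fglift_delta => /(_ _ ny).
  by case: Wu => _ _ ub; apply: inW_W.
have [//|ny] := eqVneq (coeff y (dX (strand v al))) 0.
have Wy := sX al y ny; have yW := inW_words Wy.
have yl : (index y (words i) < size (words i))%N by rewrite index_mem.
pose b := Ordinal yl; have yb : wd b = y.
  by rewrite /wd (tnth_nth y) /= nth_index.
have: (v *m res_mx i) 0 b = 0 by rewrite v0 mxE.
rewrite {1}Ev mulmx_suml summxE.
under eq_bigr do rewrite (strand_row_mul (@supported_strand _ v _)) mxE yb.
rewrite -rmorph_sum /= => /(proj_eq0 edgesE)/(_ (al - wtm y)%MM).
have yal : (wtm y <= al)%MM by case: Wy => _ _ /wtm_le.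
rewrite raddf_sum /= (bigD1 al) //= yal mcoeffZ mcoeffX eqxx mulr1 big1 ?addr0.
  case=> // p pP Hp; have: p \in set0; last by rewrite inE.
    rewrite -Zy; apply/dividingP; split=> // x; have := Hp x; rewrite mnmBE mnmE => Hx.
    move/mnm_lepP/(_ x): yal; rewrite mnmE => yx; rewrite -(subnK yx) leq_add2r.
    exact: Hx.
move=> be nbe; case: ifP => ybe; last by rewrite mcoeff0.
rewrite mcoeffZ mcoeffX; case: eqP => [E|_]; last by rewrite mulr0.
case/eqP: nbe; apply/val_inj; rewrite /= -(submK ybe) E submK //.
Qed.

Lemma strand_boundary i (al : 'X_{1..N}) z : (exists x, 0 < al x)%N ->
  supported (inW al i) z ->
  (forall y, dividing P ed al y = set0 -> coeff y (dX z) = 0) ->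
  exists u, strand_row al i z = u *m res_mx i.
Proof.
move=> al0 sz zc; have [u su uz] := strand_exact ed_self al0 sz zc.
exists (strand_row al i.+1 u); rewrite strand_row_mul //; apply/eqP.
rewrite -subr_eq0; apply/eqP; transitivity (strand_row al i (z - dX u)).
  apply/rowP => b; rewrite !mxE -rmorphB /=; congr proj.
  by case: ifP; rewrite ?subrr // coeffB scalerBl.
by apply: strand_row_eq0 => v Zv; rewrite coeffB uz // subrr.
Qed.

Lemma boundary_sum i (I : finType) (F : I -> 'rV[R]_(size (words i))) :
  (forall a, exists u, F a = u *m res_mx i) ->
  exists u, \sum_a F a = u *m res_mx i.
Proof.
move=> HF; apply: (big_ind (fun r => exists u, r = u *m res_mx i)) => //.
- by exists 0; rewrite mul0mx.
by move=> _ _ [u ->] [u' ->]; exists (u + u'); rewrite mulmxDl.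
Qed.

Lemma inW0 (al : 'X_{1..N}) i v : (forall x, al x = 0%N) -> inW al i v ->
  v = ([::], set0) /\ i = 0%N.
Proof.
move=> al0; case: v => -[|S w] A [lv dv wv].
  have A0 : A = set0.
    apply/eqP; rewrite -subset0; apply/subsetP => x xA.
    by have := wv x; rewrite al0 wt_nil xA.
  by rewrite A0 in dv *; split=> //; rewrite -dv /dg big_nil cards0.
case/andP: lv => /andP[/set0Pn[p pS] SP] _.
have := wv p; rewrite al0 wt_cons.
suff -> : p \in span ed S by [].
by apply/bigcupP; exists p => //; apply: ed_self; apply: (subsetP SP).
Qed.

Lemma mnm_cases (al : 'X_{1..N}) : (exists x, 0 < al x)%N \/ forall x, al x = 0%N.
Proof.
have [/existsP|] := boolP [exists x, 0 < al x]%N; first by left.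
by rewrite negb_exists => /forallP al0; right=> x; have := al0 x; rewrite -eqn0Ngt => /eqP.
Qed.

Lemma res_mx_exact i (v : 'rV[R]_(size (words i.+1))) :
  v *m res_mx i = 0 <-> exists u, v = u *m res_mx i.+1.
Proof.
split=> [/strand_cycle[D [Ev cyc]]|[w ->]]; last by rewrite -mulmxA res_mx_mul mulmx0.
rewrite Ev; apply: boundary_sum => al; set z := strand v al.
have sz : supported (inW al i.+1) z by apply: supported_strand.
have [al0|al0] := mnm_cases al; first exact: strand_boundary (cyc al).
exists 0; rewrite mul0mx strand_row_eq0 // => u _; apply/eqP; apply: contraTT isT.
by case/sz/(inW0 al0).
Qed.

Lemma residue_proj q : residue (proj q) = q@_0%MM.
Proof. exact: residue_pi. Qed.

Lemma residue_strand_row al i z j :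
  residue (strand_row al i z 0 j) = if wtm (wd j) == al then coeff (wd j) z else 0.
Proof.
rewrite mxE residue_proj; case: ifP => [jal|jal].
  rewrite mcoeffZ mcoeffX; case: (wtm (wd j) =P al) => [<-|jnal].
    rewrite (_ : (wtm (wd j) - wtm (wd j))%MM = 0%MM) ?eqxx ?mulr1 //.
    by apply/mnmP => x; rewrite mnmBE mnm0E subnn.
  case: eqP => [E|_]; last by rewrite mulr0.
  by case: jnal; rewrite -[RHS](submK jal) E add0m.
by rewrite mcoeff0; case: eqP => // E; rewrite E lepm_refl in jal.
Qed.

Lemma residue_res_mx i a b : residue (res_mx i a b) =
  if wtm (wd b) == wtm (wd a) then coeff (wd b) (dX (delta (wd a) : CW)) else 0.
Proof. by rewrite mxE residue_strand_row. Qed.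

Definition aug : 'cV[k]_(size (words 0)) := const_mx 1.

Lemma size_words0 : size (words 0) = 1%N.
Proof. by rewrite words0. Qed.

Lemma wd0 (j : 'I_(size (words 0))) : wd j = ([::], set0).
Proof. by have := wd_in j; rewrite [in X in X -> _]words0 inE => /eqP. Qed.

Lemma augE (v : 'rV[R]_(size (words 0))) :
  map_mx (@residue k N H) v *m aug = (\sum_j residue (v 0 j))%:M.
Proof.
apply/matrixP => a b; rewrite !ord1 !mxE eqxx mulr1n.
by apply: eq_bigr => j _; rewrite !mxE mulr1.
Qed.

Lemma aug_surj (a : k) : exists v : 'rV[R]_(size (words 0)),
  map_mx (@residue k N H) v *m aug = a%:M.
Proof.
exists (const_mx (proj a%:MP)); rewrite augE; congr _%:M.
under eq_bigr do rewrite mxE residue_proj mcoeffC eqxx mulr1.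
by rewrite sumr_const card_ord size_words0.
Qed.

Lemma aug_exact (v : 'rV[R]_(size (words 0))) :
  map_mx (@residue k N H) v *m aug = 0 <-> exists u, v = u *m res_mx 0.
Proof.
have ord0E (j j' : 'I_(size (words 0))) : j = j'.
  by apply/val_inj; case: j j' => [j +] [j' +] /=; rewrite size_words0; case: j; case: j'.
rewrite augE; split=> [v0|[w ->]]; last first.
  rewrite big1 ?scalemx0 ?raddf0 // => j _; rewrite mxE rmorph_sum big1 // => a _.
  rewrite rmorphM /= residue_res_mx; case: eqP => [E|_]; last by rewrite mulr0.
  have : inW (wtm (wd a)) 1 (wd a).
    by have := words_inW (wd_in a); apply: inW_W => x; rewrite mnmE.
  by move/inW0 => [x|_ //]; rewrite -E mnmE wd0 wt_nil inE.
have [D Ev] := row_strands v; rewrite Ev; apply: boundary_sum => al.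
set z := strand v al; have sz : supported (inW al 0) z by apply: supported_strand.
have [al0|al0] := mnm_cases al.
  apply: strand_boundary => // y _.
  have -> : dX z = 0.
    rewrite (supported_sumE sz) words0 big_seq1 linearZ /= dXE /=.
    by rewrite big_set0 scaler0.
  by rewrite coeff0.
exists 0; rewrite mul0mx; apply/rowP => j; rewrite !mxE wd0.
have -> : coeff ([::], set0) z = residue (v 0 j).
  rewrite -(wd0 j) coeff_strand -[in RHS]proj_lift residue_proj.
  have -> : wtm (wd j) = 0%MM.
    by apply/mnmP => x; rewrite wd0 !mnmE wt_nil inE.
  have -> : (al : 'X_{1..N}) = 0%MM by apply/mnmP => x; rewrite al0 mnm0E.
  by rewrite lepm_refl subm0.
move/matrixP/(_ 0 0): v0; rewrite !mxE eqxx mulr1n => s0.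
have -> : residue (v 0 j) = 0.
  rewrite -[RHS]s0 (bigD1 j) //= big1 ?addr0 // => j' /eqP[]; exact: ord0E.
by rewrite scale0r if_same rmorph0.
Qed.

Definition bar_resolution : free_resolution (@residue k N H) :=
  FreeResolution aug_surj aug_exact res_mx_exact.

End ResolutionMatrices.

(** * Independence of Tor from the resolution *)

Section TorInvariance.
Variables (R : comNzRingType) (k : fieldType) (eps : {rmorphism R -> k}).
Notation resolution := (free_resolution eps).
Implicit Types (F G : resolution) (i : nat).

Lemma row_lift m n p (M : 'M[R]_(m, n)) (D : 'M[R]_(p, n)) :
  (forall a, exists w : 'rV[R]_p, row a M = w *m D) -> {W : 'M[R]_(m, p) | M = W *m D}.
Proof.
move=> HM; apply: cid; have [W HW] := choice HM.
exists (\matrix_a W a); apply/row_matrixP => a.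
by rewrite row_mul rowK.
Qed.

Lemma res_diff_mul F i : res_diff F i.+1 *m res_diff F i = 0.
Proof.
apply/row_matrixP => a; rewrite row_mul row0.
by apply/(res_exactS (f := F)); exists (delta_mx 0 a); rewrite -rowE.
Qed.

Lemma res_diff_aug F : map_mx eps (res_diff F 0) *m res_aug F = 0.
Proof.
apply/row_matrixP => a; rewrite row_mul row0 -map_row.
by apply/(res_exact0 (f := F)); exists (delta_mx 0 a); rewrite -rowE.
Qed.

Section ChainMap.
Variables F G : resolution.

(** What is needed of the i-th component of a comparison map in order to lift it to the
    next degree; the previous component g is quantified, so that the recursion carries
    one matrix at a time. *)
Definition chain_start i (f : 'M[R]_(res_rank F i, res_rank G i)) : Prop :=
  match i return 'M[R]_(res_rank F i, res_rank G i) -> Prop with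
  | 0 => fun f => map_mx eps f *m res_aug G = res_aug F
  | j.+1 => fun f => exists g : 'M[R]_(res_rank F j, res_rank G j),
      res_diff F j *m g = f *m res_diff G j
  end f.

Lemma chain_start0 : {f : 'M[R]_(res_rank F 0, res_rank G 0) | chain_start f}.
Proof.
have HG a : exists w : 'rV[R]_(res_rank G 0),
    map_mx eps w *m res_aug G = row a (res_aug F).
  have [w Ew] := res_aug_surj G (res_aug F a 0); exists w; rewrite Ew.
  by apply/rowP => j; rewrite !ord1 !mxE eqxx mulr1n.
apply: cid; have [W HW] := choice HG; exists (\matrix_a W a).
by apply/row_matrixP => a; rewrite row_mul -map_row rowK.
Qed.

Lemma chain_step i (f : 'M[R]_(res_rank F i, res_rank G i)) : chain_start f ->
  {f' : 'M[R]_(res_rank F i.+1, res_rank G i.+1) |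
    res_diff F i *m f = f' *m res_diff G i}.
Proof.
move=> fP; apply: row_lift => a; rewrite row_mul.
case: i f fP a => [|i] f /= fP a.
  apply/(res_exact0 (f := G)); rewrite map_mxM -mulmxA fP map_row -row_mul.
  by rewrite res_diff_aug row0.
case: fP => g fg; apply/(res_exactS (f := G)).
by rewrite -mulmxA -fg mulmxA -row_mul res_diff_mul row0 mul0mx.
Qed.

Fixpoint chain_map_sig i : {f : 'M[R]_(res_rank F i, res_rank G i) | chain_start f} :=
  match i with
  | 0 => chain_start0
  | j.+1 => let: exist f fP := chain_map_sig j in
            let: exist f' ff' := chain_step fP in
            exist (@chain_start j.+1) f' (ex_intro _ f ff')
  end.
Definition chain_map i := sval (chain_map_sig i).

Lemma chain_map0 : map_mx eps (chain_map 0) *m res_aug G = res_aug F.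
Proof. exact: (svalP (chain_map_sig 0)). Qed.

Lemma chain_mapS i : res_diff F i *m chain_map i = chain_map i.+1 *m res_diff G i.
Proof.
rewrite /chain_map /=; case: (chain_map_sig i) => f fP /=.
by case: (chain_step fP).
Qed.

End ChainMap.

Section Homotopy.
Variable F : resolution.
Variable h : forall i, 'M[R]_(res_rank F i).
Hypothesis h0 : map_mx eps (h 0) *m res_aug F = 0.
Hypothesis hS : forall i, res_diff F i *m h i = h i.+1 *m res_diff F i.

(** What is needed of the i-th component of a null-homotopy of h to find the next one. *)
Definition homotopy_start i (s : 'M[R]_(res_rank F i, res_rank F i.+1)) : Prop :=
  res_diff F i *m (h i - s *m res_diff F i) = 0.

Lemma homotopy_start0 : {s : 'M[R]_(res_rank F 0, res_rank F 1) |
  h 0 = s *m res_diff F 0}.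
Proof.
apply: row_lift => a; apply/(res_exact0 (f := F)).
by rewrite map_row -row_mul h0 row0.
Qed.

Lemma homotopy_step i (s : 'M[R]_(res_rank F i, res_rank F i.+1)) : homotopy_start s ->
  {s' : 'M[R]_(res_rank F i.+1, res_rank F i.+2) |
    h i.+1 - res_diff F i *m s = s' *m res_diff F i.+1}.
Proof.
move=> sP; apply: row_lift => a; apply/(res_exactS (f := F)).
by rewrite -row_mul mulmxBl -hS -mulmxA -mulmxBr sP row0.
Qed.

Lemma homotopy_startS i (s : 'M[R]_(res_rank F i, res_rank F i.+1))
    (s' : 'M[R]_(res_rank F i.+1, res_rank F i.+2)) :
  h i.+1 - res_diff F i *m s = s' *m res_diff F i.+1 -> homotopy_start s'.
Proof.
by move=> E; rewrite /homotopy_start -E opprB addrC addrNK mulmxA res_diff_mul mul0mx.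
Qed.

Lemma homotopy_start_exact (s : 'M[R]_(res_rank F 0, res_rank F 1)) :
  h 0 = s *m res_diff F 0 -> homotopy_start s.
Proof. by rewrite /homotopy_start => ->; rewrite subrr mulmx0. Qed.

Fixpoint homotopy_sig i :
    {s : 'M[R]_(res_rank F i, res_rank F i.+1) | homotopy_start s} :=
  match i with
  | 0 => let: exist s sP := homotopy_start0 in
         exist (@homotopy_start 0) s (homotopy_start_exact sP)
  | j.+1 => let: exist s sP := homotopy_sig j in
            let: exist s' ss' := homotopy_step sP in
            exist (@homotopy_start j.+1) s' (homotopy_startS ss')
  end.
Definition homotopy i := sval (homotopy_sig i).

Lemma homotopy0 : h 0 = homotopy 0 *m res_diff F 0.
Proof. by rewrite /homotopy /=; case: homotopy_start0. Qed.

Lemma homotopyS i : h i.+1 = homotopy i.+1 *m res_diff F i.+1 + res_diff F i *m homotopy i.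
Proof.
rewrite /homotopy /=; case: (homotopy_sig i) => s sP /=.
by case: (homotopy_step sP) => s' /= <-; rewrite subrK.
Qed.

End Homotopy.

(** Modulo I and I', phi embeds K / I in K' / I', as gamma is a left inverse of it. *)
Lemma subquotient_rank_le m m' n p p' n' (K : 'M[k]_(m, n)) (I : 'M[k]_(p, n))
    (K' : 'M[k]_(m', n')) (I' : 'M[k]_(p', n')) (phi : 'M[k]_(n, n'))
    (gamma : 'M[k]_(n', n)) :
  (K *m phi <= K')%MS -> (I' <= K')%MS -> (I' *m gamma <= I)%MS ->
  (K *m (1%:M - phi *m gamma) <= I)%MS ->
  (\rank K - \rank I <= \rank K' - \rank I')%N.
Proof.
move=> KK' IK' II KI; set C := cokermx I'.
have r1 : (\rank (K :&: kermx (phi *m C))%MS <= \rank I)%N.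
  apply/mxrankS/rV_subP => v; rewrite sub_capmx => /andP[vK].
  rewrite sub_kermx mulmxA => /eqP vC.
  have vI : (v *m phi <= I')%MS by rewrite submxE vC.
  have -> : v = v *m (1%:M - phi *m gamma) + v *m phi *m gamma.
    by rewrite mulmxBr mulmx1 mulmxA subrK.
  apply: addmx_sub; first exact: submx_trans (submxMr _ vK) KI.
  exact: submx_trans (submxMr _ vI) II.
have r2 := mxrank_mul_ker K (phi *m C).
have r3 := mxrank_mul_ker K' C.
have r4 : (\rank I' <= \rank (K' :&: kermx C)%MS)%N.
  by apply/mxrankS; rewrite sub_capmx IK' sub_kermx mulmx_coker eqxx.
have r5 : (\rank (K *m (phi *m C)) <= \rank (K' *m C))%N.
  by apply/mxrankS; rewrite mulmxA submxMr.
by rewrite -r2 -r3; lia.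
Qed.

(** Comparison maps F -> G -> F compose to a map homotopic to the identity, so that the
    homology of F (x) k is a direct summand of that of G (x) k. *)
Lemma tor_dim_le F G i : (tor_dim F i <= tor_dim G i)%N.
Proof.
set f := chain_map F G; set g := chain_map G F.
pose h i : 'M[R]_(res_rank F i) := 1%:M - f i *m g i.
have h0 : map_mx eps (h 0%N) *m res_aug F = 0.
  rewrite /h map_mxB map_mx1 map_mxM mulmxBl mul1mx -mulmxA.
  by rewrite (chain_map0 G F) (chain_map0 F G) subrr.
have hS j : res_diff F j *m h j = h j.+1 *m res_diff F j.
  rewrite /h mulmxBr mulmxBl mul1mx mulmx1; congr (_ - _).
  by rewrite mulmxA (chain_mapS F G) -!mulmxA (chain_mapS G F).
have tens j : tensor_diff F j *m map_mx eps (f j) = map_mx eps (f j.+1) *m tensor_diff G j.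
  by rewrite /tensor_diff -!map_mxM chain_mapS.
have teng j : tensor_diff G j *m map_mx eps (g j) = map_mx eps (g j.+1) *m tensor_diff F j.
  by rewrite /tensor_diff -!map_mxM chain_mapS.
have one j : 1%:M - map_mx eps (f j) *m map_mx eps (g j) = map_mx eps (h j).
  by rewrite /h map_mxB map_mx1 map_mxM.
case: i => [|i] /=.
  rewrite -[X in (X - _ <= _)%N](mxrank1 k) -[X in (_ <= X - _)%N](mxrank1 k).
  apply: (subquotient_rank_le (phi := map_mx eps (f 0)) (gamma := map_mx eps (g 0))).
  - exact: submx1.
  - exact: submx1.
  - by rewrite teng submxMl.
  by rewrite one mul1mx (homotopy0 h0) map_mxM submxMl.
apply: (subquotient_rank_le (phi := map_mx eps (f i.+1)) (gamma := map_mx eps (g i.+1))).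
- by rewrite sub_kermx -mulmxA -tens mulmxA mulmx_ker mul0mx.
- by rewrite sub_kermx /tensor_diff -map_mxM res_diff_mul map_mx0.
- by rewrite teng submxMl.
rewrite one (homotopyS h0 hS) map_mxD !map_mxM mulmxDr.
by rewrite [X in _ + X]mulmxA mulmx_ker mul0mx addr0 mulmxA submxMl.
Qed.

Lemma tor_dim_indep F G i : tor_dim F i = tor_dim G i.
Proof. by apply/eqP; rewrite eqn_leq !tor_dim_le. Qed.

End TorInvariance.

(** * Acyclic matchings *)

(** The basis elements of a complex are of type U, V or critical, and [dn] matches those
    of type V with those of type U one degree lower.  The matching is triangular with
    respect to [key].  The predicate Q describes elements that contain the
    differentials of the critical ones, remain inside Q when reduced along
    the matching, and are never critical: hence nothing critical is left over when
    the differential of a critical element is reduced, and the rank of the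
    differential is the number of elements of type V. *)
Section Matching.
Variables (k : fieldType) (n : nat -> nat) (M : forall i, 'M[k]_(n i.+1, n i)).
Variables (U V Q : forall i, pred 'I_(n i)).
Variables (dn : forall i, 'I_(n i.+1) -> 'I_(n i)).
Variables (key : forall i, 'I_(n i) -> nat).
Arguments dn {i}.
Arguments key {i}.
Arguments U {i}.
Arguments V {i}.
Arguments Q {i}.
Hypothesis MM : forall i, M i.+1 *m M i = 0.
Hypothesis V0 : forall b : 'I_(n 0), ~~ V b.
Hypothesis UV : forall i (b : 'I_(n i)), U b -> ~~ V b.
Hypothesis dnU : forall i (v : 'I_(n i.+1)), V v -> U (dn v).
Hypothesis dn_inj : forall i (v v' : 'I_(n i.+1)), V v -> V v' -> dn v = dn v' -> v = v'.
Hypothesis dn_surj : forall i (u : 'I_(n i)), U u -> exists2 v, V v & dn v = u.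
Hypothesis dn_diag : forall i (v : 'I_(n i.+1)), V v -> M i v (dn v) != 0.
Hypothesis dn_triang : forall i (v v' : 'I_(n i.+1)), V v -> V v' -> v' != v ->
  M i v (dn v') != 0 -> (key v' < key v)%N.
Hypothesis crit_Q : forall i (c : 'I_(n i.+1)) b, ~~ U c -> ~~ V c -> M i c b != 0 -> Q b.
Hypothesis Q_crit : forall i (b : 'I_(n i)), Q b -> U b || V b.
Hypothesis dn_Q : forall i (v : 'I_(n i.+1)) b, V v -> Q (dn v) -> M i v b != 0 -> Q b.

Lemma matching_inj i (z : 'rV[k]_(n i.+1)) : (forall b, z 0 b != 0 -> V b) ->
  (forall u, U u -> (z *m M i) 0 u = 0) -> z = 0.
Proof.
move=> zV zM; apply: contraTeq isT => /rV0Pn[b0 nz0].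
have [b nzb bmax] := @arg_maxnP _ b0 (fun b => z 0 b != 0) key nz0.
have Vb := zV b nzb; have := zM _ (dnU Vb); rewrite mxE (bigD1 b) //= big1 ?addr0.
  by move/eqP; rewrite mulf_eq0 (negPf nzb) /= (negPf (dn_diag Vb)).
move=> b' nb'; apply/eqP; rewrite mulf_eq0; apply/norP=> -[nzb' nM].
have bb' : b != b' by rewrite eq_sym.
have := dn_triang (zV b' nzb') Vb bb' nM.
by rewrite ltnNge => /negP; apply; apply: bmax.
Qed.

Lemma matching_cycle i (r : 'rV[k]_(n i)) : (forall b, r 0 b != 0 -> V b) ->
  (exists y, r = y *m M i) -> r = 0.
Proof.
case: i r => [|i] r rV [y Ey].
  apply/rowP => b; rewrite [RHS]mxE; apply/eqP; apply: contraTT isT => /rV.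
  by rewrite (negPf (V0 b)).
by apply: matching_inj => // u _; rewrite Ey -mulmxA MM mulmx0 mxE.
Qed.

(** The components of z in U are removed by rows of type V, those of largest key first,
    which changes only components matched to smaller keys. *)
Lemma matching_reduce i (Q' : pred 'I_(n i)) (z : 'rV[k]_(n i)) :
  (forall (v : 'I_(n i.+1)) b, V v -> Q' (dn v) -> M i v b != 0 -> Q' b) ->
  (forall b, z 0 b != 0 -> Q' b) ->
  exists v : 'rV[k]_(n i.+1), [/\ forall b, v 0 b != 0 -> V b,
    forall u, U u -> (z - v *m M i) 0 u = 0 &
    forall b, (z - v *m M i) 0 b != 0 -> Q' b].
Proof.
move=> dnQ'.
have [m zm] : exists m, forall v : 'I_(n i.+1), V v -> z 0 (dn v) != 0 -> (key v < m)%N.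
  exists (\max_(v : 'I_(n i.+1)) key v).+1 => v _ _; rewrite ltnS.
  exact: (leq_bigmax (F := fun v : 'I_(n i.+1) => key v)).
elim: m z zm => [|m IH] z zm zQ.
  exists 0; rewrite mul0mx subr0; split=> // [b|u Uu]; first by rewrite mxE eqxx.
  have [v Vv <-] := dn_surj Uu.
  by apply/eqP; apply: contraTT isT => /(zm v Vv).
pose c (v : 'I_(n i.+1)) := z 0 (dn v) / M i v (dn v).
pose v : 'rV[k]_(n i.+1) := \sum_(b | V b && (key b == m)) c b *: delta_mx 0 b.
have vM u : (v *m M i) 0 u = \sum_(b | V b && (key b == m)) c b * M i b u.
  rewrite /v mulmx_suml summxE; apply: eq_bigr => b _.
  by rewrite -scalemxAl -rowE !mxE.
have vV b : v 0 b != 0 -> V b.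
  apply: contraNT => nVb; rewrite summxE big1 // => b' /andP[Vb' _].
  rewrite !mxE eqxx /=; case: eqP => [bb'|_]; last by rewrite mulr0.
  by rewrite bb' Vb' in nVb.
have zQ' b : (z - v *m M i) 0 b != 0 -> Q' b.
  apply: contraNT => nQb; rewrite mxE mxE vM big1 ?subr0 => [|b' /andP[Vb' _]].
    by apply: contraNT nQb => /zQ.
  apply/eqP; apply: contraNT nQb; rewrite !mulf_eq0 !negb_or => /andP[/andP[nz _]].
  exact/dnQ'/zQ.
have [|//|w [wV wU wQ]] := IH (z - v *m M i).
  move=> b Vb nz; rewrite ltnNge; apply: contraNN nz => mb.
  rewrite mxE mxE vM subr_eq0; apply/eqP.
  have [bm|bm] := eqVneq (key b) m.
    rewrite (bigD1 b) /= ?Vb ?bm ?eqxx // big1 ?addr0 => [|b' /andP[/andP[Vb' /eqP bm'] nb]].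
      by rewrite /c divfK // dn_diag.
    apply/eqP; rewrite mulf_eq0; apply/norP=> -[_ nM].
    by have := dn_triang Vb' Vb _ nM; rewrite eq_sym bm bm' ltnn => /(_ nb).
  rewrite big1 => [|b' /andP[Vb' /eqP bm']].
    apply/eqP; apply: contraTT isT => /(zm b Vb); rewrite ltnS => kb.
    by move: bm; rewrite eqn_leq kb mb.
  apply/eqP; rewrite mulf_eq0; apply/norP=> -[_ nM].
  have nb : b != b' by apply: contraNneq bm => ->; rewrite bm'.
  have := dn_triang Vb' Vb nb nM; rewrite bm'.
  by rewrite ltnNge mb.
exists (v + w); rewrite mulmxDl opprD addrA; split=> // b.
rewrite mxE; have [->|/vV //] := eqVneq (v 0 b) 0.
by rewrite add0r; apply: wV.
Qed.

(** An element with no component in U is a combination of V and of critical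
    elements.  The differential of a critical element lies in the span of Q,
    where reduction leaves nothing critical: it is a combination of the
    differentials of V. *)
Lemma matching_span i (z : 'rV[k]_(n i.+1)) :
  exists2 v : 'rV[k]_(n i.+1), (forall b, v 0 b != 0 -> V b) & z *m M i = v *m M i.
Proof.
have [||v [vV vU _]] := @matching_reduce i.+1 predT z => //.
pose y := z - v *m M i.+1.
have zy : z *m M i = y *m M i by rewrite mulmxBl -mulmxA MM mulmx0 subr0.
pose yV : 'rV[k]_(n i.+1) := \row_b if V b then y 0 b else 0.
pose x := (y - yV) *m M i.
have xQ b : x 0 b != 0 -> Q b.
  apply: contraNT => nQ; rewrite mxE big1 // => c _.
  apply/eqP; rewrite mulf_eq0; apply/norP=> -[nc nM]; case/negP: nQ.
  apply: crit_Q nM.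
    apply: contraNN nc => Uc; rewrite !mxE (negPf (UV Uc)) subr0.
    by have := vU c Uc; rewrite /y !mxE => ->.
  by apply: contraNN nc => Vc; rewrite !mxE Vc subrr.
have [w [wV wU wQ]] := matching_reduce (@dn_Q i) xQ.
have r0 : x - w *m M i = 0.
  have rV b : (x - w *m M i) 0 b != 0 -> V b.
    move=> nb; have := Q_crit (wQ b nb); case/orP=> // Ub.
    by rewrite (wU b Ub) eqxx in nb.
  by apply: matching_cycle rV _; exists (y - yV - w); rewrite [RHS]mulmxBl.
exists (yV + w).
  move=> b; rewrite mxE; have [->|/wV //] := eqVneq (w 0 b) 0.
  by rewrite addr0 mxE; case: ifP; rewrite ?eqxx.
by rewrite zy -[y in LHS](subrK yV) [LHS]mulmxDl [RHS]mulmxDl addrC; congr (_ + _);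
  exact: subr0_eq r0.
Qed.

(** The rows of type V are independent by triangularity, and they span by
    [matching_span]. *)
Lemma matching_rank i : \rank (M i) = #|V : pred 'I_(n i.+1)|.
Proof.
set W := (V : pred 'I_(n i.+1)); pose f (a : 'I_#|W|) := enum_val a.
have fV a : V (f a) by have := enum_valP a.
have free : row_free (rowsub f (M i)).
  apply: inj_row_free => z zM.
  pose v : 'rV[k]_(n i.+1) := \sum_a z 0 a *: delta_mx 0 (f a).
  have vM : v *m M i = 0.
    rewrite -zM /v mulmx_suml; apply/rowP => b; rewrite summxE mxE.
    by apply: eq_bigr => a _; rewrite -scalemxAl -rowE !mxE.
  have v0 : v = 0.
    apply: matching_inj => [b|u _]; last by rewrite vM mxE.
    apply: contraNT => nb; rewrite summxE big1 // => a _.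
    rewrite !mxE eqxx /=; case: eqP => [ba|_]; last by rewrite mulr0.
    by rewrite ba fV in nb.
  apply/rowP => a; move/rowP/(_ (f a)): v0; rewrite summxE (bigD1 a) //= big1 ?addr0.
    by rewrite !mxE !eqxx mulr1.
  move=> a' na; rewrite !mxE eqxx /=; case: eqP => [E|_]; last by rewrite mulr0.
  by rewrite (enum_val_inj E) eqxx in na.
rewrite -[RHS](eqP free); apply/eqP; rewrite eqn_leq; apply/andP; split.
  apply/mxrankS/row_subP => a; rewrite rowE.
  have [v vV ->] := matching_span (delta_mx 0 a : 'rV_(n i.+1)).
  rewrite mulmx_sum_row; apply: summx_sub => b _.
  have [->|/vV Vb] := eqVneq (v 0 b) 0; first by rewrite scale0r sub0mx.
  apply: scalemx_sub; have bW : b \in W by [].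
  have -> : row b (M i) = row (enum_rank_in bW b) (rowsub f (M i)).
    by apply/rowP => c; rewrite !mxE /f enum_rankK_in.
  exact: row_sub.
by apply/mxrankS/row_subP => a; rewrite row_rowsub row_sub.
Qed.

Lemma card_matching i : #|U : pred 'I_(n i)| = #|V : pred 'I_(n i.+1)|.
Proof.
rewrite -[RHS](card_in_imset (f := dn) (D := V : pred 'I_(n i.+1))); last exact: dn_inj.
apply: eq_card => u; apply/idP/imsetP => [/dn_surj[v Vv <-]|[v Vv ->]].
  by exists v.
exact: dnU.
Qed.

End Matching.

(** * The resolution modulo the maximal ideal *)

Section LeadingPart.
Variables (k : fieldType) (N : nat) (P : {set 'I_N}) (ed : 'I_N -> {set 'I_N}).
Hypothesis ed_self : forall p, p \in P -> p \in ed p.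
Hypothesis ed_private : forall p q, p \in P -> q \in P -> p \in ed q -> p = q.
Hypothesis ed_big : forall p, p \in P -> (1 < #|ed p|)%N.
Implicit Types (S T A B : {set 'I_N}) (p : 'I_N) (i : nat).

Notation word := (seq {set 'I_N} * {set 'I_N})%type.
Notation CW := {freeg word / k}.
Notation wt := (wt ed).
Notation span := (span ed).
Notation letter := (letter P).
Notation letters := (letters P).
Implicit Types (w u : seq {set 'I_N}) (v y : word).

(** For orthogonal S and T the monomials m_S and m_T are coprime, so that
    u_S u_T = u_(S :|: T) up to sign, without a monomial coefficient. *)
Definition orth S T := [disjoint span S & span T].

Lemma orthE S T : orth S T = (span S :&: span T == set0).
Proof. by rewrite setI_eq0. Qed.

Lemma orthC S T : orth S T = orth T S.
Proof. exact: disjoint_sym. Qed.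

Lemma orthUl S S' T : orth (S :|: S') T = orth S T && orth S' T.
Proof. by rewrite /orth spanU disjointUl. Qed.

Lemma orth_disjoint S T : S \subset P -> T \subset P -> orth S T -> [disjoint S & T].
Proof.
move=> SP TP; rewrite /orth -!setI_eq0 -!subset0 => oST.
by apply: subset_trans oST; apply: setISS; apply: (sub_span ed_self).
Qed.

(** The words obtained by merging two consecutive letters that span disjoint sets. *)
Fixpoint merges w : seq (seq {set 'I_N}) :=
  if w is T :: w' then
    (if w' is T' :: w'' then if orth T T' then [:: (T :|: T') :: w''] else [::] else [::])
    ++ [seq T :: u | u <- merges w']
  else [::].

Lemma in_spanU S T x : orth S T ->
  ((x \in span (S :|: T)) = (x \in span S) + (x \in span T) :> nat)%N.
Proof.
rewrite spanU inE => dST; case: (boolP (x \in span S)) => xS /=; last by [].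
by rewrite (disjointFr dST xS).
Qed.

Lemma merges_wt w u A x : u \in merges w -> wt (u, A) x = wt (w, A) x.
Proof.
elim: w u => [|T w IH] u //=; rewrite mem_cat => /orP[|/mapP[u' /IH wu' ->]]; last first.
  by rewrite !wt_cons wu'.
case: w {IH} => [|T' w] //; case: ifP => //= dTT'; rewrite inE => /eqP->.
by rewrite !wt_cons in_spanU // addnA.
Qed.

(** Whence the minimality of the Taylor resolution: removing an edge from S removes its
    private vertex from the support of m_S. *)
Lemma span_private S a : S \subset P -> a \in S -> a \notin span (S :\ a).
Proof.
move=> SP aS; apply/bigcupP => -[q]; rewrite !inE => /andP[qa qS] aq.
have := ed_private (subsetP SP _ aS) (subsetP SP _ qS) aq => E.
by rewrite E eqxx in qa.
Qed.

Lemma span_proper S : letter S -> exists2 x, x \in span S & x \notin S.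
Proof.
case/andP=> /set0Pn[p pS] SP; have pP := subsetP SP _ pS.
have : ed p :\ p != set0.
  by rewrite -card_gt0; have := ed_big pP; rewrite (cardsD1 p) ed_self.
case/set0Pn=> x; rewrite !inE => /andP[xp xe]; exists x.
  by apply/bigcupP; exists p.
apply: contra xp => xS; apply/eqP; exact: ed_private (subsetP SP _ xS) pP xe.
Qed.

Lemma coeff_bar_inF S (z : CW) u B : S != set0 ->
  coeff (u, B) (bar (inF S z)) =
  if u is T :: u' then if S == T then coeff (u', B) z else 0 else 0.
Proof.
move=> S0; have: supported (fun=> True) z by [].
elim/supported_ind => [|c [w A] {}z _ _ IH].
  by rewrite !linear0 !coeff0; case: u => // T u'; rewrite coeff0 if_same.
rewrite !linearP /= !coeffD !coeffZ IH inFE barE (negPf S0) coeff_delta.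
case: u {IH} => [|T u']; first by rewrite xpair_eqE /= mulr0 add0r.
rewrite coeffD coeffZ coeff_delta xpair_eqE eqseq_cons -andbA xpair_eqE.
by case: (S == T); rewrite //= mulr0 addr0.
Qed.

Lemma coeff_dword_cons S w A u B : letters (S :: w) ->
  (forall x, wt (u, B) x = wt (S :: w, A) x) ->
  coeff (u, B) (dword k (S :: w) A) = - (-1) ^+ #|S| *
    ((if w is T :: w' then ext k S T * (((S :|: T) :: w', A) == (u, B))%:R else 0) +
     (if u is T :: u' then if S == T then coeff (u', B) (dword k w A) else 0 else 0)).
Proof.
move=> lSw wt_eq; have /andP[lS lw] := lSw; move=> {lSw}; have [S0 SP] := andP lS.
have [x xS xnS] := span_proper lS.
rewrite dword_cons coeffB coeffN.
have -> : coeff (u, B) (act (delta (S, (w, A)) : {freeg _ / k})) = 0.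
  rewrite actE; case: w lw wt_eq => [|T w] lw wt_eq; last exact: coeff0.
  rewrite coeffZ coeff_delta; case: eqP => [E|_]; last by rewrite mulr0.
  have := wt_eq x; rewrite -E wt_cons xS !wt_nil inE (negPf xnS).
  by case: (x \in A).
rewrite oppr0 sub0r dYE linearD linearZ /= coeffD coeffZ.
have -> : coeff (u, B) (bar (d0 (delta (S, (w, A)) : {freeg _ / k}))) = 0.
  rewrite d0E linear_sum coeff_sum big1 // => a aS.
  rewrite linearZ /= coeffZ barE; case: ifP => _; first by rewrite coeff0 mulr0.
  rewrite coeff_delta; case: eqP => [E|_]; last by rewrite mulr0.
  have := wt_eq a; rewrite -E !wt_cons (negPf (span_private SP aS)).
  rewrite (subsetP (sub_span ed_self SP) _ aS) add0n add1n => /eqP.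
  by rewrite -[X in X == _]addn0 -addn1 eqn_add2l.
rewrite add0r -mulNr; congr (_ * _).
rewrite /d1 !linearD /= lm_inF coeffD coeff_bar_inF //; congr (_ + _).
rewrite /front /=; case: w lw wt_eq => [|T w] _ _; first by rewrite !linear0 coeff0.
rewrite lmE linearZ /= coeffZ barE setU_eq0 (negPf S0) /= coeff_delta //.
Qed.

Lemma merges_letters w u : letters w -> u \in merges w -> letters u.
Proof.
elim: w u => [|T w IH] u //= /andP[lT lw]; rewrite mem_cat => /orP[|/mapP[u' u'w ->]]; last first.
  by rewrite /= lT IH.
case: w {IH} lw => [|T' w] //= /andP[lT' lw]; case: ifP => //= _; rewrite inE => /eqP->.
have [T0 TP] := andP lT; have [T'0 TP'] := andP lT'.
by rewrite /= lw andbT; apply/andP; rewrite setU_eq0 (negPf T0) subUset TP TP'.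
Qed.

(** A coefficient of the differential over the hypergraph algebra is a unit iff both
    words have the same multidegree.  Differentiating e_A or a letter, or letting the
    last letter act on e_A, loses variables; a product of two letters loses none iff
    they are orthogonal. *)
Lemma coeff_dword_merges w A u B : letters w ->
  (forall x, wt (u, B) x = wt (w, A) x) ->
  (coeff (u, B) (dword k w A) != 0) = (B == A) && (u \in merges w).
Proof.
elim: w u => [|S w IH] u lw wt_eq.
  rewrite andbF; apply/negbTE; rewrite negbK /= coeff_sum big1 // => a aA.
  rewrite coeffZ coeff_delta; case: eqP => [[Eu EB]|_]; last by rewrite mulr0.
  have := wt_eq a; rewrite -Eu -EB !wt_nil !inE eqxx aA //.
rewrite coeff_dword_cons // mulf_eq0 oppr_eq0 signr_eq0 /=.
have /andP[lS lw'] := lw; have [S0 SP] := andP lS.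
have IH' u' : (forall x, wt (S :: u', B) x = wt (S :: w, A) x) ->
    (coeff (u', B) (dword k w A) != 0) = (B == A) && (u' \in merges w).
  move=> Hu'; apply: IH => // x; apply/eqP; have := Hu' x.
  by rewrite !wt_cons => /eqP; rewrite eqn_add2l.
rewrite mem_cat andb_orr.
case: u wt_eq => [|T u] wt_eq.
  rewrite addr0; have -> : [::] \in [seq S :: u0 | u0 <- merges w] = false.
    by apply/negP => /mapP[].
  case: w lw lw' wt_eq {IH IH'} => [|T w] lw lw' wt_eq; rewrite ?eqxx ?andbF //.
  rewrite xpair_eqE /= mulr0 eqxx; case: ifP; rewrite ?inE ?andbF //.
have map_in : (T :: u \in [seq S :: u0 | u0 <- merges w]) = (S == T) && (u \in merges w).
  apply/mapP/andP => [[u' u'w [-> ->]]|[/eqP-> uw]]; first by rewrite eqxx.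
  by exists u.
rewrite map_in; have [ST|ST] := eqVneq S T.
  rewrite -ST in wt_eq *; rewrite /= -IH' //.
  case: w lw lw' wt_eq {IH IH' map_in} => [|T' w] lw lw' wt_eq; first by rewrite add0r andbF.
  rewrite xpair_eqE eqseq_cons.
  have [E|nE] := eqVneq (S :|: T') S.
    have T'S : T' \subset S by rewrite -E subsetUr.
    have /andP[/andP[T'0 T'P] _] := lw'.
    have nd : ~~ [disjoint S & T'].
      rewrite -setI_eq0; case/set0Pn: T'0 => a aT'; apply/set0Pn; exists a.
      by rewrite inE aT' (subsetP T'S).
    rewrite (ext_eq0 _ nd) mul0r add0r; case: ifP => [/(orth_disjoint SP T'P)|_].
      by rewrite (negPf nd).
    by rewrite andbF.
  rewrite /= mulr0 add0r; case: ifP => _; rewrite ?inE ?eqseq_cons ?andbF //=.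
  by rewrite [S == _]eq_sym (negPf nE) /= andbF.
rewrite /= andbF orbF addr0.
case: w lw lw' wt_eq {IH IH' map_in} => [|T' w] lw lw' wt_eq; first by rewrite eqxx andbF.
have /andP[/andP[T'0 T'P] _] := lw'.
rewrite xpair_eqE mulf_eq0 negb_or ext_neq0.
case: (boolP (orth S T')) => [oST'|noST'].
  rewrite (orth_disjoint SP T'P oST') /= inE [T :: u == _]eq_sym [B == A]eq_sym andbC.
  by case: (_ && _); rewrite ?eqxx ?oner_eq0.
rewrite andbF; apply/negbTE; rewrite negb_and; apply/orP; right; rewrite negbK.
case: andP => [[/eqP E /eqP EA]|_] //; exfalso.
case/negP: noST'; rewrite /orth -setI_eq0 -subset0; apply/subsetP => x.
rewrite inE => /andP[xS xT']; have := wt_eq x.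
by rewrite -E -EA !wt_cons spanU inE xS xT' /= addnA => /eqP; rewrite eqn_add2r.
Qed.

End LeadingPart.

(** * Connected components *)

Section Components.
Variables (N : nat) (P : {set 'I_N}) (ed : 'I_N -> {set 'I_N}).
Hypothesis ed_self : forall p, p \in P -> p \in ed p.
Implicit Types (S T A B C D E : {set 'I_N}) (p x : 'I_N).
Notation orth := (orth ed).

(** Connectedness in the graph of the edges that meet, without reference to paths. *)
Definition conn C : bool :=
  (C != set0) && [forall D : {set 'I_N},
    [&& D \subset C, D != set0 & orth D (C :\: D)] ==> (D == C)].

Definition comps S : {set {set 'I_N}} :=
  [set C : {set 'I_N} | [&& C \subset S, conn C & orth C (S :\: C)]].

Lemma orth_sub S S' T T' : S \subset S' -> T \subset T' -> orth S' T' -> orth S T.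
Proof.
move=> SS' TT'; rewrite !orthE -!subset0 => o.
by apply: subset_trans o; apply: setISS; apply: span_sub.
Qed.

Lemma orth0 S : orth S set0.
Proof. by rewrite orthE span0 setI0. Qed.

Lemma connP C : reflect (C != set0 /\ forall D, D \subset C -> D != set0 ->
  orth D (C :\: D) -> D = C) (conn C).
Proof.
apply: (iffP andP) => -[C0 HC]; split=> //.
  move=> D DC D0 oD; apply/eqP; move/forallP/(_ D)/implyP: HC; apply.
  by rewrite DC D0.
by apply/forallP => D; apply/implyP => /and3P[DC D0 oD]; rewrite (HC D).
Qed.

Lemma compsP S C : reflect [/\ C \subset S, conn C & orth C (S :\: C)] (C \in comps S).
Proof. by rewrite inE; apply: and3P. Qed.

Lemma comps_sub S C : C \in comps S -> C \subset S.
Proof. by case/compsP. Qed.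

Lemma comps_conn S C : C \in comps S -> conn C.
Proof. by case/compsP. Qed.

Lemma conn_neq0 C : conn C -> C != set0.
Proof. by case/andP. Qed.

Lemma comps_neq0 S C : C \in comps S -> C != set0.
Proof. by move/comps_conn/conn_neq0. Qed.

Lemma comps_setU S T : S \subset P -> T \subset P -> orth S T ->
  comps (S :|: T) = comps S :|: comps T.
Proof.
move=> SP TP oST; have oTS : orth T S by rewrite orthC.
have dST := orth_disjoint ed_self SP TP oST.
have half A B C : orth A B -> [disjoint A & B] -> C \in comps A -> C \in comps (A :|: B).
  move=> oAB dAB /compsP[CA cC oC]; apply/compsP; split=> //.
    exact: subset_trans CA (subsetUl _ _).
  rewrite setDUl orthC orthUl orthC oC orthC (orth_sub CA _ oAB) //; exact: subsetDl.
apply/setP => C; rewrite in_setU; apply/idP/orP => [|[]]; last first.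
- by rewrite setUC; apply: half => //; rewrite disjoint_sym.
- exact: half.
case/compsP => Csub cC oC; have [C0 HC] := connP _ cC.
have [CS|CS] := eqVneq (C :&: S) set0.
  right; have CT : C \subset T.
    apply/subsetP => x xC; have := subsetP Csub x xC; rewrite inE => /orP[xS|//].
    by have : x \in C :&: S; [rewrite inE xC|rewrite CS inE].
  by apply/compsP; split=> //; apply: orth_sub oC => //; apply: setSD; apply: subsetUr.
left; have ECS : C :&: S = C.
  apply: HC => //; first exact: subsetIl.
  apply: orth_sub oST; first exact: subsetIr.
  apply/subsetP => x; rewrite !inE negb_and => /andP[/orP[/negPf->//|xS] xC].
  by have := subsetP Csub x xC; rewrite inE (negPf xS).
have CS' : C \subset S by rewrite -ECS subsetIr.
by apply/compsP; split=> //; apply: orth_sub oC => //; apply: setSD; apply: subsetUl.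
Qed.

Lemma comps_conn1 C : conn C -> comps C = [set C].
Proof.
move=> cC; have [C0 HC] := connP _ cC; apply/setP => D; rewrite inE in_set1.
apply/and3P/eqP => [[DC cD oD]|->]; last by rewrite subxx cC setDv orth0.
by apply: HC => //; apply: conn_neq0.
Qed.

Lemma conn_comps C : (C \in comps C) = conn C.
Proof. by rewrite inE subxx setDv orth0 andbT. Qed.

Lemma comps0 : comps set0 = set0.
Proof.
apply/setP => C; rewrite [RHS]inE; apply/negP => /compsP[]; rewrite subset0.
by move=> /eqP-> /conn_neq0; rewrite eqxx.
Qed.

Lemma setUD_comp S C : C \in comps S -> C :|: (S :\: C) = S.
Proof. by move=> CS; rewrite -{1}(setIidPr (comps_sub CS)) setID. Qed.

Lemma orth_comp S C : C \in comps S -> orth C (S :\: C).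
Proof. by case/compsP. Qed.

Lemma comps_setD S C : S \subset P -> C \in comps S -> comps S = C |: comps (S :\: C).
Proof.
move=> SP CS; rewrite -{1}(setUD_comp CS) comps_setU ?orth_comp //.
- by rewrite comps_conn1 // (comps_conn CS).
- exact: subset_trans (comps_sub CS) SP.
by apply: subset_trans (subsetDl _ _) SP.
Qed.

Lemma comp_notin_setD S C : C != set0 -> C \notin comps (S :\: C).
Proof.
case/set0Pn => x xC; apply/negP => /comps_sub/subsetP/(_ x xC).
by rewrite inE xC.
Qed.

(** The component of x is a smallest set that contains x and is orthogonal to the rest
    of S. *)
Lemma comps_cover S x : x \in S -> exists2 C, C \in comps S & x \in C.
Proof.
move=> xS; pose Q D := [&& x \in D, D \subset S & orth D (S :\: D)].
have QS : Q S by rewrite /Q xS subxx setDv orth0.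
case: (arg_minnP (fun D => #|D|) QS) => C /and3P[xC CS oC] Cmin.
exists C => //; apply/compsP; split=> //; apply/connP; split=> [|E EC E0 oE].
  by apply/set0Pn; exists x.
have oEr : orth E (S :\: E).
  apply: (orth_sub (subxx E) _ (_ : orth E ((C :\: E) :|: (S :\: C)))).
    by apply/subsetP => y; rewrite !inE => /andP[-> ->]; case: (y \in C).
  by rewrite orthC orthUl orthC oE orthC (orth_sub EC _ oC).
have [xE|xE] := boolP (x \in E).
  apply/eqP; rewrite eqEcard EC Cmin //; apply/and3P; split=> //.
  exact: subset_trans EC CS.
have QCE : Q (C :\: E).
  apply/and3P; split; first by rewrite inE xE.
    exact: subset_trans (subsetDl _ _) CS.
  apply: (orth_sub (subxx _) _ (_ : orth (C :\: E) (E :|: (S :\: C)))).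
    by apply/subsetP => y; rewrite !inE; case: (y \in E); case: (y \in C).
  by rewrite orthC orthUl oE orthC (orth_sub (subsetDl _ _) _ oC).
have := Cmin _ QCE; rewrite cardsD (setIidPr EC).
have E1 : (0 < #|E|)%N by rewrite card_gt0.
by have := subset_leq_card EC; lia.
Qed.

Lemma comps_eq0 S : (comps S == set0) = (S == set0).
Proof.
apply/eqP/eqP => [S0|->]; last exact: comps0.
apply/eqP; rewrite -subset0; apply/subsetP => x /comps_cover[C].
by rewrite S0 inE.
Qed.

Lemma orth_comps S T : (forall C, C \in comps S -> orth C T) -> orth S T.
Proof.
move=> H; rewrite orthE -subset0; apply/subsetP => y.
rewrite inE => /andP[/bigcupP[x xS xy] yT].
have [C CS xC] := comps_cover xS; have := H C CS.
rewrite orthE setI_eq0 => /disjointFl/(_ yT)/negbT/negP; case.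
by apply/bigcupP; exists x.
Qed.

End Components.

(** * The matching on words *)

Section WordMatching.
Variables (N : nat) (P : {set 'I_N}) (ed : 'I_N -> {set 'I_N}).
Hypothesis ed_self : forall p, p \in P -> p \in ed p.
Implicit Types (S T : {set 'I_N}) (a b : {set 'I_N}) (F : {set {set 'I_N}}).
Implicit Types (u v w : seq {set 'I_N}).
Notation orth := (orth ed).
Notation letter := (letter P).
Notation letters := (letters P).
Notation conn := (conn ed).
Notation comps := (comps ed).
Notation merges := (merges ed).

Definition rk a : nat := enum_rank a.

Lemma rk_inj : injective rk.
Proof. by move=> a b /val_inj/enum_rank_inj. Qed.

(** Words of connected letters represent elements of the trace monoid in which
    orthogonal connected sets commute, a general letter being the product of its
    components; [front_set w] is the set of the possible first letters of the trace of w. *)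
Fixpoint front_set w : {set {set 'I_N}} :=
  if w is T :: w' then comps T :|: [set b in front_set w' | orth b T] else set0.

Arguments front_set : simpl never.

Lemma front_cons T w :
  front_set (T :: w) = comps T :|: [set b in front_set w | orth b T].
Proof. by []. Qed.

(** An arbitrary total order on the letters selects one of the possible first letters. *)
Definition lead F : {set 'I_N} :=
  odflt set0 [pick a in F | [forall (b | b \in F), rk a <= rk b]%N].

Lemma leadP F : F != set0 -> lead F \in F /\ forall b, b \in F -> (rk (lead F) <= rk b)%N.
Proof.
case/set0Pn=> b0 b0F; rewrite /lead; case: pickP => [a /andP[aF /forall_inP Ha] //|none].
case: (arg_minnP rk b0F) => a aF' amin; have aF : a \in F := aF'; have := none a; rewrite /= aF /=.
by move/negbT/negP; case; apply/forall_inP.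
Qed.

Lemma lead_eq F a : a \in F -> (forall b, b \in F -> (rk a <= rk b)%N) -> lead F = a.
Proof.
move=> aF amin; have [|lF lmin] := @leadP F; first by apply/set0Pn; exists a.
by apply: rk_inj; apply/eqP; rewrite eqn_leq lmin ?amin.
Qed.

Lemma mem_front_cons T w b :
  (b \in front_set (T :: w)) = (b \in comps T) || (b \in front_set w) && orth b T.
Proof. by rewrite in_setU [b \in [set _ in _ | _]]inE. Qed.

Lemma front_prop w b : letters w -> b \in front_set w -> conn b /\ letter b.
Proof.
elim: w => [|T w IH] /=; first by rewrite inE.
case/andP=> lT lw; rewrite mem_front_cons => /orP[bT|/andP[bw _]]; last exact: IH.
have cb := comps_conn bT; split=> //; apply/andP; split; first exact: conn_neq0 cb.
by case/andP: lT => _; apply: subset_trans; apply: comps_sub bT.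
Qed.

Lemma front_neq0 T w : letter T -> front_set (T :: w) != set0.
Proof.
case/andP=> T0 _; have := T0; rewrite -(comps_eq0 ed) => /set0Pn[b bT].
by apply/set0Pn; exists b; rewrite mem_front_cons bT.
Qed.

(** Merging two letters does not change the trace. *)
Lemma front_merges w u : letters w -> u \in merges w -> front_set u = front_set w.
Proof.
elim: w u => [|T w IH] u // lTw; have /andP[lT lw] := lTw.
rewrite mem_cat => /orP[|/mapP[u' u'w ->]]; last by rewrite !front_cons (IH u').
case: w IH lTw lw => [|T' w] // _ _ /andP[lT' lw]; case: ifP => // oTT'; rewrite inE => /eqP->.
have [_ TP] := andP lT; have [_ TP'] := andP lT'.
apply/setP => b; rewrite !mem_front_cons (comps_setU ed_self TP TP' oTT') in_setU.
rewrite -orbA (orthC _ b (T :|: T')) orthUl (orthC _ T) (orthC _ T').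
have [bT'|_] := boolP (b \in comps T').
  by rewrite (orth_sub (comps_sub bT') (subxx T)) // orthC.
by rewrite /= andbA andbAC.
Qed.

(** The set a occurs in w as a component of a letter; [lone a w] says that the
    first letter where it occurs is a itself, and [split] and [join] detach a from,
    or attach it to, the preceding letter. *)
Fixpoint lone a w : bool :=
  if w is T :: w' then if a \in comps T then T == a else lone a w' else false.
Fixpoint split a w : seq {set 'I_N} :=
  if w is T :: w' then
    if a \in comps T then (T :\: a) :: a :: w' else T :: split a w'
  else [::].
Fixpoint join a w : seq {set 'I_N} :=
  if w is T :: w' then
    if w' is T' :: w'' then if T' == a then (T :|: a) :: w'' else T :: join a w'
    else w
  else w.
Fixpoint pos a w : nat :=
  if w is T :: w' then if a \in comps T then 0%N else (pos a w').+1 else 0%N.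

Lemma comps_self_neq a T : conn a -> a \notin comps T -> T != a.
Proof. by move=> ca; apply: contraNneq => ->; rewrite conn_comps. Qed.

Lemma setU_orth_neq S T : letter S -> letter T -> orth S T -> S :|: T != S.
Proof.
move=> /andP[_ SP] /andP[T0 TP] oST; have := orth_disjoint ed_self SP TP oST.
rewrite -setI_eq0 => dST; apply: contraNneq T0 => E.
by rewrite -subset0 -(eqP dST) subsetI subxx andbT -E subsetUr.
Qed.

Lemma splitP a w : letters w -> a \in front_set w -> ~~ lone a w ->
  [/\ w \in merges (split a w), letters (split a w), lone a (split a w),
      join a (split a w) = w & pos a (split a w) = (pos a w).+1] /\
  head set0 (split a w) != a.
Proof.
elim: w => [|T w IH] lTw; first by rewrite inE.
have /andP[lT lw] := lTw; move=> aF; have [ca la] := front_prop lTw aF.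
have [a0 aP] := andP la; have [T0 TP] := andP lT.
move: aF; rewrite mem_front_cons /=; have [aT _ Ta|aT /= /andP[aw oaT] na] := boolP (a \in comps T).
  have lTa : letter (T :\: a).
    apply/andP; split; last exact: subset_trans (subsetDl _ _) TP.
    by apply: contraNneq Ta => TD; rewrite -(setUD_comp aT) TD setU0.
  have oTa : orth (T :\: a) a by rewrite orthC; case/compsP: aT.
  have ETa : T :\: a :|: a = T by rewrite setUC (setUD_comp aT).
  rewrite /= (negPf (comp_notin_setD ed T (conn_neq0 ca))) conn_comps ca oTa ETa !eqxx /=.
  split; first split=> //; first by rewrite inE eqxx.
    by apply/and3P.
  apply: contraNneq a0 => E; apply/eqP/setP => x; rewrite inE; apply/negP => xa.
  by have: x \in T :\: a; [rewrite E|rewrite inE xa].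
have [[m l lo jo po] hd] := IH lw aw na; rewrite (negPf aT).
split; last exact: comps_self_neq.
case E: (split a w) => [|X Y]; first by rewrite E in m.
rewrite E in m l lo jo po hd; rewrite /= in hd.
split=> //; last by rewrite po.
- by rewrite mem_cat (map_f (cons T) m) orbT.
- by apply/andP.
by rewrite (negPf hd) jo.
Qed.

Lemma joinP a v : letters v -> a \in front_set v -> lone a v -> head set0 v != a ->
  [/\ join a v \in merges v, ~~ lone a (join a v), split a (join a v) = v &
      head set0 (join a v) != a].
Proof.
elim: v => [|T v IH] lTv; first by rewrite inE.
have /andP[lT lv] := lTv; move=> aF; have [ca la] := front_prop lTv aF.
have [a0 aP] := andP la; have [T0 TP] := andP lT.
move: aF; rewrite mem_front_cons /=;
  have [aT _ /eqP-> /eqP//|aT /= /andP[av oaT] lo Ta] := boolP (a \in comps T).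
case: v IH lTv lv av lo => [|T' v] IH lTv lv av lo //.
have [E|T'a] := eqVneq T' a.
  have oTa : orth T a by rewrite orthC.
  have nTa : T :|: a != a.
    by rewrite setUC setU_orth_neq.
  have aTa : a \in comps (T :|: a).
    by rewrite (comps_setU ed_self TP aP oTa) in_setU conn_comps ca orbT.
  have ETa : (T :|: a) :\: a = T.
    rewrite setDUl setDv setU0; apply/setDidPl; exact: (orth_disjoint ed_self TP aP).
  rewrite E oTa /= aTa ETa; split=> //.
  by rewrite inE eqxx.
have [m nl sp hd] := IH lv av lo T'a.
rewrite /= (negPf aT) nl sp; split=> //.
by rewrite -[X in _ \in X]/(merges (T :: T' :: v)) /= mem_cat (map_f (cons T) m) orbT.
Qed.

Lemma head_merges a v u : letters v -> conn a -> u \in merges v ->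
  head set0 v != a -> head set0 u != a.
Proof.
case: v => [|T v] // lTv ca; have /andP[/andP[T0 TP] lv] := lTv.
rewrite mem_cat => /orP[|/mapP[u' _ ->]] //.
case: v lTv lv => [|T' v] // _ /andP[/andP[T'0 TP'] _]; case: ifP => // oTT'.
rewrite inE => /eqP-> _ /=; apply: contraTneq ca => <-; apply/connP => -[_ /(_ T)].
have d := orth_disjoint ed_self TP TP' oTT'.
rewrite subsetUl T0 setDUl setDv set0U (setDidPl _) 1?disjoint_sym // oTT'.
move=> /(_ isT isT isT) E; case/set0Pn: T'0 => x xT'.
have : x \in T by rewrite E inE xT' orbT.
by rewrite (disjointFl d xT').
Qed.

Lemma merges_lone_head a w u : letters (a :: w) -> conn a -> u \in merges (a :: w) ->
  lone a u || (pos a u == 0%N).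
Proof.
move=> law ca; have /andP[/andP[a0 aP] lw] := law.
rewrite mem_cat => /orP[|/mapP[u' _ ->]]; last by rewrite /= conn_comps ca eqxx.
case: w {law} lw => [|T w] // /andP[/andP[_ TP] _]; case: ifP => // oaT.
rewrite inE => /eqP-> /=.
by rewrite (comps_setU ed_self aP TP oaT) in_setU conn_comps ca orbT.
Qed.

(** A merge to the left of a joins a to a letter, which is [join a], or keeps a alone;
    a merge to the right of a keeps its position. *)
Lemma merges_lone a v u : letters v -> a \in front_set v -> lone a v ->
  head set0 v != a -> u \in merges v ->
  [|| lone a u, u == join a v | pos a u == pos a v].
Proof.
elim: v u => [|T v IH] u lTv; first by rewrite inE.
have /andP[lT lv] := lTv; move=> aF; have [ca la] := front_prop lTv aF.
have [a0 aP] := andP la; have [T0 TP] := andP lT.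
move: aF; rewrite mem_front_cons /=;
  have [aT _ /eqP-> /eqP//|aT /= /andP[av oaT] lo Ta] := boolP (a \in comps T).
case: v IH lTv lv av lo => [|T' v] IH lTv lv av lo //.
have [E|T'a] := eqVneq T' a.
  rewrite mem_cat => /orP[|/mapP[u' u'v ->]].
    by case: ifP => // _; rewrite inE E => /eqP->; rewrite eqxx orbT.
  rewrite /= (negPf aT) E conn_comps ca eqSS.
  by rewrite E in u'v lv; case/orP: (merges_lone_head lv ca u'v) => ->; rewrite ?orbT.
rewrite mem_cat => /orP[|/mapP[u' u'v ->]]; last first.
  rewrite /= (negPf aT) eqSS eqseq_cons eqxx /=; exact: IH.
case: ifP => // oTT'; rewrite inE => /eqP-> /=.
have /andP[/andP[_ TP'] _] := lv; move: lo => /=.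
rewrite (comps_setU ed_self TP TP' oTT') in_setU (negPf aT) /=.
by case: ifP => [_ /eqP E|_ -> //]; rewrite E eqxx in T'a.
Qed.

(** The matching.  A letter at the beginning of w is skipped as long as it is the leading
    letter of the trace of the remaining word.  At the first other letter, the leading
    letter a of the remaining trace is split off if it is part of a larger letter, and
    joined to the preceding letter if it is alone.  The merged word [down w] has type U,
    and the longer word type V; the critical words are those skipped to the end. *)
Fixpoint isU w : bool :=
  if w is T :: w' then
    let a := lead (front_set w) in if T == a then isU w' else ~~ lone a w
  else false.
Fixpoint isV w : bool :=
  if w is T :: w' then
    let a := lead (front_set w) in if T == a then isV w' else lone a w
  else false.
Fixpoint up w : seq {set 'I_N} :=
  if w is T :: w' then
    let a := lead (front_set w) in if T == a then T :: up w' else split a w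
  else [::].
Fixpoint down w : seq {set 'I_N} :=
  if w is T :: w' then
    let a := lead (front_set w) in if T == a then T :: down w' else join a w
  else [::].
(** Lexicographic order on the number of skipped letters and on the position of a,
    counted from the right; D bounds the length of the words. *)
Fixpoint key D w : nat :=
  if w is T :: w' then
    let a := lead (front_set w) in if T == a then (D + key D w')%N else (D - pos a w)%N
  else 0%N.

Lemma isU_cons T w : isU (T :: w) =
  if T == lead (front_set (T :: w)) then isU w
  else ~~ lone (lead (front_set (T :: w))) (T :: w).
Proof. by []. Qed.
Lemma isV_cons T w : isV (T :: w) =
  if T == lead (front_set (T :: w)) then isV w
  else lone (lead (front_set (T :: w))) (T :: w).
Proof. by []. Qed.
Lemma up_cons T w : up (T :: w) =
  if T == lead (front_set (T :: w)) then T :: up w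
  else split (lead (front_set (T :: w))) (T :: w).
Proof. by []. Qed.
Lemma down_cons T w : down (T :: w) =
  if T == lead (front_set (T :: w)) then T :: down w
  else join (lead (front_set (T :: w))) (T :: w).
Proof. by []. Qed.
Lemma key_cons D T w : key D (T :: w) =
  if T == lead (front_set (T :: w)) then (D + key D w)%N
  else (D - pos (lead (front_set (T :: w))) (T :: w))%N.
Proof. by []. Qed.

Lemma isUV w : isU w -> ~~ isV w.
Proof.
by elim: w => // T w IH; rewrite isU_cons isV_cons; case: ifP => // _; rewrite negbK.
Qed.

Lemma upP w : letters w -> isU w ->
  [/\ w \in merges (up w), letters (up w), isV (up w) & down (up w) = w].
Proof.
elim: w => // T w IH lTw; have /andP[lT lw] := lTw.
have [aF _] := leadP (front_neq0 w lT).
rewrite isU_cons up_cons; set a := lead _ in aF *.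
case: ifP => [/eqP Ta|/negbT Ta].
  move=> Uw; have [m l Vw dw] := IH lw Uw.
  have lTup : letters (T :: up w) by apply/andP.
  have mT : T :: w \in merges (T :: up w) by rewrite mem_cat (map_f (cons T) m) orbT.
  rewrite isV_cons down_cons.
  by rewrite -(front_merges lTup mT) -/a -Ta eqxx dw.
move=> na; have [[m l lo jo _] hd] := splitP lTw aF na.
have fr := front_merges l m.
case E: (split a (T :: w)) m l lo jo hd fr => [|X Y] m l lo jo hd fr //.
by split=> //; rewrite ?isV_cons ?down_cons -fr -/a (negPf hd).
Qed.

Lemma downP v : letters v -> isV v ->
  [/\ down v \in merges v, isU (down v) & up (down v) = v].
Proof.
elim: v => // T v IH lTv; have /andP[lT lv] := lTv.
have [aF _] := leadP (front_neq0 v lT).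
rewrite isV_cons down_cons; set a := lead _ in aF *.
case: ifP => [/eqP Ta|/negbT Ta].
  move=> Vv; have [m Uv uv] := IH lv Vv.
  have mT : T :: down v \in merges (T :: v) by rewrite mem_cat (map_f (cons T) m) orbT.
  rewrite isU_cons up_cons.
  by rewrite (front_merges lTv mT) -/a -Ta eqxx uv.
move=> lo; have [m nl sp hd] := joinP lTv aF lo Ta.
have fr := front_merges lTv m.
case E: (join a (T :: v)) m nl sp hd fr => [|X Y] m nl sp hd fr; first by have := sp.
by rewrite isU_cons up_cons fr -/a (negPf hd).
Qed.

Lemma lone_pos_size a w : lone a w -> (pos a w < size w)%N.
Proof. by elim: w => //= T w IH; case: ifP. Qed.

(** A merge of v other than [down v] either merges skipped letters, and then fewer
    letters are skipped, or leaves a where it was, and then splitting a off puts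
    it one place further to the right. *)
Lemma key_triang D v u : (size v <= D)%N -> letters v -> isV v -> u \in merges v ->
  isU u -> u != down v -> (key D (up u) < key D v)%N.
Proof.
elim: v u => [|T v IH] u sD lTv // Vv mu Uu nu; have /andP[lT lv] := lTv.
have [aF amin] := leadP (front_neq0 v lT).
have lu := merges_letters lTv mu.
have [mup lup Vup dup] := upP lu Uu.
have fr := front_merges lTv mu.
have frup := front_merges lup mup.
move: Vv nu; rewrite isV_cons down_cons key_cons.
set a := lead _ in aF amin *; have [ca la] := front_prop lTv aF.
case: ifP => [/eqP Ta|/negbT Ta].
  move=> Vv nu; move: mu; rewrite mem_cat => /orP[|/mapP[u' u'v Eu]]; last first.
    have au' : lead (front_set (T :: u')) = T by rewrite -Eu fr -/a Ta.
    move: Uu nu; rewrite Eu isU_cons up_cons au' eqxx.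
    move=> Uu' nu'.
    have Eup : up u = T :: up u' by rewrite Eu up_cons au' eqxx.
    have au2 : lead (front_set (T :: up u')) = T by rewrite -Eup -frup fr -/a Ta.
    rewrite key_cons au2 eqxx ltn_add2l; apply: IH => //.
      exact: ltnW.
    by apply: contraNneq nu' => ->.
  case: v {IH nu} sD lTv lv Vv @a aF amin Ta fr ca la =>
    [|T' v] sD lTv lv Vv a aF amin Ta fr ca la //.
  case: ifP => // oTT'; rewrite inE => /eqP Eu; rewrite {}Eu in Uu lu mup lup Vup dup fr frup *.
  have /andP[lT' _] := lv; have nTT' := setU_orth_neq lT lT' oTT'.
  have [_ TP] := andP lT; have [_ TP'] := andP lT'.
  have cT : conn T by rewrite Ta.
  have TTT' : T \in comps (T :|: T').
    by rewrite (comps_setU ed_self TP TP' oTT') in_setU conn_comps cT.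
  have Eup : up ((T :|: T') :: v) = ((T :|: T') :\: T) :: T :: v.
    by rewrite up_cons fr -/a -Ta (negPf nTT') /= TTT'.
  have nT : (T :|: T') :\: T != T.
    apply: contraNneq (conn_neq0 cT) => E; apply/eqP/setP => x; rewrite inE; apply/negP => xT.
    by have: x \in (T :|: T') :\: T; [rewrite E|rewrite inE xT].
  have -> : key D (up ((T :|: T') :: v)) = (D - 1)%N.
    rewrite Eup key_cons -Eup -frup fr -/a -Ta (negPf nT) Eup /=.
    by rewrite (negPf (comp_notin_setD ed _ (conn_neq0 cT))) conn_comps cT.
  have D0 : (0 < D)%N by apply: leq_trans sD.
  by apply: leq_trans (leq_addr _ _); rewrite subn1 prednK.
move=> lo nu.
have hu := head_merges lTv ca mu Ta.
have poU : ~~ lone a u.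
  by move: Uu hu fr; case: {mu lu mup lup Vup dup frup nu} u => [|X Y] //;
    rewrite isU_cons => + hX E; rewrite E -/a (negPf hX).
have aFu : a \in front_set u by rewrite fr.
have [[_ _ _ _ posu] hsp] := splitP lu aFu poU.
have Eup : up u = split a u.
  by move: hu fr; case: {Uu mu lu mup lup Vup dup frup nu poU aFu posu hsp} u => [|X Y] // hX E;
    rewrite up_cons E -/a (negPf hX).
have := merges_lone lTv aF lo Ta mu; rewrite (negPf poU) (negPf nu) /= => /eqP pE.
have -> : key D (up u) = (D - pos a (up u))%N.
  move: frup hsp; rewrite Eup; case: (split a u) => [|X Y]; last first.
    by move=> E hX; rewrite key_cons -E fr -/a (negPf hX).
  by move=> E; move: aFu; rewrite E inE.
rewrite Eup posu pE; apply: ltn_sub2l => //.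
exact: leq_trans (lone_pos_size lo) sD.
Qed.

(** The length of the trace of w.  It separates the critical words, where it equals the
    length of w, from their merges, where it is larger. *)
Definition weight w : nat := (\sum_(S <- w) #|comps S|)%N.

Lemma merges_weight w u : letters w -> u \in merges w -> weight u = weight w.
Proof.
elim: w u => // T w IH u lTw; have /andP[lT lw] := lTw.
rewrite mem_cat => /orP[|/mapP[u' u'w ->]]; last by rewrite /weight !big_cons -!/(weight _) (IH u').
case: w {IH lTw} lw => // T' w /andP[lT' _]; case: ifP => // oTT'; rewrite inE => /eqP->.
have [T0 TP] := andP lT; have [_ TP'] := andP lT'.
rewrite /weight !big_cons addnA (comps_setU ed_self) // cardsU_disjoint //.
rewrite -setI_eq0 -subset0; apply/subsetP => C; rewrite inE => /andP[/comps_sub CT CT'].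
have := comps_neq0 CT'; rewrite -subset0.
have := orth_disjoint ed_self TP TP' oTT'; rewrite -setI_eq0 => /eqP <-.
by rewrite subsetI CT (comps_sub CT').
Qed.

Lemma merges_size w u : u \in merges w -> size w = (size u).+1.
Proof.
elim: w u => // T w IH u; rewrite mem_cat => /orP[|/mapP[u' /IH + ->]] /=; last by move=> ->.
by case: w {IH} => // T' w; case: ifP => // _; rewrite inE => /eqP->.
Qed.

Lemma merges_dg w u A : letters w -> u \in merges w -> dg (w, A) = (dg (u, A)).+1.
Proof.
elim: w u => // T w IH u lTw; have /andP[lT lw] := lTw.
rewrite mem_cat => /orP[|/mapP[u' u'w ->]]; last by rewrite !dg_cons (IH u') // addnS.
case: w {IH lTw} lw => // T' w /andP[lT' _]; case: ifP => // oTT'; rewrite inE => /eqP->.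
have [T0 TP] := andP lT; have [_ TP'] := andP lT'.
rewrite !dg_cons cardsU_disjoint; last exact: (orth_disjoint ed_self TP TP').
by rewrite !addSn !addnS addnA.
Qed.

Lemma crit_weight w : letters w -> ~~ isU w -> ~~ isV w -> weight w = size w.
Proof.
elim: w => [|T w IH] lTw; first by rewrite /weight big_nil.
have /andP[lT lw] := lTw; rewrite isU_cons isV_cons.
have [aF _] := leadP (front_neq0 w lT); set a := lead _ in aF *.
case: ifP => [/eqP Ta nU nV|_ /negPn-> //].
have [ca _] := front_prop lTw aF.
by rewrite /weight big_cons -/(weight w) IH // Ta comps_conn1 // cards1.
Qed.

(** The critical words are the normal forms of traces: every letter is connected, and
    no smaller letter can be moved in front of it. *)
Lemma crit_cons S w : letters (S :: w) ->
  (~~ isU (S :: w) && ~~ isV (S :: w)) =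
  [&& conn S, [forall (b | (b \in front_set w) && orth b S), rk S <= rk b]%N,
      ~~ isU w & ~~ isV w].
Proof.
move=> lSw; have /andP[lS lw] := lSw; have [S0 SP] := andP lS.
have [aF amin] := leadP (front_neq0 w lS).
rewrite isU_cons isV_cons; set a := lead _ in aF amin *.
have [ca _] := front_prop lSw aF.
case: ifP => [/eqP Sa|/negbT Sa].
  rewrite Sa ca /=; suff -> : [forall (b | (b \in front_set w) && orth b a), rk a <= rk b]%N by [].
  apply/forall_inP => b /andP[bw oba]; apply: amin.
  by rewrite mem_front_cons bw Sa oba orbT.
rewrite negbK andbN; apply/esym/negP => /and4P[cS /forall_inP Smin _ _].
case/eqP: Sa; apply/esym/lead_eq; first by rewrite mem_front_cons conn_comps cS.
move=> b; rewrite mem_front_cons comps_conn1 // in_set1 => /orP[/eqP-> //|bw].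
exact: Smin.
Qed.

End WordMatching.

(** * The dimensions of Tor *)

Lemma count_tnth (T : eqType) (s : seq T) (p : pred T) :
  #|[pred b : 'I_(size s) | p (tnth (in_tuple s) b)]| = count p s.
Proof. by rewrite -sum1_card -sum1_count [in RHS]big_tnth; apply: eq_bigl. Qed.

Section PrivateVertices.
Variables (k : fieldType) (N : nat) (H : hypergraph N).
Variables (P : {set 'I_N}) (ed : 'I_N -> {set 'I_N}).
Hypothesis ed_self : forall p, p \in P -> p \in ed p.
Hypothesis ed_private : forall p q, p \in P -> q \in P -> p \in ed q -> p = q.
Hypothesis ed_big : forall p, p \in P -> (1 < #|ed p|)%N.
Hypothesis edgesE : edges H = ed @: P.
Implicit Types (S T A : {set 'I_N}) (i : nat).

Notation word := (seq {set 'I_N} * {set 'I_N})%type.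
Notation words := (words P).
Notation letters := (letters P).
Notation isU := (isU ed).
Notation isV := (isV ed).
Notation down := (down ed).
Notation up := (up ed).
Notation merges := (merges ed).
Notation res := (bar_resolution k ed_self edgesE).
Notation wd := (@wd N P _).
Implicit Types (v : word).

Definition critical v : bool := ~~ isU v.1 && ~~ isV v.1.

Lemma criticalE v : critical v = ~~ isU v.1 && ~~ isV v.1.
Proof. by []. Qed.

Lemma tensor_diff_neq0 i (a : 'I_(size (words i.+1))) (b : 'I_(size (words i))) :
  (tensor_diff res i a b != 0) =
  ((wd b).2 == (wd a).2) && ((wd b).1 \in merges (wd a).1).
Proof.
have -> : tensor_diff res i a b = residue (res_mx k H P ed i a b) by rewrite mxE.
rewrite residue_res_mx; have := words_inW ed (wd_in a).
case: (wd a) => w A [lw _ _]; case: (wd b) => u B; rewrite dXE /=.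
case: (wtm ed (u, B) =P wtm ed (w, A)) => [E|nE].
  apply: (coeff_dword_merges k ed_self ed_private ed_big) => // x.
  by have := congr1 (fun m : 'X_{1..N} => m x) E; rewrite !mnmE.
rewrite eqxx; apply/esym/negP => /andP[/eqP EB uw]; case: nE; apply/mnmP => x.
by rewrite !mnmE EB (merges_wt _ _ uw).
Qed.

(** Some word of degree i is needed as a default value of [dn]. *)
Lemma words_pred i : (0 < size (words i.+1))%N -> (0 < size (words i))%N.
Proof.
case E: (words i.+1) => [|v s] // _.
have: v \in words i.+1 by rewrite E inE eqxx.
case: v {E} => w A; rewrite mem_words /= => /andP[lw /eqP dw].
suff [v vW] : exists v, v \in words i by case: (words i) vW.
have [A0|/set0Pn[a aA]] := eqVneq A set0; last first.
  exists (w, A :\ a); rewrite mem_words lw; apply/eqP/eq_add_S; rewrite -dw.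
  by rewrite /dg /= (cardsD1 a A) aA addnCA.
case: w lw dw => [|S w] lw dw; first by rewrite A0 /dg big_nil cards0 in dw.
have /andP[/andP[/set0Pn[a aS] SP] lw'] := lw.
have [S1|S1] := eqVneq (S :\ a) set0.
  exists (w, [set a]); rewrite mem_words; apply/andP; split=> //.
  apply/eqP/eq_add_S; rewrite -dw.
  by rewrite dg_cons A0 /dg /= !cards0 cards1 (cardsD1 a S) aS S1 cards0; lia.
exists (S :\ a :: w, A); rewrite mem_words; apply/andP; split.
  by apply/andP; split=> //; apply/andP; rewrite S1 (subset_trans _ SP) // subsetDl.
by apply/eqP/eq_add_S; rewrite -dw !dg_cons (cardsD1 a S) aS; lia.
Qed.

Definition index_or0 i v : nat :=
  if v \in words i then index v (words i) else 0%N.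

Lemma index_or0_lt i v : (0 < size (words i))%N -> (index_or0 i v < size (words i))%N.
Proof. by rewrite /index_or0; case: ifP => //; rewrite index_mem. Qed.

Lemma size_words_gt0 i (b : 'I_(size (words i.+1))) : (0 < size (words i))%N.
Proof. by apply: words_pred; apply: leq_ltn_trans (ltn_ord b). Qed.

Definition down_word v : word := (down v.1, v.2).
Definition dn i (b : 'I_(size (words i.+1))) : 'I_(size (words i)) :=
  Ordinal (index_or0_lt (down_word (wd b)) (size_words_gt0 b)).

Lemma wd_letters i (b : 'I_(size (words i))) : letters (wd b).1 && (dg (wd b) == i).
Proof. by rewrite -mem_words wd_in. Qed.

Lemma wd_index i v (lt : (index_or0 i v < size (words i))%N) : v \in words i ->
  wd (Ordinal lt) = v.
Proof. by move=> vW; rewrite (wdE v) /= /index_or0 vW nth_index. Qed.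

Lemma wd_dn i (b : 'I_(size (words i.+1))) : isV (wd b).1 -> wd (dn b) = down_word (wd b).
Proof.
move=> Vb; apply: wd_index; have /andP[lb /eqP db] := wd_letters b.
have [m _ _] := downP ed_self lb Vb.
rewrite mem_words (merges_letters lb m) /=; apply/eqP/eq_add_S; rewrite -[RHS]db.
by case: (wd b) lb m {Vb db} => w A lb m; rewrite (merges_dg ed_self A lb m).
Qed.

(** Q' holds for the words with a letter that is not connected. *)
Let V' i : pred 'I_(size (words i)) := [pred b | isV (wd b).1].
Let U' i : pred 'I_(size (words i)) := [pred b | isU (wd b).1].
Let Q' i : pred 'I_(size (words i)) := [pred b | size (wd b).1 < weight ed (wd b).1]%N.
Let key' i (b : 'I_(size (words i))) : nat := key ed i (wd b).1.

Lemma size_word w A : (size w <= dg (w, A))%N.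
Proof. by elim: w => // S w IH; rewrite dg_cons /= addSn ltnS (leq_trans IH) // leq_addl. Qed.

Let dn_matching : (forall i (b : 'I_(size (words i))), U' b -> ~~ V' b) /\
  [/\ forall i (v : 'I_(size (words i.+1))), V' v -> U' (dn v),
    forall i (v v' : 'I_(size (words i.+1))), V' v -> V' v' -> dn v = dn v' -> v = v' &
    forall i (u : 'I_(size (words i))), U' u -> exists2 v, V' v & dn v = u].
Proof.
split; first by move=> i b; apply: isUV.
split=> [i v Vv|i v v' Vv Vv' E|i u Uu].
- have /andP[lb _] := wd_letters v; have [_ Ud _] := downP ed_self lb Vv.
  by rewrite /U' /= wd_dn.
- have /andP[lv _] := wd_letters v; have /andP[lv' _] := wd_letters v'.
  have [_ _ uv] := downP ed_self lv Vv; have [_ _ uv'] := downP ed_self lv' Vv'.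
  have := congr1 (fun j => wd j) E; rewrite !wd_dn // => -[E1 E2].
  apply: wd_inj; case: (wd v) (wd v') uv uv' E1 E2 => [w A] [w' A'] /= uv uv' E1 ->.
  by rewrite -uv E1 uv'.
have /andP[lu /eqP du] := wd_letters u; have [m l Vup dup] := upP ed_self lu Uu.
have upW : (up (wd u).1, (wd u).2) \in words i.+1.
  rewrite mem_words l /= (merges_dg ed_self _ l m) -[in X in _ == X]du.
  by case: (wd u).
have lt : (index_or0 i.+1 (up (wd u).1, (wd u).2) < size (words i.+1))%N.
  by rewrite /index_or0 upW index_mem.
have E := wd_index lt upW; exists (Ordinal lt).
  by rewrite /V' /= E.
apply: wd_inj; rewrite wd_dn; last by rewrite E.
by rewrite E /down_word dup; case: (wd u).
Qed.

Let V0 (b : 'I_(size (words 0))) : ~~ V' b.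
Proof. by rewrite /V' /= wd0. Qed.

Let MM i : tensor_diff res i.+1 *m tensor_diff res i = 0.
Proof. by rewrite /tensor_diff -map_mxM res_diff_mul map_mx0. Qed.

Let dn_diag i (v : 'I_(size (words i.+1))) : V' v -> tensor_diff res i v (dn v) != 0.
Proof.
move=> Vv; rewrite tensor_diff_neq0 wd_dn // eqxx /=.
by have /andP[lv _] := wd_letters v; have [m _ _] := downP ed_self lv Vv.
Qed.

Let dn_triang i (v v' : 'I_(size (words i.+1))) : V' v -> V' v' -> v' != v ->
  tensor_diff res i v (dn v') != 0 -> (key' v' < key' v)%N.
Proof.
move=> Vv Vv' vv'; rewrite tensor_diff_neq0 wd_dn // => /andP[/eqP E2 m].
have /andP[lv /eqP dv] := wd_letters v; have /andP[lv' _] := wd_letters v'.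
have [_ Ud' ud'] := downP ed_self lv' Vv'; have [_ Ud ud] := downP ed_self lv Vv.
rewrite /key' -[in X in (X < _)%N]ud'; apply: (key_triang ed_self) => //.
  apply: leq_trans (_ : dg (wd v) <= _)%N; last by rewrite dv.
  by case: (wd v) => w A; apply: size_word.
apply: contraNneq vv' => E; apply/eqP/wd_inj; move: E2 E ud' ud {m lv dv lv' Vv Vv' Ud Ud'}.
by case: (wd v) (wd v') => [w A] [w' A'] /= -> E <- <-; rewrite E.
Qed.

Let crit_Q i (c : 'I_(size (words i.+1))) b : ~~ U' c -> ~~ V' c ->
  tensor_diff res i c b != 0 -> Q' b.
Proof.
move=> nU nV; rewrite tensor_diff_neq0 => /andP[_ m].
have /andP[lc _] := wd_letters c; rewrite /Q' /= (merges_weight ed_self lc m).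
by rewrite (crit_weight lc nU nV) (merges_size m).
Qed.

Let Q_crit i (b : 'I_(size (words i))) : Q' b -> U' b || V' b.
Proof.
have /andP[lb _] := wd_letters b; rewrite /Q' /U' /V' /=; apply: contraLR.
by rewrite negb_or => /andP[nU nV]; rewrite (crit_weight lb nU nV) ltnn.
Qed.

Let dn_Q i (v : 'I_(size (words i.+1))) b : V' v -> Q' (dn v) ->
  tensor_diff res i v b != 0 -> Q' b.
Proof.
move=> Vv; rewrite /Q' /= wd_dn // tensor_diff_neq0 => + /andP[_ m].
have /andP[lv _] := wd_letters v; have [md _ _] := downP ed_self lv Vv.
rewrite (merges_weight ed_self lv m) (merges_weight ed_self lv md).
by have := merges_size m; rewrite (merges_size md) => -[->].
Qed.

Lemma rank_tensor_diff i : \rank (tensor_diff res i) = #|@V' i.+1|.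
Proof.
have [UV [dnU dnI dnS]] := dn_matching.
exact: (@matching_rank k (fun j => size (words j)) (fun j => tensor_diff res j)
  U' V' Q' dn key' MM V0 UV dnU dnS dn_diag dn_triang crit_Q Q_crit dn_Q i).
Qed.

Lemma tor_dim_res i : tor_dim res i = count critical (words i).
Proof.
have [UV [dnU dnI dnS]] := dn_matching.
have UVC j : size (words j) = (#|@U' j| + #|@V' j| + count critical (words j))%N.
  rewrite (count_tnth (words j) (fun v => isU v.1)) (count_tnth (words j) (fun v => isV v.1)).
  elim: (words j) => //= v s ->; rewrite /critical.
  have := @isUV N ed v.1; case: (isU v.1) => [/(_ isT)/negPf->|_] /=.
    by rewrite !add0n add1n !addSn.
  by case: (isV v.1); rewrite /= ?add0n ?add1n ?addSn ?addnS.
have cU j : #|@U' j| = #|@V' j.+1| .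
  exact: (@card_matching (fun j => size (words j)) U' V' dn dnU dnI dnS j).
case: i => [|i]; rewrite /tor_dim.
  rewrite rank_tensor_diff -cU [res_rank _ _]UVC (_ : #|@V' 0| = 0%N) ?addn0 ?addKn //.
  by apply: eq_card0 => b; apply/negbTE/V0.
rewrite mxrank_ker !rank_tensor_diff [res_rank _ _]UVC -(cU i.+1).
by rewrite addnAC addnK addKn.
Qed.

End PrivateVertices.

(** * The generating function of the critical words *)

Section GeneratingFunction.
Variables (N : nat) (P : {set 'I_N}) (ed : 'I_N -> {set 'I_N}).
Hypothesis ed_self : forall p, p \in P -> p \in ed p.
Implicit Types (S T A C : {set 'I_N}) (F : {set {set 'I_N}}).
Notation word := (seq {set 'I_N} * {set 'I_N})%type.
Notation words := (words P).
Notation letter := (letter P).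
Notation letters := (letters P).
Notation orth := (orth ed).
Notation conn := (conn ed).
Notation comps := (comps ed).
Notation front_set := (front_set ed).
Notation critical := (critical ed).

(** The critical words whose trace cannot start with a letter in F: this generality is
    what a recursion on the first letter produces. *)
Definition crit_count F j : nat :=
  count (fun v : word => critical v && [disjoint front_set v.1 & F]) (words j).

(** A trace starting with S avoids the first letters in F, and has S as its least
    first letter, iff the rest of the trace avoids the first letters in [shift F S]. *)
Definition shift F S : {set {set 'I_N}} :=
  [set b | orth b S && ((b \in F) || (rk b < rk S)%N)].

Lemma words_unfold j : words j =
  [seq ([::], A) | A : {set 'I_N} <- enum {set 'I_N} & #|A| == j] ++
  flatten [seq [seq cons_word T v | v <- words (j - #|T|.+1)]
          | T : {set 'I_N} <- enum {set 'I_N} & letter T && (#|T| < j)%N].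
Proof.
rewrite -[LHS]/(words_fuel P j j); case: j => [|j] /=.
  congr (_ ++ _); rewrite (@eq_filter _ _ pred0) ?filter_pred0 // => T.
  by rewrite andbF.
congr (_ ++ flatten _); apply/eq_in_map => T; rewrite mem_filter => /andP[/andP[_ Tj] _].
by rewrite (words_fuelE P (m := (j.+1 - #|T|.+1)%N)) //; lia.
Qed.

Lemma critical_cons F S (v : word) : letters (S :: v.1) ->
  critical (cons_word S v) && [disjoint front_set (S :: v.1) & F] =
  [&& conn S, S \notin F, critical v & [disjoint front_set v.1 & shift F S]].
Proof.
move=> l; rewrite !criticalE /=; apply/andP/and4P => [[]|[cS SF /andP[nU nV] d]].
  rewrite (crit_cons ed l) => /and4P[cS /forall_inP Smin nU nV] d; split=> //.
  - by rewrite (disjointFr d) // mem_front_cons conn_comps cS.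
  - by rewrite nU nV.
  apply/pred0P => b /=; apply/negP => /andP[bv]; rewrite inE => /andP[ob /orP[bF|bS]].
    by have := disjointFl d bF; rewrite mem_front_cons bv ob orbT.
  by move: bS; rewrite ltnNge Smin // bv.
rewrite (crit_cons ed l) cS nU nV !andbT /=; split.
  apply/forall_inP => b /andP[bv ob]; rewrite leqNgt; apply/negP => bS.
  by have := disjointFr d bv; rewrite inE ob bS orbT.
apply/pred0P => b /=; apply/negP => /andP[]; rewrite mem_front_cons comps_conn1 // in_set1.
case/orP=> [/eqP->|/andP[bv ob] bF]; first exact/negP.
by have := disjointFr d bv; rewrite inE ob bF.
Qed.

Lemma crit_count_rec F j : crit_count F j = ('C(N, j) +
  \sum_(S | [&& letter S, conn S, S \notin F & #|S| < j])
     crit_count (shift F S) (j - #|S|.+1))%N.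
Proof.
rewrite /crit_count words_unfold count_cat; congr (_ + _)%N.
  rewrite count_map (@eq_count _ _ predT) ?count_predT => [|A]; last first.
    by rewrite /=; apply/pred0P => b; rewrite /= inE.
  rewrite size_filter -sum1_count big_enum_cond /= sum1dep_card card_draws.
  by rewrite card_ord.
rewrite count_flatten -map_comp sumnE big_map big_filter.
rewrite big_enum_cond /=.
rewrite [RHS](eq_bigl (fun S => (letter S && (#|S| < j)%N) && (conn S && (S \notin F))));
  last first.
  by move=> S; apply/and4P/idP => [[-> -> -> ->]|/andP[/andP[-> ->] /andP[-> ->]]].
rewrite [RHS]big_mkcondr /=; apply/esym; apply: eq_big => [S //|S /andP[lS Sj]]; apply/esym.
rewrite /= count_map; case: ifPn => [/andP[cS SF]|nS]; last first.
  rewrite -[RHS](count_pred0 (words (j - #|S|.+1))); apply: eq_in_count => v.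
  rewrite mem_words => /andP[lv _] /=; rewrite critical_cons; last exact/andP.
  by apply/negbTE; apply: contra nS => /and3P[-> ->].
apply: eq_in_count => v; rewrite mem_words => /andP[lv _] /=.
by rewrite critical_cons ?cS ?SF //; apply/andP.
Qed.

(** A set S stands for the set of its components, a set of commuting letters of the
    trace monoid, where a letter C has weight #|C|.+1. *)
Definition clique_term S : {poly rat} := (-1) ^+ #|comps S| *: 'X^(#|S| + #|comps S|).
Definition clique_poly F : {poly rat} :=
  \sum_(S : {set 'I_N} | (S \subset P) && (comps S \subset F)) clique_term S.
Definition taylor_poly : {poly rat} := \sum_(S : {set 'I_N} | S \subset P) clique_term S.

Definition top F S : {set 'I_N} := odflt set0
  [pick C in comps S :\: F | [forall (C' | C' \in comps S :\: F), rk C' <= rk C]%N].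

Lemma topP F S : ~~ (comps S \subset F) -> [/\ top F S \in comps S, top F S \notin F &
  forall C, C \in comps S -> C \notin F -> (rk C <= rk (top F S))%N].
Proof.
case/subsetPn => C0 C0S C0F; rewrite /top.
have C0D : C0 \in comps S :\: F by rewrite inE C0F.
case: pickP => [C /andP[] |none].
  rewrite inE => /andP[CF CS] /forall_inP Cmax; split=> // C' C'S C'F.
  by apply: Cmax; rewrite inE C'F.
case: (arg_maxnP (@rk N) C0D) => C CD Cmax; have := none C.
by rewrite /= (CD : C \in comps S :\: F) /= => /negbT/negP; case; apply/forall_inP.
Qed.

Lemma top_eq F S C : C \in comps S -> C \notin F ->
  (forall C', C' \in comps S -> C' \notin F -> (rk C' <= rk C)%N) -> top F S = C.
Proof.
move=> CS CF Cmax; have [|tS tF tmax] := @topP F S; first by apply/subsetPn; exists C.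
by apply: rk_inj; apply/eqP; rewrite eqn_leq Cmax ?tmax.
Qed.

Lemma setUKD_disjoint S T : [disjoint S & T] -> (S :|: T) :\: S = T.
Proof. by move=> d; rewrite setDUl setDv set0U; apply/setDidPl; rewrite disjoint_sym. Qed.

(** Sorting the cliques of components that are not contained in F by their largest
    element outside F. *)
Lemma clique_poly_rec F : clique_poly F = taylor_poly +
  \sum_(C | [&& letter C, conn C & C \notin F]) 'X^(#|C|.+1) * clique_poly (shift F C).
Proof.
rewrite /taylor_poly (bigID (fun S => comps S \subset F)) /= -/(clique_poly F).
rewrite -[LHS]addr0 -addrA; congr (_ + _); apply/esym/eqP; rewrite addr_eq0; apply/eqP.
rewrite (partition_big (top F) (fun C => [&& letter C, conn C & C \notin F])) /=; last first.
  move=> S /andP[SP nS]; have [tS tF _] := topP nS; rewrite tF (comps_conn tS) !andbT.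
  by apply/andP; split; [apply: comps_neq0 tS|apply: subset_trans (comps_sub tS) SP].
rewrite -sumrN; apply: eq_bigr => C /and3P[lC cC CF]; have [C0 CP] := andP lC.
rewrite /clique_poly mulr_sumr -sumrN.
rewrite (reindex_onto (fun T => C :|: T) (fun S => S :\: C)); last first.
  move=> S /andP[/andP[SP nS] /eqP tC]; have [tS _ _] := topP nS.
  by rewrite tC in tS; apply: setUD_comp tS.
have key T : [&& (C :|: T \subset P), ~~ (comps (C :|: T) \subset F), top F (C :|: T) == C
      & (C :|: T) :\: C == T] = (T \subset P) && (comps T \subset shift F C).
  apply/and4P/andP => [[CTP nF /eqP tC /eqP CT]|[TP /subsetP TF]].
    have [tS _ tmax] := topP nF; rewrite tC in tS tmax.
    have TP : T \subset P by apply: subset_trans CTP; apply: subsetUr.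
    split=> //; apply/subsetP => C' C'T.
    have oCT : orth C T by have := orth_comp tS; rewrite CT.
    have C'CT : C' \in comps (C :|: T) by rewrite (comps_setD ed_self CTP tS) CT in_setU1 C'T orbT.
    rewrite inE orthC (orth_sub (subxx C) (comps_sub C'T) oCT) /=.
    have [//|C'F] := boolP (C' \in F); rewrite /= ltn_neqAle tmax // andbT.
    apply: contraNneq (comp_notin_setD ed (C :|: T) C0) => /rk_inj E.
    by rewrite CT -[X in X \in _]E.
  have oCT : orth C T.
    by rewrite orthC; apply: orth_comps => C' /TF; rewrite inE => /andP[].
  have dCT := orth_disjoint ed_self CP TP oCT.
  have cCT : comps (C :|: T) = C |: comps T.
    by rewrite (comps_setU ed_self CP TP oCT) comps_conn1.
  have CCT : C \in comps (C :|: T) by rewrite cCT setU11.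
  split; first by rewrite subUset CP.
  - by apply/subsetPn; exists C.
  - apply/eqP/top_eq => // C'; rewrite cCT in_setU1 => /orP[/eqP->//|/TF].
    by rewrite inE => /andP[_ /orP[-> //|/ltnW]].
  by rewrite setUKD_disjoint.
apply: eq_big => [T|T]; first by rewrite -key -!andbA.
rewrite -!andbA key => /andP[TP /subsetP TF].
have oCT : orth C T.
  by rewrite orthC; apply: orth_comps => C' /TF; rewrite inE => /andP[].
have dCT := orth_disjoint ed_self CP TP oCT.
have CT : C \notin comps T.
  by rewrite -(setUKD_disjoint dCT) comp_notin_setD.
rewrite /clique_term (comps_setU ed_self CP TP oCT) comps_conn1 // cardsU1 CT.
rewrite cardsU_disjoint // -scalerAr -exprD -scaleN1r scalerA exprS.
by congr (_ *: 'X^_); rewrite add1n !addSn !addnS addnA.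
Qed.

Lemma coef_binomial j : ((1 + 'X) ^+ N : {poly rat})`_j = 'C(N, j)%:R.
Proof.
rewrite exprDn coef_sum; under eq_bigr do rewrite expr1n mul1r coefMn coefXn.
have [jN|Nj] := ltnP j N.+1; last first.
  rewrite bin_small // big1 // => i _; case: eqP => [E|_]; last by rewrite mul0rn.
  by have := ltn_ord i; rewrite -E ltnNge Nj.
rewrite (bigD1 (Ordinal jN)) //= eqxx big1 ?addr0 // => i ij.
by case: eqP => [E|_]; rewrite ?mul0rn //; case/eqP: ij; apply/val_inj; rewrite /= E.
Qed.

(** Inversion in the trace monoid: the generating function of the traces that cannot
    start with a letter in F is the quotient of the alternating sum over the sets of
    commuting letters inside F by the one over all sets of commuting letters.  Both
    sides satisfy the same recursion, on the leading letter of the trace and on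
    the largest letter outside F respectively.  The factor (1 + 'X) ^+ N counts A. *)
Lemma crit_count_series m F :
  \sum_(j < m.+1) (crit_count F j)%:R * taylor_poly`_(m - j) =
  ((1 + 'X) ^+ N * clique_poly F)`_m.
Proof.
elim/ltn_ind: m F => m IH F.
have step S : letter S -> \sum_(j < m.+1 | (#|S| < j)%N)
      (crit_count (shift F S) (j - #|S|.+1))%:R * taylor_poly`_(m - j) =
    ((1 + 'X) ^+ N * ('X^(#|S|.+1) * clique_poly (shift F S)))`_m.
  move=> lS; rewrite mulrCA coefXnM; case: ltnP => mS.
    rewrite big1 // => j Sj; have := ltn_ord j; rewrite ltnS => jm.
    by have := leq_trans Sj jm; rewrite leqNgt mS.
  rewrite -IH; last by rewrite ltn_subrL; apply: leq_trans mS.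
  rewrite -(big_mkord (fun j => (#|S| < j)%N)
    (fun j => (crit_count (shift F S) (j - #|S|.+1))%:R * taylor_poly`_(m - j))).
  rewrite -(big_mkord xpredT (fun j => (crit_count (shift F S) j)%:R *
     taylor_poly`_(m - #|S|.+1 - j))).
  rewrite (big_cat_nat (n := #|S|.+1)) //=; last by rewrite ltnW.
  rewrite big_nat_cond big1 ?add0r => [|j]; last first.
    by case/andP => /andP[_]; rewrite ltnS => + Sj; rewrite leqNgt Sj.
  rewrite -{1}[#|S|.+1]add0n big_addn subSn //.
  rewrite big_nat_cond [RHS]big_nat; apply: eq_big => [j|j _].
    by rewrite (_ : (#|S| < j + #|S|.+1)%N) ?andbT // addnS ltnS leq_addl.
  by rewrite addnK subnDA subnAC.
rewrite [in RHS](clique_poly_rec F) mulrDr coefD coefM.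
under eq_bigr do rewrite crit_count_rec natrD mulrDl.
rewrite big_split /=; congr (_ + _).
  by apply: eq_bigr => j _; rewrite coef_binomial.
rewrite mulr_sumr coef_sum; under eq_bigr do rewrite natr_sum mulr_suml.
rewrite (exchange_big_dep (fun S => [&& letter S, conn S & S \notin F])) /=; last first.
  by move=> j S _ /and4P[-> -> ->].
apply: eq_bigr => S /and3P[lS cS SF]; rewrite -step //.
by apply: eq_bigl => j; rewrite lS cS SF.
Qed.

Lemma clique_poly0 : clique_poly set0 = 1.
Proof.
rewrite /clique_poly (big_pred1 set0) => [|S].
  by rewrite /clique_term comps0 !cards0 expr0 scale1r.
rewrite subset0 comps_eq0; apply/andP/eqP => [[_ /eqP]//|->].
by rewrite sub0set eqxx.
Qed.

Lemma crit_count0 j : crit_count set0 j = count critical (words j).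
Proof.
apply: eq_count => v /=; rewrite disjoint_sym -setI_eq0 set0I eqxx.
exact: andbT.
Qed.

End GeneratingFunction.

(** The case F = set0 of [crit_count_series], where the only set of commuting letters
    inside F is empty, combined with the count of critical words.  The Poincare series
    thus depends only on N and on the graph of the edges that meet. *)
Lemma private_vertices_poincare (k : fieldType) (N : nat) (H : hypergraph N)
    (P : {set 'I_N}) (ed : 'I_N -> {set 'I_N}) :
  (forall p, p \in P -> p \in ed p) ->
  (forall p q, p \in P -> q \in P -> p \in ed q -> p = q) ->
  (forall p, p \in P -> (1 < #|ed p|)%N) ->
  edges H = ed @: P ->
  has_poincare_series k H ((1 + 'X) ^+ N) (taylor_poly P ed).
Proof.
move=> ed_self ed_private ed_big edgesE.
pose res := bar_resolution k ed_self edgesE.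
exists (fun i => tor_dim res i).
  by split; [exists res|move=> F i; apply: tor_dim_indep].
have series m : \sum_(j < m.+1) (tor_dim res j)%:R * (taylor_poly P ed)`_(m - j) =
    ((1 + 'X) ^+ N : {poly rat})`_m.
  transitivity (((1 + 'X) ^+ N * clique_poly P ed set0)`_m); last by rewrite clique_poly0 mulr1.
  rewrite -crit_count_series //.
  by apply: eq_bigr => j _; rewrite crit_count0 -(tor_dim_res k ed_self ed_private ed_big edgesE).
split=> //; have := series 0%N; rewrite big_ord1 coef_binomial bin0.
by move=> E; apply: contraTneq isT => D0; move/eqP: E; rewrite D0 mulr0 eq_sym oner_eq0.
Qed.

(** * Components in paths and cycles of edges *)

Section IndexedEdges.
Variables (N n : nat) (e : 'I_n -> {set 'I_N}) (pv : 'I_n -> 'I_N).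
Hypothesis pv_in : forall i, pv i \in e i.
Hypothesis pv_out : forall i j, i != j -> pv i \notin e j.
Implicit Types (I J : {set 'I_n}) (i j : 'I_n).

(** Edges numbered by 'I_n, to be renamed after their private vertices pv i. *)
Definition privates : {set 'I_N} := [set pv i | i : 'I_n].
Definition edge_at (p : 'I_N) : {set 'I_N} := if [pick i | pv i == p] is Some i then e i else set0.

Lemma pv_inj : injective pv.
Proof.
move=> i j E; apply/eqP; apply: contraTT (pv_in i) => ij.
by rewrite E pv_out // eq_sym.
Qed.

Lemma edge_atE i : edge_at (pv i) = e i.
Proof.
by rewrite /edge_at; case: pickP => [j /eqP/pv_inj->|/(_ i)]; rewrite ?eqxx.
Qed.

Lemma edge_at_self p : p \in privates -> p \in edge_at p.
Proof. by case/imsetP => i _ ->; rewrite edge_atE. Qed.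

Lemma edge_at_private p q : p \in privates -> q \in privates -> p \in edge_at q -> p = q.
Proof.
case/imsetP => i _ ->; case/imsetP => j _ ->; rewrite edge_atE => ij.
by apply: contraTeq ij => pij; apply: pv_out; apply: contraNneq pij => ->.
Qed.

Lemma edge_at_image : edge_at @: privates = [set e i | i : 'I_n].
Proof. by rewrite -imset_comp; apply: eq_imset => i /=; rewrite edge_atE. Qed.

Lemma sub_privates I : pv @: I \subset privates.
Proof. by apply/subsetP => _ /imsetP[i _ ->]; apply: imset_f. Qed.

Lemma taylor_poly_index : taylor_poly privates edge_at =
  \sum_(I : {set 'I_n}) clique_term edge_at (pv @: I).
Proof.
rewrite /taylor_poly (reindex_onto (fun I => pv @: I) (fun S => pv @^-1: S)) /=.
  apply: eq_bigl => I; apply/andP; split; first exact: sub_privates.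
  apply/eqP/setP => i; rewrite inE; apply/imsetP/idP => [[j jI /pv_inj->]//|iI].
  by exists i.
move=> S SP; apply/setP => p; apply/imsetP/idP => [[i]|pS].
  by rewrite inE => iS ->.
by have /imsetP[i _ Ep] := subsetP SP p pS; exists i => //; rewrite inE -Ep.
Qed.

Lemma orth_index I J : orth edge_at (pv @: I) (pv @: J) =
  [forall i in I, forall j in J, e i :&: e j == set0].
Proof.
rewrite orthE; apply/eqP/forall_inP => [E i iI|H].
  apply/forall_inP => j jJ; rewrite -subset0 -E; apply: setISS.
    by apply: (bigcup_max (pv i)); rewrite ?imset_f // edge_atE.
  by apply: (bigcup_max (pv j)); rewrite ?imset_f // edge_atE.
apply/setP => x; rewrite [RHS]inE; apply/negP; rewrite inE.
case/andP => /bigcupP[_ /imsetP[i iI ->]] + /bigcupP[_ /imsetP[j jJ ->]].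
rewrite !edge_atE => xi xj; have /forall_inP/(_ j jJ)/eqP/setP/(_ x) := H i iI.
by rewrite !inE xi xj.
Qed.

Lemma comps_eq (S C C' : {set 'I_N}) x : S \subset privates ->
  C \in comps edge_at S -> C' \in comps edge_at S -> x \in C -> x \in C' -> C = C'.
Proof.
move=> SP CS; rewrite (comps_setD edge_at_self SP CS) in_setU1 => /orP[/eqP->//|C'S] xC xC'.
by have := subsetP (comps_sub C'S) x xC'; rewrite inE xC.
Qed.

(** The graph of the edges that meet is oriented by nxt, with at most one
    successor for each edge. *)
Variable nxt : rel 'I_n.
Hypothesis nxt_fun : forall i j j', nxt i j -> nxt i j' -> j = j'.
Hypothesis meetE : forall i j, i != j -> (e i :&: e j != set0) = nxt i j || nxt j i.

Definition ends I : {set 'I_n} := [set i in I | [forall j in I, ~~ nxt i j]].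

Let step I i j := [&& i \in I, j \in I & nxt i j].

(** The edges from which i1 can be reached along nxt inside I are closed under adjacency,
    since i1 has no successor in I and the others have at most one: they make up C.
    But i1 cannot be reached from another end i2. *)
Lemma end_unique I C i1 i2 : C \in comps edge_at (pv @: I) -> i1 \in ends I ->
  i2 \in ends I -> pv i1 \in C -> pv i2 \in C -> i2 = i1.
Proof.
move=> CS; rewrite !inE => /andP[i1I /forall_inP E1] /andP[i2I /forall_inP E2] i1C i2C.
have [CI /connP[C0 HC] _] := compsP _ _ _ CS.
pose J := [set i in I | pv i \in C].
have CJ : C = pv @: J.
  apply/setP => p; apply/idP/imsetP => [pC|[i]]; last by rewrite inE => /andP[_ iC] ->.
  have /imsetP[i iI Ep] := subsetP CI p pC; exists i => //.
  by rewrite inE iI -Ep.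
pose D := [set i in J | connect (step I) i i1].
have ED : pv @: D = C.
  apply: HC.
  - by rewrite CJ; apply: imsetS; apply/subsetP => i; rewrite !inE => /andP[].
  - by apply/set0Pn; exists (pv i1); rewrite imset_f // !inE i1I i1C connect0.
  have -> : C :\: pv @: D = pv @: (J :\: D).
    rewrite CJ; apply/setP => p; rewrite inE; apply/andP/imsetP => [[pD /imsetP[i iJ Ep]]|[i]].
      by exists i => //; rewrite inE iJ andbT; apply: contra pD => iD; rewrite Ep imset_f.
    rewrite inE => /andP[iD iJ] ->; split; last exact: imset_f.
    by apply: contra iD => /imsetP[j jD /pv_inj->].
  rewrite orth_index; apply/forall_inP => i; rewrite inE => /andP[iJ ic].
  apply/forall_inP => j; rewrite inE => /andP[jD jJ].
  have [iI _] : i \in I /\ pv i \in C by move: iJ; rewrite inE => /andP[].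
  have [jI _] : j \in I /\ pv j \in C by move: jJ; rewrite inE => /andP[].
  have ij : i != j.
    by apply: contraNneq jD => <-; rewrite inE iJ.
  apply: contraNT jD; rewrite meetE // inE jJ /= => /orP[nij|nji]; last first.
    by apply: connect_trans ic; apply: connect1; rewrite /step jI iI.
  case/connectP: ic => [[|i' p]] /=; first by move=> _ Ei; have := E1 j jI; rewrite Ei nij.
  case/andP => /and3P[_ i'I nii'] pp lp; rewrite (nxt_fun nij nii').
  by apply/connectP; exists p.
have : i2 \in D.
  by have : pv i2 \in pv @: D; [rewrite ED|case/imsetP => j jD /pv_inj->].
rewrite inE => /andP[_ /connectP[[|j p] /=]]; first by move=> _ ->.
by case/andP => /and3P[_ jI n2] _ _; have := E2 j jI; rewrite n2.
Qed.

(** A component contains an end, where r is largest, and no other by [end_unique]. *)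
Lemma card_comps_ends I (r : 'I_n -> nat) :
  (forall i j, i \in I -> j \in I -> nxt i j -> (r i < r j)%N) ->
  #|comps edge_at (pv @: I)| = #|ends I|.
Proof.
move=> rI; set S := pv @: I; have SP : S \subset privates by apply: sub_privates.
pose g i := odflt set0 [pick C in comps edge_at S | pv i \in C].
have gP i : i \in I -> g i \in comps edge_at S /\ pv i \in g i.
  move=> iI; rewrite /g; case: pickP => [C /andP[CS iC] //|none].
  have [C CS iC] := comps_cover edge_at (imset_f pv iI : pv i \in S).
  by have := none C; rewrite CS iC.
have endI i : i \in ends I -> i \in I by rewrite inE => /andP[].
rewrite -(card_in_imset (f := g) (D := ends I)); last first.
  move=> i j iE jE E; have [gi ii] := gP i (endI i iE); have [gj jj] := gP j (endI j jE).
  by apply/esym/(end_unique gi iE jE ii); rewrite E.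
apply: eq_card => C; apply/idP/imsetP => [CS|[i /endI/gP[gi _] ->//]].
have [x xC] : exists x, x \in C by apply/set0Pn; apply: comps_neq0 CS.
have /imsetP[i0 i0I Ex] := subsetP (comps_sub CS) x xC.
have Q0 : (i0 \in I) && (pv i0 \in C) by rewrite i0I -Ex.
case: (@arg_maxnP _ i0 (fun i => (i \in I) && (pv i \in C)) r Q0) => i /andP[iI iC] imax.
exists i; last first.
  by have [gi ii] := gP i iI; apply: (comps_eq SP CS gi iC ii).
rewrite inE iI; apply/forall_inP => j jI; apply/negP => nij.
have rij := rI i j iI jI nij.
have ij : i != j by apply: contraTneq rij => ->; rewrite ltnn.
have [jC|jC] := boolP (pv j \in C).
  by have := imax j; rewrite jI jC /= => /(_ isT); rewrite leqNgt rij.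
have := orth_comp CS; rewrite orthE => /eqP E.
have : e i :&: e j != set0 by rewrite meetE // nij.
case/set0Pn => y /setIP[yi yj].
have : y \in span edge_at C :&: span edge_at (S :\: C); last by rewrite E inE.
rewrite inE; apply/andP; split; apply/bigcupP.
  by exists (pv i) => //; rewrite edge_atE.
by exists (pv j); rewrite ?edge_atE // inE jC imset_f.
Qed.

Lemma conn_full_cycle : (0 < n)%N -> (forall i j, connect nxt i j) ->
  #|comps edge_at (pv @: [set: 'I_n])| = 1%N.
Proof.
move=> n0 cyc; suff cS : conn edge_at (pv @: [set: 'I_n]) by rewrite comps_conn1 // cards1.
apply/connP; split=> [|D DS D0 oD].
  by apply/set0Pn; exists (pv (Ordinal n0)); rewrite imset_f.
pose J := pv @^-1: D.
have ED : D = pv @: J.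
  apply/setP => p; apply/idP/imsetP => [pD|[i]]; last by rewrite inE => iD ->.
  by have /imsetP[i _ Ep] := subsetP DS p pD; exists i => //; rewrite inE -Ep.
have closed i j : nxt i j -> i \in J -> j \in J.
  move=> nij iJ; apply: contraTT isT => jJ.
  have ij : i != j by apply: contraNneq jJ => <-.
  have : e i :&: e j != set0 by rewrite meetE // nij.
  case/set0Pn => y /setIP[yi yj]; move: oD; rewrite orthE => /eqP E.
  have : y \in span edge_at D :&: span edge_at (pv @: [set: 'I_n] :\: D); last by rewrite E inE.
  rewrite inE; apply/andP; split; apply/bigcupP.
    by exists (pv i); rewrite ?edge_atE //; rewrite inE in iJ.
  by exists (pv j); rewrite ?edge_atE // inE imset_f // andbT; rewrite inE in jJ.
case/set0Pn: D0 => p; rewrite {1}ED => /imsetP[i iJ _].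
suff JT : J = [set: 'I_n] by rewrite ED JT.
apply/setP => j; rewrite [RHS]inE.
have /connectP[q] := cyc i j; elim: q i iJ => [|i' q IH] i iJ /=; first by move=> _ ->.
by case/andP => /closed/(_ iJ) i'J; apply: IH.
Qed.

End IndexedEdges.
(** * Counting subsets of a path or a cycle by size and number of runs *)

Fixpoint bitseqs n : seq bitseq :=
  if n is n'.+1 then map (cons true) (bitseqs n') ++ map (cons false) (bitseqs n') else [:: [::]].

(** The runs of ones of b are counted at their ends; z is the bit that follows the last
    one, false for a path and the first bit of b for a cycle. *)
Fixpoint runs z (b : bitseq) : nat :=
  if b is x :: b' then ((x && ~~ head z b') + runs z b')%N else 0%N.

Lemma mem_bitseqs n b : (b \in bitseqs n) = (size b == n).
Proof.
elim: n b => [|n IH] [|x b] //=; rewrite mem_cat.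
  by apply/negP => /orP[] /mapP[].
rewrite eqSS -IH; apply/orP/idP => [[] /mapP[c cb [_ ->]] //|bn].
by case: x; [left|right]; apply: map_f.
Qed.

Lemma uniq_bitseqs n : uniq (bitseqs n).
Proof.
elim: n => //= n IH; rewrite cat_uniq !map_inj_uniq ?IH ?andbT //=; try by move=> ? ? [].
by apply/hasPn => _ /mapP[b _ ->]; apply/negP => /mapP[].
Qed.

Lemma runs_le z b : (runs z b <= count id b)%N.
Proof. by elim: b => //= x b IH; apply: leq_add => //; case: x => //=; case: (~~ _). Qed.

Lemma runsE z b :
  runs z b = (\sum_(0 <= i < size b) (nth z b i && ~~ nth z b i.+1))%N.
Proof.
by elim: b => [|x b IH]; [rewrite big_nil|rewrite /= big_nat_recl //= IH nth0].
Qed.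

(** The number of bit strings with i ones, m zeros and r runs that start with y and are
    followed by z.  Ones and zeros are distributed among the runs and the gaps, and
    z and y decide whether the outer gaps may be empty. *)
Definition run_count z y i m r : nat :=
  match z, y with
  | false, true => if (i, r) is (i'.+1, r'.+1) then 'C(i', r') * 'C(m, r') else 0
  | false, false =>
      if i is i'.+1 then if r is r'.+1 then 'C(i', r') * 'C(m, r) else 0 else (r == 0)
  | true, false => if m is m'.+1 then 'C(i, r) * 'C(m', r) else 0
  | true, true =>
      if m is m'.+1 then if r is r'.+1 then 'C(i, r) * 'C(m', r') else 0 else (r == 0)
  end%N.

Arguments run_count : simpl never.

Lemma run_count_false z i m r :
  run_count z false i m.+1 r = (run_count z true i m r + run_count z false i m r)%N.
Proof.
rewrite /run_count; case: z.
  case: m r => [|m] [|r]; rewrite ?bin0 ?bin0n /= ?muln0 //.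
  by rewrite binS mulnDr addnC.
by case: i => [|i] //; case: r => [|r] //; rewrite binS mulnDr addnC.
Qed.

Lemma run_count_true z i m r : run_count z true i.+1 m r =
  (run_count z true i m r + (if r is r'.+1 then run_count z false i m r' else 0))%N.
Proof.
rewrite /run_count; case: z; first by case: m r => [|m] [|r] //; rewrite binS mulnDl.
case: i r => [|i] [|[|r]] //; rewrite ?bin0 ?bin0n ?mul0n ?mul1n //.
by rewrite binS mulnDl addnC.
Qed.

Lemma count_bitseqs z y n i m r : n = (i + m)%N ->
  count (fun b => [&& head z b == y, count id b == i & runs z b == r]) (bitseqs n) =
  run_count z y i m r.
Proof.
elim: n y i m r => [|n IH] y i m r En.
  case: i m En => [|i] [|m] // _; rewrite /= addn0 eq_sym /run_count.
  by case: z; case: y => /=; rewrite ?(eq_sym r).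
have split_head (Q : pred bitseq) : count Q (bitseqs n) =
    (count (fun b => (head z b == true) && Q b) (bitseqs n) +
     count (fun b => (head z b == false) && Q b) (bitseqs n))%N.
  rewrite -count_predUI [X in (_ + X)%N](eq_count (a2 := pred0)); last first.
    by move=> b /=; case: (head z b) => /=; rewrite ?andbF.
  rewrite count_pred0 addn0; apply: eq_count => b /=.
  by case: (head z b); rewrite ?orbF.
rewrite /= count_cat !count_map; case: y => /=; last first.
  rewrite (eq_count (a2 := pred0)) ?count_pred0 //= add0n.
  case: m En => [|m] En.
    rewrite (eq_in_count (a2 := pred0)) ?count_pred0 /=.
      by rewrite /run_count; case: (z) => //=; case: (i) En => // i0; case: (r) => // r0;
        rewrite muln0.
    move=> b; rewrite mem_bitseqs => /eqP Eb /=.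
    have -> : (count id b == i) = false; last by [].
    by apply: ltn_eqF; rewrite -(addn0 i) -En ltnS -Eb count_size.
  have {}En : n = (i + m)%N by move: En; rewrite addnS => -[].
  by rewrite run_count_false split_head -(IH true) // -(IH false).
rewrite [X in (_ + X)%N](eq_count (a2 := pred0)) ?count_pred0 //= addn0.
case: i En => [|i] En; first rewrite (eq_count (a2 := pred0)) ?count_pred0 //.
  by have <- : n.+1 = m by []; rewrite /run_count; case: (z) => //; case: (r).
case: En => En; rewrite run_count_true split_head; congr (_ + _)%N.
  rewrite -(IH true) //; apply: eq_count => b /=.
  by rewrite add1n eqSS; case: (head z b).
case: r => [|r].
  rewrite (eq_count (a2 := pred0)) ?count_pred0 // => b /=.
  by case: (head z b); rewrite ?andbF //= andbF.
rewrite -(IH false) //; apply: eq_count => b /=.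
by rewrite add1n eqSS; case: (head z b).
Qed.

Lemma sum_by_size_runs (g : bitseq -> nat) n (T : nat -> nat -> {poly rat}) :
  (forall b, g b <= count id b)%N ->
  \sum_(b <- bitseqs n) T (count id b) (g b) =
  \sum_(0 <= i < n.+1) \sum_(0 <= r < i.+1)
    T i r *+ count (fun b => (count id b == i) && (g b == r)) (bitseqs n).
Proof.
move=> g_le.
under [RHS]eq_bigr do under eq_bigr do rewrite -sum1_count -sumrMnr big_mkcond /=.
under [RHS]eq_bigr do rewrite exchange_big /=.
rewrite exchange_big /= big_seq [RHS]big_seq; apply: eq_bigr => b; rewrite mem_bitseqs => /eqP Eb.
have c_le : (count id b < n.+1)%N by rewrite ltnS -Eb count_size.
rewrite (bigD1_seq (count id b)) ?mem_index_iota ?iota_uniq //=.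
rewrite [X in _ + X]big1 ?addr0 => [|i ic]; last first.
  by apply: big1 => r _; rewrite eq_sym (negPf ic).
rewrite (bigD1_seq (g b)) ?mem_index_iota ?iota_uniq ?ltnS ?g_le //= !eqxx /= big1 ?addr0 //.
by move=> r rg; rewrite eq_sym (negPf rg).
Qed.

(** The term of the denominator for a set of i edges with r components. *)
Definition run_term i r : {poly rat} := (-1) ^+ r *: 'X^(i + r).

Lemma path_runs_sum n : \sum_(b <- bitseqs n) run_term (count id b) (runs false b) =
  1 + \sum_(1 <= i < n.+1) \sum_(1 <= r < i.+1)
        ((-1) ^+ r * 'C(i - 1, r - 1)%:R * 'C(n - i + 1, r)%:R) *: 'X^(i + r).
Proof.
rewrite (sum_by_size_runs _ _ (runs_le false)).
have E i r : (i <= n)%N ->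
    count (fun b => (count id b == i) && (runs false b == r)) (bitseqs n) =
    (run_count false true i (n - i) r + run_count false false i (n - i) r)%N.
  move=> le_in; rewrite -!(@count_bitseqs _ _ n) ?subnKC //.
  rewrite -count_predUI [X in (_ + X)%N](eq_count (a2 := pred0)); last first.
    by move=> b /=; case: (head false b) => /=; rewrite ?andbF.
  by rewrite count_pred0 addn0; apply: eq_count => b /=; case: (head false b); rewrite ?orbF.
rewrite big_nat_recl // big_nat1 E // /run_count /= /run_term expr0 scale1r addn0 expr0;
  congr (_ + _).
rewrite big_add1 /= big_nat [RHS]big_nat; apply: eq_bigr => i /= lt_in.
rewrite big_nat_recl // E // /run_count /= add0r big_add1 /=; apply: eq_bigr => r _.
by rewrite E // /run_count -mulnDr [X in (_ * X)%N]addnC -binS addn1 -scaler_nat scalerA !subn1 /=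
  natrM mulrC mulrA.
Qed.

(** On the cycle, no run of the string of n ones ends: it contributes 'X^n. *)
Lemma cycle_runs_sum n : (0 < n)%N ->
  \sum_(b <- bitseqs n) run_term (count id b) (runs (head false b) b) =
  1 + \sum_(1 <= i < n) \sum_(1 <= r < i.+1)
        ((-1) ^+ r * (n%:R / r%:R) * 'C(i - 1, r - 1)%:R * 'C(n - i - 1, r - 1)%:R)
          *: 'X^(i + r) + 'X^n.
Proof.
move=> n_gt0; rewrite (@sum_by_size_runs (fun b => runs (head false b) b)); last first.
  by move=> b; apply: runs_le.
have E i r : (i <= n)%N ->
    count (fun b => (count id b == i) && (runs (head false b) b == r)) (bitseqs n) =
    (run_count true true i (n - i) r + run_count false false i (n - i) r)%N.
  move=> le_in; rewrite -!(@count_bitseqs _ _ n) ?subnKC //.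
  rewrite -count_predUI [X in (_ + X)%N](eq_in_count (a2 := pred0)); last first.
    move=> b; rewrite mem_bitseqs => /eqP Eb; case: b Eb => [Eb|[] b _] /=; rewrite ?andbF //.
    by rewrite -Eb in n_gt0.
  rewrite count_pred0 addn0; apply: eq_in_count => b; rewrite mem_bitseqs => /eqP Eb.
  by case: b Eb => [Eb|[] b _] /=; rewrite ?orbF //; rewrite -Eb in n_gt0.
case: n n_gt0 E => // n _ E.
rewrite big_nat_recl // big_nat1 E // /run_count /= /run_term expr0 scale1r addn0 expr0 -addrA.
congr (_ + _); rewrite big_nat_recr //=; congr (_ + _); last first.
  rewrite big_nat_recl // E // subnn /run_count /= expr0 scale1r !addn0 mulr1n big1 ?addr0 // =>
    r _.
  by rewrite E // subnn /run_count /= muln0 mulr0n.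
rewrite big_add1 /= big_nat [RHS]big_nat; apply: eq_bigr => i /= lt_in.
have le_in : (i.+1 <= n.+1)%N by rewrite ltnS ltnW.
have [m Em] : exists m, (n - i)%N = m.+1 by exists (n - i).-1; rewrite prednK // subn_gt0.
rewrite big_nat_recl // E // subSS Em /run_count /= add0r big_add1 /=.
apply: eq_bigr => r _; rewrite E // subSS Em /run_count /= -scaler_nat scalerA.
congr (_ *: _); rewrite mulrC -!mulrA; congr (_ * _).
have r0 : (r.+1)%:R != 0 :> rat by rewrite Num.Theory.pnatr_eq0.
apply: (mulfI r0); rewrite [RHS]mulrCA mulVKf // -!natrM; congr (_%:R).
have En : n.+1 = (i.+1 + m.+1)%N by rewrite addSn -Em subnKC // ltnW.
rewrite !subn1 /= mulnDr mulnA -(mul_bin_diag i.+1 r) /= mulnCA -(mul_bin_diag m.+1 r) /= En.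
by rewrite mulnDl -mulnA; congr (_ + _)%N; rewrite mulnCA.
Qed.

Section BitsOfSet.
Variable n : nat.
Implicit Types I : {set 'I_n}.

Definition bits_of I : bitseq := [seq i \in I | i <- enum 'I_n].

Lemma size_bits_of I : size (bits_of I) = n.
Proof. by rewrite size_map size_enum_ord. Qed.

Lemma nth_bits_of z I (i : 'I_n) : nth z (bits_of I) i = (i \in I).
Proof. by rewrite (nth_map i) ?size_enum_ord // nth_ord_enum. Qed.

Lemma bits_of_sum (f : bitseq -> {poly rat}) :
  \sum_(I : {set 'I_n}) f (bits_of I) = \sum_(b <- bitseqs n) f b.
Proof.
rewrite -big_enum /= -(big_map bits_of xpredT f); apply: perm_big.
rewrite uniq_perm ?uniq_bitseqs //.
  rewrite map_inj_uniq ?enum_uniq // => I J E.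
  by apply/setP => i; rewrite -!(nth_bits_of false) E.
move=> b; rewrite mem_bitseqs; apply/mapP/eqP => [[I _ ->]|Eb]; first exact: size_bits_of.
exists [set i : 'I_n | nth false b i]; first by rewrite mem_enum.
apply: (@eq_from_nth _ false); first by rewrite size_bits_of.
move=> i; rewrite Eb => lt_in.
by rewrite (nth_bits_of false _ (Ordinal lt_in)) inE.
Qed.

Lemma count_bits_of I : count id (bits_of I) = #|I|.
Proof. by rewrite count_map cardE enumT -size_filter /enum_mem. Qed.

Lemma runs_bits_of z I (nxt : rel 'I_n) :
  (forall i : 'I_n, i \in I -> ~~ nth z (bits_of I) i.+1 = [forall j in I, ~~ nxt i j]) ->
  runs z (bits_of I) = #|ends nxt I|.
Proof.
move=> H; rewrite runsE size_bits_of big_mkord -sum1_card [RHS]big_mkcond.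
apply: eq_bigr => i _; rewrite nth_bits_of inE.
by have := H i; case: (i \in I) => //= ->.
Qed.

End BitsOfSet.
(** * Hyperlines and hypercycles *)

Section ChainOfEdges.
Variables (N n a : nat) (e : 'I_n -> {set 'I_N}) (nxt : rel 'I_n).
Hypothesis nxt_fun : forall i j j', nxt i j -> nxt i j' -> j = j'.
Hypothesis nxt_inj : forall i i' j, nxt i j -> nxt i' j -> i = i'.
Hypothesis a_gt0 : (0 < a)%N.
Hypothesis card_meet : forall i j, i != j ->
  if nxt j i || nxt i j then #|e i :&: e j| = a else e i :&: e j = set0.
Hypothesis e_large : forall i, (2 * a < #|e i|)%N.

Lemma chain_meetE i j : i != j -> (e i :&: e j != set0) = nxt i j || nxt j i.
Proof.
move=> ij; have := card_meet ij; rewrite orbC; case: (_ || _) => [E|->]; last by rewrite eqxx.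
by rewrite -card_gt0 E.
Qed.

(** At most two edges meet e i, and each shares a of its more than 2 * a vertices. *)
Lemma exists_private_vertex i : exists x, (x \in e i) && [forall (j | i != j), x \notin e j].
Proof.
pose F := [set j | nxt i j || nxt j i].
have F2 : (#|F| <= 2)%N.
  have -> : F = [set j | nxt i j] :|: [set j | nxt j i] by apply/setP => j; rewrite !inE.
  rewrite (leq_trans (leq_card_setU _ _)) // -(addn1 1) leq_add //.
    by apply/card_le1_eqP => j j'; rewrite !inE => /nxt_fun/[apply].
  by apply/card_le1_eqP => j j'; rewrite !inE => /nxt_inj/[apply].
pose U := \bigcup_(j in F :\ i) (e i :&: e j).
have U_le : (#|U| <= 2 * a)%N.
  apply: (@leq_trans (\sum_(j in F :\ i) a)%N).
    apply: (big_ind2 (fun (A : {set 'I_N}) m => (#|A| <= m)%N)); first by rewrite cards0.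
      by move=> A1 m1 A2 m2 A1m A2m; rewrite (leq_trans (leq_card_setU _ _)) ?leq_add.
    move=> j; rewrite !inE eq_sym => /andP[/card_meet].
    by rewrite orbC => + Fj; rewrite Fj => ->.
  by rewrite sum_nat_const leq_mul2r (leq_trans (subset_leq_card (subsetDl _ _)) F2) orbT.
have [x] : exists x, x \in e i :\: U.
  apply/set0Pn; rewrite -card_gt0 cardsD subn_gt0.
  by apply: leq_ltn_trans (e_large i); rewrite (leq_trans (subset_leq_card (subsetIr _ _))).
rewrite inE => /andP[xU xi]; exists x; rewrite xi; apply/forall_inP => j ij.
apply: contra xU => xj; apply/bigcupP; exists j; last by rewrite inE xi.
by rewrite !inE eq_sym ij -chain_meetE //; apply/set0Pn; exists x; rewrite inE xi.
Qed.

Definition private_vertex i : 'I_N := xchoose (exists_private_vertex i).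

Lemma private_vertex_in i : private_vertex i \in e i.
Proof. by case/andP: (xchooseP (exists_private_vertex i)). Qed.

Lemma private_vertex_out i j : i != j -> private_vertex i \notin e j.
Proof. by case/andP: (xchooseP (exists_private_vertex i)) => _ /forall_inP/(_ j). Qed.

Definition chain_term (I : {set 'I_n}) : {poly rat} :=
  clique_term (edge_at e private_vertex) (private_vertex @: I).

Lemma chain_poincare (k : fieldType) (H : hypergraph N) :
  edges H = [set e i | i : 'I_n] ->
  has_poincare_series k H ((1 + 'X) ^+ N) (\sum_(I : {set 'I_n}) chain_term I).
Proof.
move=> edgesE; have pin := private_vertex_in; have pout := private_vertex_out.
rewrite -taylor_poly_index //; apply: private_vertices_poincare.
- exact: edge_at_self.
- exact: edge_at_private.
- move=> _ /imsetP[i _ ->]; rewrite edge_atE //.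
  by apply: leq_ltn_trans (e_large i); rewrite -{1}(muln1 1%N) leq_mul.
- by rewrite edge_at_image.
Qed.

Lemma chain_termE (I : {set 'I_n}) (r : 'I_n -> nat) :
  (forall i j, i \in I -> j \in I -> nxt i j -> (r i < r j)%N) ->
  chain_term I = run_term #|I| #|ends nxt I|.
Proof.
move=> rI; rewrite /chain_term /clique_term.
rewrite (card_comps_ends private_vertex_in private_vertex_out nxt_fun chain_meetE rI).
by rewrite card_imset //; apply: pv_inj private_vertex_in private_vertex_out.
Qed.

(** The full cycle is connected though it has no end. *)
Lemma chain_term_cycle : (0 < n)%N -> (forall i j, connect nxt i j) ->
  chain_term setT = - 'X^(n + 1).
Proof.
move=> n0 cyc; rewrite /chain_term /clique_term.
rewrite (conn_full_cycle private_vertex_in private_vertex_out chain_meetE n0 cyc).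
rewrite card_imset ?cardsT ?card_ord ?expr1 ?scaleN1r //.
exact: pv_inj private_vertex_in private_vertex_out.
Qed.

End ChainOfEdges.

Lemma hyperline_poincare (k : fieldType) (n N d a : nat) (H : hypergraph N) :
  (1 <= a)%N -> (2 * a < d)%N -> (1 <= n)%N -> hyperline n d a H ->
  has_poincare_series k H ((1 + 'X) ^+ (n * (d - a) + a))
    (1 + \sum_(1 <= i < n.+1) \sum_(1 <= r < i.+1)
           ((-1) ^+ r * 'C(i - 1, r - 1)%:R * 'C(n - i + 1, r)%:R) *: 'X^(i + r)).
Proof.
move=> a0 ad n0 [EN [e [_ edgesE card_e card_meet]]].
have -> : (n * (d - a) + a)%N = N.
  rewrite EN; case: n n0 {e edgesE card_e card_meet EN} => // n _.
  have -> : d = (d - a + a)%N by rewrite subnK // ltnW // (leq_ltn_trans _ ad) // leq_pmull.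
  by rewrite subn1 addnK /= mulnDr [(n.+1 * a)%N]mulSn addnA addnK.
pose nxt (i j : 'I_n) := j == i.+1 :> nat.
have nxt_fun i j j' : nxt i j -> nxt i j' -> j = j' by move=> /eqP E /eqP E'; apply: val_inj;
  rewrite /= E E'.
have nxt_inj i i' j : nxt i j -> nxt i' j -> i = i'.
  by move=> /eqP E /eqP; rewrite E => -[] /val_inj.
have e_large i : (2 * a < #|e i|)%N by rewrite card_e.
have := chain_poincare nxt_fun nxt_inj a0 card_meet e_large k edgesE.
rewrite -path_runs_sum -bits_of_sum; congr has_poincare_series.
apply: eq_bigr => I _; rewrite count_bits_of (@runs_bits_of _ _ _ nxt).
  apply: (@chain_termE _ _ _ _ _ _ _ _ _ _ _ val) => // i j _ _ /eqP Ej; by rewrite /= Ej.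
move=> i iI; case: (ltnP i.+1 n) => [lt_in|le_ni].
  rewrite (nth_bits_of false _ (Ordinal lt_in));
    apply/idP/forall_inP => [iN j jI|/(_ (Ordinal lt_in))].
    by apply: contra iN => /eqP Ej; rewrite (_ : Ordinal lt_in = j) //; apply: val_inj.
  by move=> no_next; apply/negP => /no_next; rewrite /nxt eqxx.
rewrite nth_default ?size_bits_of //; apply/esym/forall_inP => j _.
by apply: contraTN (ltn_ord j) => /eqP ->; rewrite -leqNgt.
Qed.

Lemma connect_cycle n (nxt : rel 'I_n) :
  (forall i j : 'I_n, nxt i j = (j == i.+1 %[mod n])) ->
  forall i j, connect nxt i j.
Proof.
move=> nxtE i j; have n0 : (0 < n)%N := leq_ltn_trans (leq0n i) (ltn_ord i).
have reach m : connect nxt i (Ordinal (ltn_pmod (i + m) n0)).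
  elim: m => [|m IH].
    by rewrite (_ : Ordinal _ = i) ?connect0 //; apply: val_inj; rewrite /= addn0 modn_small.
  apply: connect_trans IH (connect1 _).
  by rewrite nxtE /= modn_mod addnS -(addn1 (_ %% _)%N) modnDml addn1.
have := reach (n - i + j)%N; congr (connect _ _ _); apply: val_inj => /=.
by rewrite addnA subnKC 1?ltnW // modnDl modn_small.
Qed.

Lemma hypercycle_poincare (k : fieldType) (n N d a : nat) (H : hypergraph N) :
  (1 <= a)%N -> (2 * a < d)%N -> (3 <= n)%N -> hypercycle n d a H ->
  has_poincare_series k H ((1 + 'X) ^+ (n * (d - a)))
    (1 + \sum_(1 <= i < n) \sum_(1 <= r < i.+1)
           ((-1) ^+ r * (n%:R / r%:R) * 'C(i - 1, r - 1)%:R * 'C(n - i - 1, r - 1)%:R)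
             *: 'X^(i + r) - 'X^(n + 1)).
Proof.
move=> a0 ad n3 [EN _ [e [_ edgesE card_e card_meet]]]; rewrite -EN.
have n0 : (0 < n)%N by apply: leq_trans n3.
pose nxt (i j : 'I_n) := (j == i.+1 %[mod n])%N.
have mod_inj (i j : 'I_n) : i = j %[mod n] -> i = j by rewrite !modn_small // => /val_inj.
have nxt_fun i j j' : nxt i j -> nxt i j' -> j = j'.
  by move=> /eqP Ej /eqP Ej'; apply: mod_inj; rewrite Ej Ej'.
have nxt_inj i i' j : nxt i j -> nxt i' j -> i = i'.
  move=> /eqP + /eqP E; rewrite E => /eqP.
  by rewrite -(addn1 i) -(addn1 i') eqn_modDr => /eqP/mod_inj.
have e_large i : (2 * a < #|e i|)%N by rewrite card_e.
have cyc : forall i j, connect nxt i j by apply: connect_cycle.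
have := chain_poincare nxt_fun nxt_inj a0 card_meet e_large k edgesE.
congr has_poincare_series; set rhs := (X in _ = X).
pose f b := run_term (count id b) (runs (head false b) b).
have -> : rhs = \sum_(I : {set 'I_n}) f (bits_of I) - 'X^n - 'X^(n + 1).
  by rewrite bits_of_sum cycle_runs_sum // addrK.
have fE I : f (bits_of I) = run_term #|I| #|ends nxt I|.
  rewrite /f count_bits_of; congr run_term; apply: runs_bits_of => i iI.
  set s := Ordinal (ltn_pmod i.+1 n0).
  have -> : nth (head false (bits_of I)) (bits_of I) i.+1 = (s \in I).
    case: (ltnP i.+1 n) => [lt_in|le_ni].
      rewrite (nth_bits_of _ _ (Ordinal lt_in)); congr (_ \in I).
      by apply: val_inj; rewrite /= modn_small.
    rewrite nth_default ?size_bits_of // -nth0 (nth_bits_of _ _ (Ordinal n0)); congr (_ \in I).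
    apply: val_inj => /=; have -> : i.+1 = n by apply/eqP; rewrite eqn_leq le_ni ltn_ord.
    by rewrite modnn.
  apply/idP/forall_inP => [sI j jI|/(_ s)].
    apply: contra sI => /eqP Ej; rewrite (_ : s = j) //; apply: mod_inj.
    by rewrite /= modn_mod Ej.
  by move=> no_next; apply/negP => /no_next; rewrite /nxt /= modn_mod eqxx.
(* The set of all edges is the only one where the number of ends, 0, is not the number
   of components, 1. *)
rewrite (bigD1 setT) //= [in RHS](bigD1 setT) //= (chain_term_cycle nxt_fun nxt_inj a0 card_meet
  e_large n0 cyc) //.
have ends0 : ends nxt setT = set0.
  apply/setP => i; rewrite !inE; apply/negbTE/forall_inPn.
  by exists (Ordinal (ltn_pmod i.+1 n0)); rewrite ?inE // negbK /nxt /= modn_mod eqxx.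
rewrite fE ends0 cards0 cardsT card_ord /run_term expr0 scale1r addn0.
rewrite [RHS]addrC; congr (_ + _); rewrite addrAC subrr add0r.
apply: eq_bigr => I IT; rewrite fE.
have [x xI] : exists x, x \notin I.
  by apply/existsP; apply: contraR IT => /existsPn xI; apply/eqP/setP => x; rewrite inE;
    have := xI x; rewrite negbK.
(* Cutting the cycle at x makes nxt increasing: (i - x - 1) mod n is the number of
   steps from x + 1 to i. *)
apply: (@chain_termE _ _ _ _ _ _ _ _ _ _ _ (fun i => (i + (n - x.+1)) %% n)%N) =>
  // i j iI jI /eqP Ej.
have -> : ((j + (n - x.+1)) %% n = ((i + (n - x.+1)) %% n).+1 %% n)%N.
  by rewrite -modnDml Ej modnDml -[in RHS]addn1 modnDml addn1 addSn.
have := ltn_pmod (i + (n - x.+1)) n0; rewrite leq_eqVlt => /orP[/eqP E|lt_n]; last first.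
  by rewrite [X in (_ < X)%N]modn_small.
case/negP: xI; rewrite (_ : x = i) //; apply: mod_inj; apply/eqP.
rewrite -(eqn_modDr (n - x.+1)) -(eqn_modDr 1) !addn1 -addSn subnKC //.
by rewrite modnn -addn1 -modnDml addn1 E modnn.
Qed.

Theorem theorem3p1 (k : fieldType) (a d : nat) :
  (1 <= a)%N -> (2 * a < d)%N ->
  (forall (n N : nat) (H : hypergraph N), (3 <= n)%N -> hypercycle n d a H ->
     has_poincare_series k H
       ((1 + 'X) ^+ (n * (d - a)))
       (1 + \sum_(1 <= i < n) \sum_(1 <= r < i.+1)
              ((-1) ^+ r * (n%:R / r%:R)
                 * 'C(i - 1, r - 1)%:R * 'C(n - i - 1, r - 1)%:R) *: 'X^(i + r)
          - 'X^(n + 1)))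
  /\
  (forall (n N : nat) (H : hypergraph N), (1 <= n)%N -> hyperline n d a H ->
     has_poincare_series k H
       ((1 + 'X) ^+ (n * (d - a) + a))
       (1 + \sum_(1 <= i < n.+1) \sum_(1 <= r < i.+1)
              ((-1) ^+ r * 'C(i - 1, r - 1)%:R * 'C(n - i + 1, r)%:R)
                *: 'X^(i + r))).
Proof.
move=> a_gt0 lt_ad; split=> n N H n_large HH.
  exact: hypercycle_poincare.
exact: hyperline_poincare.
Qed.
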